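(* Let $X\subseteq\mathbb P(\mathcal L)$ be an irreducible projective variety and $F$ a homogeneous polynomial on $\mathcal L$. Then $\mathrm{MLD}_F(X)=1$ if and only if there exists a dominant rational map $\Psi:\mathcal L^*\dashrightarrow C_X$ such that (a) $\Psi(t\mathbf u)=t^{-1}\Psi(\mathbf u)$ for all $t\in\mathbb C\setminus\{0\}$, and (b) $\nabla_{\mathbf u}\log(F\circ\Psi)=-\Psi(\mathbf u)$ for general $\mathbf u\in\mathcal L^*$ (where the gradient of a function on $\mathcal L^*$ is viewed as an element of $(\mathcal L^* )^*=\mathcal L$). In this case $\Psi=\mathrm{MLE}_{X,\mathcal L,F}$.
   Context: Let $\mathcal L$ be a finite-dimensional complex vector space with dual $\mathcal L^*$. For a polynomial $F$ on $\mathcal L$, $\mathbf u\in\mathcal L^*$, $p\in\mathcal L\setminus V(F)$, the log-likelihood is $\ell_{F,\mathbf u}(p)=\log F(p)-\mathbf u(p)$ (gradient $\nabla_pF/F(p)-\mathbf u$). For an irreducible affine variety $Y\subseteq\mathcal L$, $\mathrm{MLD}_F(Y)$ is the number of $p\in Y^{\mathrm{sm}}\setminus V(F)$ with $T_pY\subseteq\ker(\nabla_p\ell_{F,\mathbf u})$ for general $\mathbf u$. For an irreducible projective $X\subseteq\mathbb P(\mathcal L)$ with affine cone $C_X$ and homogeneous $F$, $\mathrm{MLD}_F(X):=\mathrm{MLD}_F(C_X)$. When $\mathrm{MLD}_F(X)=1$, $\mathrm{MLE}_{X,\mathcal L,F}:\mathcal L^*\dashrightarrow C_X^{\mathrm{sm}}\setminus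 V(F)$ sends a general $\mathbf u$ to the unique critical point of $\ell_{F,\mathbf u}$ along $C_X$. *)

(* Defs.v *)
From HB Require Import structures.
From mathcomp Require Import all_boot all_order all_algebra.
From mathcomp Require Import all_classical all_reals all_analysis.
From mathcomp Require Import complex.
From mathcomp Require mpoly.
Import -(notations) mpoly.

Set Implicit Arguments.
Unset Strict Implicit.
Unset Printing Implicit Defensive.

Import GRing.Theory Num.Theory.
Local Open Scope ring_scope.
Local Open Scope classical_set_scope.

(* Throughout: the field of complex numbers is  R[i]  for R : realType,
   L = C^n with coordinates (points are row vectors 'rV[C]_n), and
   L^* = C^n via the dual basis: u(p) = \sum_i u_i p_i.                   *)

Section MLDefs.
Variables (R : realType) (n : nat).
Local Notation C := (R[i]).
Local Notation pt := 'rV[C]_n.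
Local Notation poly := (mpoly.mpoly n C).

Definition peval (f : poly) (p : pt) : C := mpoly.meval (fun i => p ord0 i) f.

Definition pgrad (f : poly) (p : pt) : pt := \row_i peval (mpoly.mderiv i f) p.

Definition homogeneous (f : poly) : Prop :=
  exists d : nat, f \is @mpoly.ishomog1 n C d (mpoly.mpoly_mdeg__canonical__mpoly_Measure n).

Definition zero_locus (S : set poly) : set pt :=
  [set p | forall f, S f -> peval f p = 0].

Definition zclosed (Z : set pt) : Prop := exists S, Z = zero_locus S.

Definition irreducible_variety (Z : set pt) : Prop :=
  [/\ Z !=set0, zclosed Z &
      forall Z1 Z2, zclosed Z1 -> zclosed Z2 -> Z `<=` Z1 `|` Z2 ->
        Z `<=` Z1 \/ Z `<=` Z2].

(* Z is the affine cone C_X of an irreducible projective variety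
   X \subseteq P(L): Z is an irreducible affine variety cut out by
   homogeneous polynomials, containing a nonzero point (X nonempty). *)
Definition affine_cone_of_proj_variety (Z : set pt) : Prop :=
  [/\ irreducible_variety Z,
      (exists S, (forall f, S f -> homogeneous f) /\ Z = zero_locus S) &
      exists p, Z p /\ p != 0].

Definition vanishing (Z : set pt) : set poly :=
  [set f | forall p, Z p -> peval f p = 0].

Definition tangent_space (Z : set pt) (p : pt) : set pt :=
  [set v | forall f, vanishing Z f -> \sum_i (pgrad f p) ord0 i * v ord0 i = 0].

Definition subspace_dim (W : set pt) (k : nat) : Prop :=
  exists B : 'M[C]_(k, n), row_free B /\ forall v, W v <-> (v <= B)%MS.

Definition irr_chain (Z : set pt) (k : nat) : Prop :=
  exists Zs : nat -> set pt,
    [/\ forall j, (j <= k)%N -> irreducible_variety (Zs j),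
        forall j, (j < k)%N -> Zs j `<` Zs j.+1 & Zs k = Z].

Definition variety_dim (Z : set pt) (k : nat) : Prop :=
  irr_chain Z k /\ ~ irr_chain Z k.+1.

Definition smooth_point (Z : set pt) (p : pt) : Prop :=
  Z p /\ exists k, variety_dim Z k /\ subspace_dim (tangent_space Z p) k.

(* critical points of l_{F,u}(p) = log F(p) - u(p) along Y:
   p in Y^sm \ V(F) with T_p Y \subseteq ker (grad_p F / F(p) - u) *)
Definition crit_points (F : poly) (Y : set pt) (u : pt) : set pt :=
  [set p | [/\ smooth_point Y p, peval F p != 0 &
     forall v, tangent_space Y p v ->
       \sum_i v ord0 i * ((pgrad F p) ord0 i / peval F p - u ord0 i) = 0]].

Definition general (P : pt -> Prop) : Prop :=
  exists g : poly, g != 0 /\ forall u, peval g u != 0 -> P u.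

Definition MLD_eq (F : poly) (Y : set pt) (d : nat) : Prop :=
  general (fun u => exists s : seq pt,
    [/\ uniq s, size s = d & forall p, crit_points F Y u p <-> p \in s]).

(* ----- rational maps L^* -|-> L, given by numerators N_i and a common
   nonzero denominator D:  Psi(u) = (N_i(u) / D(u))_i, defined where
   D(u) <> 0 ----- *)
Definition rdom (D : poly) (u : pt) : Prop := peval D u != 0.

Definition reval (N : 'I_n -> poly) (D : poly) (u : pt) : pt :=
  \row_i (peval (N i) u / peval D u).

Definition rational_map_to (N : 'I_n -> poly) (D : poly) (Y : set pt) : Prop :=
  D != 0 /\ forall u, rdom D u -> Y (reval N D u).

Definition dominant (N : 'I_n -> poly) (D : poly) (Y : set pt) : Prop :=
  forall f : poly, (forall u, rdom D u -> peval f (reval N D u) = 0) ->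
    forall p, Y p -> peval f p = 0.

Definition partial (g : pt -> C) (u : pt) (i : 'I_n) : C :=
  derive1 (fun h : C => (g (u + h *: delta_mx ord0 i) : C^o)) 0.

Definition MLE_like (F : poly) (Y : set pt) (N : 'I_n -> poly) (D : poly) : Prop :=
  [/\ rational_map_to N D Y, dominant N D Y,
      (forall (t : C) u, t != 0 -> rdom D u -> rdom D (t *: u) ->
         reval N D (t *: u) = t^-1 *: reval N D u) &
      (* (b) grad_u log (F o Psi) = - Psi(u) for general u *)
      general (fun u => [/\ rdom D u, peval F (reval N D u) != 0 &
         forall i, partial (fun w => peval F (reval N D w)) u i
                     / peval F (reval N D u) = - reval N D u ord0 i])].

End MLDefs.

(* Main.v *)
(** Let [x] be the generic point of [Y]. Pairs of a general [u] and a critical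
    point [p] are the specialisations of [(U, x)], where
    [U = grad F / F (x) + sum_k c_k grad f_k (x)] with new variables [c_k] and
    with [f_k] in [I(Y)] spanning the conormal space at [x]. If the degree is
    one, then [U] is algebraically free, and a coordinate of [x] outside the
    field of rational functions of [U] would specialise to two distinct values
    over a general [u]; hence [x = Psi (U)] for a rational map [Psi]. Property
    (a) is the behaviour of critical points under scaling, and (b) follows by
    differentiating [u . Psi u = deg F] along the tangent vectors [d_k Psi].

    Conversely, (b) makes the Jacobian matrix of [Psi] symmetric, and with (a)
    it shows that [grad F / F (Psi) - u] kills the image of [d Psi]. In
    characteristic zero derivations extend along [C(Psi) <= C(u)], so this image
    is the tangent space at [Psi u], and [Psi u] is critical. By symmetry [Psi]
    is constant along the conormal directions [grad f (Psi u)], so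
    [Psi (grad F / F (p) + grad f (p)) = p] holds on the dense image of [Psi],
    hence at every critical point [p]. *)

Require Import Defs.
From HB Require Import structures.
From mathcomp Require Import all_boot all_order all_algebra.
From mathcomp Require Import all_classical all_reals all_analysis.
From mathcomp Require Import complex.
From mathcomp Require Import ring.
From mathcomp Require mpoly.
Import -(notations) mpoly.

Set Implicit Arguments.
Unset Strict Implicit.
Unset Printing Implicit Defensive.

Import GRing.Theory Num.Theory.
Local Open Scope ring_scope.
Local Open Scope classical_set_scope.

(** * Specialization of algebraic and transcendental elements *)

(** One device passes between generic and closed points: a homomorphism [phi] from a ring [A] to a
    field is specialised to some [beta] whose kernel contains [ker phi], one coordinate at a time,
    at the cost of one element of [A] that must stay nonzero under [beta]. Each coordinate enlarges
    [A] to a polynomial ring whose map to the field need not be injective, so division takes place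
    in [A] up to powers of leading coefficients and modulo [ker phi].

    A second obstacle is smoothness, which compares a tangent space with the length of chains of
    irreducible closed sets. Both numbers are matched with the size of a largest algebraically
    independent set of coordinates, the former by extending derivations, the latter by generic
    hyperplane sections.

    A third is that (b) speaks of complex derivatives, while the converse works with derivations of
    the field of rational functions. Fractions whose denominators have no zero on a given set carry
    identities across in both directions. *)

Section HornerAt.
Variables (A M : comNzRingType) (phi : {rmorphism A -> M}) (z : M).

Definition horner_at (p : {poly A}) : M := (map_poly phi p).[z].

Lemma horner_at_is_additive : additive horner_at.
Proof. by move=> p q; rewrite /horner_at rmorphB hornerD hornerN. Qed.

Lemma horner_at_is_multiplicative : multiplicative horner_at.
Proof.
by split=> [p q|]; rewrite /horner_at ?rmorphM ?rmorph1 ?hornerM ?hornerC.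
Qed.

HB.instance Definition _ := GRing.isAdditive.Build {poly A} M horner_at
  horner_at_is_additive.
HB.instance Definition _ := GRing.isMultiplicative.Build {poly A} M horner_at
  horner_at_is_multiplicative.

Lemma horner_atC a : horner_at a%:P = phi a.
Proof. by rewrite /horner_at map_polyC hornerC. Qed.

Lemma horner_atX : horner_at 'X = z.
Proof. by rewrite /horner_at map_polyX hornerX. Qed.

End HornerAt.

Section MinimalRelation.
Variables (A : comNzRingType) (M : fieldType) (phi : {rmorphism A -> M}) (z : M).
Local Notation horner_at := (horner_at phi z).

(** A minimal polynomial of [z] over the fraction field of the image of [phi], with coefficients
    kept in [A] so that another homomorphism can be applied to them. A shorter relation need not be
    zero: it only becomes zero under [phi]. *)
Definition minimal_relation (g : {poly A}) : Prop :=
  [/\ phi (lead_coef g) != 0, horner_at g = 0 &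
      forall h : {poly A}, (size h < size g)%N -> horner_at h = 0 -> map_poly phi h = 0].

(** Dropping top coefficients in [ker phi] makes the degree in [A] equal to the degree over [M]; the
    leading coefficient then survives [phi] and can serve in pseudo-division. *)
Lemma strip_poly p : exists q,
  map_poly phi q = map_poly phi p /\ size q = size (map_poly phi p).
Proof.
pose q := \poly_(i < size (map_poly phi p)) p`_i.
have eq_qp : map_poly phi q = map_poly phi p.
  apply/polyP => i; rewrite !coef_map coef_poly; case: ltnP => // le_pi.
  by rewrite raddf0 -coef_map nth_default.
exists q; split=> //; apply/eqP; rewrite eqn_leq size_poly /= -eq_qp.
exact: size_poly.
Qed.

Lemma strip_lead_coef p : map_poly phi p != 0 ->
  size p = size (map_poly phi p) -> phi (lead_coef p) != 0.
Proof.
move=> p_neq0 eq_size; move: p_neq0; rewrite -lead_coef_eq0 lead_coefE coef_map.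
by rewrite -eq_size -lead_coefE.
Qed.

Lemma map_poly_lead_neq0 p : phi (lead_coef p) != 0 -> map_poly phi p != 0.
Proof.
apply: contraNneq => p_eq0.
by rewrite lead_coefE -coef_map p_eq0 coef0.
Qed.

Lemma minimal_relation_exists :
  (exists2 h, horner_at h = 0 & map_poly phi h != 0) ->
  exists g, minimal_relation g.
Proof.
move=> [h h_z h_neq0].
pose P k := `[< exists h : {poly A}, [/\ size h = k, horner_at h = 0 & map_poly phi h != 0] >].
have exP : exists k, P k by exists (size h); apply/asboolP; exists h.
case: (ex_minnP exP) => k /asboolP[g [g_size g_z g_neq0]] k_min.
have [g' [eq_g' size_g']] := strip_poly g.
have Pg' : P (size g').
  by apply/asboolP; exists g'; split=> //; rewrite /horner_at eq_g'.
exists g'; split.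
- by apply: strip_lead_coef; rewrite eq_g'.
- by rewrite /horner_at eq_g'.
move=> q lt_qg' q_z; apply/eqP; apply: contraTT lt_qg' => q_neq0.
rewrite -leqNgt; apply: (@leq_trans k).
  rewrite -g_size size_g'; exact: size_poly.
by apply: k_min; apply/asboolP; exists q.
Qed.

Lemma lead_neq0 (p : {poly A}) : phi (lead_coef p) != 0 -> p != 0.
Proof. by apply: contraNneq => ->; rewrite lead_coef0 raddf0. Qed.

Lemma pseudo_division (g h : {poly A}) : g != 0 -> exists k q r,
  (lead_coef g ^+ k)%:P * h = q * g + r /\ (size r < size g)%N.
Proof.
move=> g_neq0; exists (Pdiv.Ring.rscalp h g), (Pdiv.Ring.rdivp h g), (Pdiv.Ring.rmodp h g).
by rewrite mul_polyC Pdiv.ComRing.rdivp_eq Pdiv.Ring.ltn_rmodp.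
Qed.

Lemma minimal_relation_divides g h : minimal_relation g -> horner_at h = 0 ->
  exists k q r, (lead_coef g ^+ k)%:P * h = q * g + r /\ map_poly phi r = 0.
Proof.
move=> [g_lead g_z g_min] h_z.
have [k [q [r [eq_h lt_r]]]] := pseudo_division h (lead_neq0 g_lead).
exists k, q, r; split=> //; apply: g_min => //.
have := congr1 horner_at eq_h.
by rewrite rmorphM rmorphD rmorphM /= h_z g_z !mulr0 add0r.
Qed.

(** Bezout's identity modulo [g]. It trades the condition that [v] is nonzero at [z] for the
    condition that a constant [a] is nonzero, which no longer mentions [z]. After a reduction modulo
    [g], the algorithm always divides [g] by the current polynomial, whose degree drops until it is
    constant. *)
Lemma minimal_relation_coprime g v : minimal_relation g -> horner_at v != 0 ->
  exists s a, phi a != 0 /\ horner_at (s * v - a%:P) = 0.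
Proof.
move=> g_rel; have [g_lead g_z g_min] := g_rel.
have small n : forall v : {poly A}, (size v < n)%N -> (size v < size g)%N ->
    horner_at v != 0 -> exists s a, phi a != 0 /\ horner_at (s * v - a%:P) = 0.
  elim: n => // n IHn {}v lt_vn lt_vg v_z.
  have [w [eq_wv size_w]] := strip_poly v.
  have w_z : horner_at w = horner_at v by rewrite /horner_at eq_wv.
  have w_neq0 : map_poly phi w != 0.
    by apply: contraNneq v_z; rewrite -w_z /horner_at => ->; rewrite horner0.
  have le_wv : (size w <= size v)%N by rewrite size_w; exact: size_poly.
  have w_lead : phi (lead_coef w) != 0.
    by apply: strip_lead_coef; rewrite // eq_wv.
  have [size_w1|size_w1] := leqP (size w) 1.
    exists 1, (lead_coef w); split=> //.
    rewrite mul1r rmorphB /= -w_z horner_atC (size1_polyC size_w1).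
    by rewrite horner_atC lead_coefC subrr.
  have [k [q [r [eq_g lt_r]]]] := pseudo_division g (lead_neq0 w_lead).
  have r_z : horner_at r = - (horner_at q * horner_at w).
    have := congr1 horner_at eq_g; rewrite rmorphM rmorphD rmorphM /= g_z mulr0.
    by move/eqP; rewrite eq_sym addrC addr_eq0 => /eqP.
  have [r_z0|r_z0] := eqVneq (horner_at r) 0; last first.
    have [||s [a [a_neq0 sa]]] := IHn r _ _ r_z0.
    - by rewrite -ltnS; apply: leq_trans lt_vn; rewrite ltnS (leq_trans lt_r).
    - by rewrite (ltn_trans lt_r) // (leq_ltn_trans le_wv).
    exists (- s * q), a; split=> //; rewrite -sa !rmorphB !rmorphM rmorphN /= r_z -w_z.
    by rewrite mulrN mulNr mulNr mulrA.
  (* The remaining case is absurd: over [M] the factor [q] of a multiple of [g] would be nonzero,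
     shorter than [g] since [w] is not constant, and zero at [z]. *)
  have r_map0 : map_poly phi r = 0.
    by apply: g_min => //; rewrite (ltn_trans lt_r) // (leq_ltn_trans le_wv).
  have q_z0 : horner_at q = 0.
    move: r_z; rewrite r_z0 => /esym/eqP; rewrite oppr_eq0 mulf_eq0.
    by rewrite w_z (negbTE v_z) orbF => /eqP.
  have g_neq0 : map_poly phi g != 0 by exact: map_poly_lead_neq0.
  have := congr1 (map_poly phi) eq_g.
  rewrite rmorphM rmorphD rmorphM /= r_map0 addr0 map_polyC /= => eq_map.
  have lc_neq0 : phi (lead_coef w ^+ k) != 0 by rewrite rmorphXn expf_neq0.
  have q_neq0 : map_poly phi q != 0.
    apply: contra_eq_neq eq_map => ->; rewrite mul0r.
    by rewrite mulf_neq0 // polyC_eq0.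
  have lt_qg : (size (map_poly phi q) < size g)%N.
    have := congr1 (fun p : {poly M} => size p) eq_map.
    rewrite mul_polyC size_scale // size_mul // eq_wv -size_w => size_g.
    have : (size (map_poly phi g) <= size g)%N by exact: size_poly.
    rewrite size_g; apply: leq_trans.
    by case: (size w) size_w1 => [|[|m]] // _; rewrite !addnS /= ltnS leq_addr.
  have [q' [eq_q' size_q']] := strip_poly q.
  have q'0 : map_poly phi q' = 0.
    by apply: g_min; [rewrite size_q' | rewrite /horner_at eq_q'].
  by move: q_neq0; rewrite -eq_q' q'0 eqxx.
move=> v_z; have [k [q [r [eq_v lt_r]]]] := pseudo_division v (lead_neq0 g_lead).
have r_z : horner_at r = phi (lead_coef g ^+ k) * horner_at v.
  have := congr1 horner_at eq_v; rewrite rmorphD !rmorphM /= g_z mulr0 add0r.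
  by rewrite horner_atC => ->.
have [|s [a [a_neq0 sa]]] := small (size r).+1 r (ltnSn _) lt_r.
  by rewrite r_z mulf_neq0 // rmorphXn expf_neq0.
exists (s * (lead_coef g ^+ k)%:P), a; split=> //.
by rewrite -sa !rmorphB !rmorphM /= horner_atC r_z mulrA.
Qed.

Section Specialize.
Variables (L : fieldType) (beta : {rmorphism A -> L}).
Hypothesis ker_phi : forall a, phi a = 0 -> beta a = 0.

Lemma map_poly_ker p : map_poly phi p = 0 -> map_poly beta p = 0.
Proof.
move=> p0; apply/polyP => i; rewrite coef_map coef0; apply: ker_phi.
by rewrite -coef_map p0 coef0.
Qed.

(** Every relation at [z] is a multiple of [g] up to a power of its leading coefficient and terms in
    [ker phi], so one root of the image of [g] satisfies them all. *)
Lemma minimal_relation_specialize g xi h : minimal_relation g ->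
  beta (lead_coef g) != 0 -> root (map_poly beta g) xi ->
  horner_at h = 0 -> (map_poly beta h).[xi] = 0.
Proof.
move=> g_rel g_lead /eqP g_xi h_z.
have [k [q [r [eq_h r0]]]] := minimal_relation_divides g_rel h_z.
have := congr1 (fun p => (map_poly beta p).[xi]) eq_h.
rewrite rmorphM rmorphD rmorphM /= map_polyC /= hornerM hornerD hornerM g_xi.
rewrite (map_poly_ker r0) horner0 mulr0 add0r hornerC => /eqP.
by rewrite rmorphXn mulf_eq0 expf_eq0 (negbTE g_lead) andbF => /eqP.
Qed.

End Specialize.
End MinimalRelation.

Definition specializes (A : comNzRingType) (M L : fieldType)
    (phi : {rmorphism A -> M}) (beta : {rmorphism A -> L}) : Prop :=
  forall a, phi a = 0 -> beta a = 0.

Definition has_roots (L : fieldType) : Prop :=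
  forall p : {poly L}, (1 < size p)%N -> exists x, root p x.

Lemma single_root_power (L : fieldType) (p : {poly L}) (x : L) :
  has_roots L -> p != 0 -> (forall y, root p y -> y = x) ->
  p = lead_coef p *: ('X - x%:P) ^+ (size p).-1.
Proof.
move=> L_roots; have [n] := ubnP (size p); elim: n p => // n IHn p lt_pn p_neq0 p_x.
have [size_p1|size_p1] := leqP (size p) 1.
  have -> : (size p).-1 = 0%N by case: (size p) size_p1 => [|[]].
  rewrite expr0 alg_polyC {1}(size1_polyC size_p1); congr _%:P.
  by rewrite {2}(size1_polyC size_p1) lead_coefC.
have [y p_y] := L_roots p size_p1.
have {p_y} : root p x by rewrite -(p_x y).
move=> /factor_theorem[q eq_p].
have q_neq0 : q != 0 by apply: contraNneq p_neq0 => q0; rewrite eq_p q0 mul0r.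
have size_p : size p = (size q).+1.
  by rewrite eq_p size_mul ?polyXsubC_eq0 // size_XsubC addn2.
rewrite {1}eq_p (IHn q) //; last 2 first.
- by rewrite -ltnS -size_p.
- by move=> t q_t; apply: p_x; rewrite eq_p rootM q_t.
rewrite -scalerAl -exprSr eq_p lead_coefM lead_coefXsubC mulr1 -eq_p size_p prednK //.
by rewrite size_poly_gt0.
Qed.

Lemma coef_XsubC_exp (L : fieldType) (x : L) d :
  (('X - x%:P) ^+ d.+1)`_d = - (d.+1%:R * x).
Proof.
have lead m : (('X - x%:P) ^+ m)`_m = 1.
  have /monicP := monic_exp m (monicXsubC x).
  by rewrite lead_coefE size_exp_XsubC.
elim: d => [|d IHd]; first by rewrite expr1 coefB coefX coefC sub0r mul1r.
rewrite exprSr mulrBr coefB coefMX /= coefMC IHd lead mul1r.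
by rewrite -[d.+2]addn1 natrD mulrDl mul1r opprD.
Qed.

Lemma exists_nonroot (L : fieldType) (p : {poly L}) : has_roots L -> p != 0 ->
  exists x, p.[x] != 0.
Proof.
move=> L_roots p_neq0; have [size_p|size_p] := leqP (size p) 1.
  exists 0; rewrite (size1_polyC size_p) hornerC.
  by apply: contraNneq p_neq0 => p0; rewrite (size1_polyC size_p) p0.
have [|x /eqP] := L_roots (p - 1%:P).
  by rewrite -polyCN size_polyDl // (leq_ltn_trans (size_polyC_leq1 _)).
rewrite hornerD hornerN hornerC => /eqP; rewrite subr_eq0 => /eqP p_x.
by exists x; rewrite p_x oner_neq0.
Qed.

Section SpecializeStep.
Variables (A : comNzRingType) (M L : fieldType) (phi : {rmorphism A -> M}) (z : M).
Hypothesis L_roots : has_roots L.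

Lemma transcendental_or_algebraic :
  (forall h, horner_at phi z h = 0 -> map_poly phi h = 0) \/
  exists g, minimal_relation phi z g.
Proof.
have [[h h_z h_neq0]|no_rel] :=
    pselect (exists2 h, horner_at phi z h = 0 & map_poly phi h != 0).
  by right; apply: minimal_relation_exists; exists h.
left=> h h_z; apply/eqP/negP => h_neq0; apply: no_rel; exists h => //.
exact/negP.
Qed.

Lemma transcendental_specialize v :
    (forall h, horner_at phi z h = 0 -> map_poly phi h = 0) ->
    horner_at phi z v != 0 ->
  exists u, phi u != 0 /\ forall beta : {rmorphism A -> L},
    specializes phi beta -> beta u != 0 ->
    map_poly beta v != 0 /\
    forall xi, specializes (horner_at phi z) (horner_at beta xi).
Proof.
move=> z_tr v_z.
have v_neq0 : map_poly phi v != 0.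
  by apply: contraNneq v_z; rewrite /horner_at => ->; rewrite horner0.
exists v`_(size (map_poly phi v)).-1; split.
  by rewrite -coef_map -lead_coefE lead_coef_eq0.
move=> beta ker_phi v_beta; split=> [|xi h h_z].
  apply: contraNneq v_beta => v0.
  by rewrite -coef_map /= v0 coef0.
by rewrite /= /horner_at (map_poly_ker ker_phi (z_tr h h_z)) horner0.
Qed.

(** The element [a] of [minimal_relation_coprime] keeps [v] nonzero at every root at once, not
    merely at some root; finding two admissible roots relies on this. *)
Lemma algebraic_specialize g v : minimal_relation phi z g ->
    horner_at phi z v != 0 ->
  exists u, phi u != 0 /\ forall beta : {rmorphism A -> L},
    specializes phi beta -> beta u != 0 ->
    beta (lead_coef g) != 0 /\
    forall xi, root (map_poly beta g) xi ->
      specializes (horner_at phi z) (horner_at beta xi) /\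
      horner_at beta xi v != 0.
Proof.
move=> g_rel v_z; have [g_lead g_z _] := g_rel.
have [s [a [a_neq0 sa]]] := minimal_relation_coprime g_rel v_z.
exists (a * lead_coef g); split=> [|beta ker_phi].
  by rewrite rmorphM mulf_neq0.
rewrite rmorphM mulf_eq0 negb_or => /andP[a_beta g_beta]; split=> // xi g_xi.
have spec h : horner_at phi z h = 0 -> horner_at beta xi h = 0.
  exact: (minimal_relation_specialize ker_phi g_rel).
split=> //; apply: contraNneq a_beta => v_xi.
have := spec _ sa; rewrite rmorphB rmorphM /= v_xi mulr0 horner_atC sub0r.
by move/eqP; rewrite oppr_eq0.
Qed.

Lemma minimal_relation_size g : minimal_relation phi z g -> (1 < size g)%N.
Proof.
move=> [g_lead g_z _]; rewrite ltnNge; apply/negP => size_g.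
move: g_z g_lead; rewrite (size1_polyC size_g) horner_atC lead_coefC => ->.
by rewrite eqxx.
Qed.

Lemma size_map_lead (beta : {rmorphism A -> L}) (g : {poly A}) :
  beta (lead_coef g) != 0 -> size (map_poly beta g) = size g.
Proof.
move=> g_beta; apply: size_map_poly_id0 => //.
Qed.

Lemma specialize_step v : horner_at phi z v != 0 ->
  exists u, phi u != 0 /\ forall beta : {rmorphism A -> L},
    specializes phi beta -> beta u != 0 ->
    exists xi, specializes (horner_at phi z) (horner_at beta xi) /\
      horner_at beta xi v != 0.
Proof.
move=> v_z; have [z_tr|[g g_rel]] := transcendental_or_algebraic.
  have [u [u_neq0 u_spec]] := transcendental_specialize z_tr v_z.
  exists u; split=> // beta ker_phi u_beta.
  have [v_beta spec] := u_spec beta ker_phi u_beta.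
  by have [xi v_xi] := exists_nonroot L_roots v_beta; exists xi.
have [u [u_neq0 u_spec]] := algebraic_specialize g_rel v_z.
exists u; split=> // beta ker_phi u_beta.
have [g_beta spec] := u_spec beta ker_phi u_beta.
have [|xi g_xi] := L_roots (p := map_poly beta g).
  by rewrite size_map_lead // (minimal_relation_size g_rel).
by exists xi; apply: spec.
Qed.

(* If [g] specialises to a polynomial with a single root, it is a constant
   times a power of a linear polynomial, which is a polynomial identity [w]
   between its coefficients; generically the linear factor would have the
   root [z]. *)
Lemma specialize_step_twice v : [pchar M] =i pred0 ->
    (forall a b, phi b != 0 -> z != phi a / phi b) ->
    horner_at phi z v != 0 ->
  exists u, phi u != 0 /\ forall beta : {rmorphism A -> L},
    specializes phi beta -> beta u != 0 ->
    exists x y, [/\ x != y,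
      specializes (horner_at phi z) (horner_at beta x),
      specializes (horner_at phi z) (horner_at beta y),
      horner_at beta x v != 0 & horner_at beta y v != 0].
Proof.
move=> char0 z_irr v_z; have [z_tr|[g g_rel]] := transcendental_or_algebraic.
  have [u [u_neq0 u_spec]] := transcendental_specialize z_tr v_z.
  exists u; split=> // beta ker_phi u_beta.
  have [v_beta spec] := u_spec beta ker_phi u_beta.
  have [x v_x] := exists_nonroot L_roots v_beta.
  have [y] : exists y, (map_poly beta v * ('X - x%:P)).[y] != 0.
    by apply: exists_nonroot; rewrite // mulf_neq0 ?polyXsubC_eq0.
  rewrite hornerM hornerXsubC mulf_eq0 negb_or subr_eq0 => /andP[v_y y_x].
  by exists x, y; rewrite eq_sym y_x.
have [u [u_neq0 u_spec]] := algebraic_specialize g_rel v_z.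
have [g_lead g_z _] := g_rel.
pose d := (size g).-2.
have size_g : size g = d.+2.
  by rewrite /d; case: (size g) (minimal_relation_size g_rel) => [|[]].
(* With [l] the leading coefficient, [l (X - x)^(d+1)] has coefficient [- (d+1) l x] in degree [d].
   So a single root [x] satisfies [c x = - g_d], and then [c^(d+1) g = l (c X + g_d)^(d+1)], that is
   [w = 0]. *)
pose c := lead_coef g *+ d.+1.
pose w : {poly A} := (c ^+ d.+1) *: g - lead_coef g *: (c *: 'X + (g`_d)%:P) ^+ d.+1.
have c_neq0 : phi c != 0.
  by rewrite rmorphMn -mulr_natr mulf_neq0 // (pcharf0P _).1.
have w_neq0 : map_poly phi w != 0.
  apply/negP => /eqP w0.
  have : horner_at phi z w = 0 by rewrite /horner_at w0 horner0.
  rewrite rmorphB -!mul_polyC !rmorphM /= g_z mulr0 sub0r => /eqP.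
  rewrite oppr_eq0 mulf_eq0 horner_atC (negbTE g_lead) rmorphXn expf_eq0 /=.
  rewrite rmorphD rmorphM /= !horner_atC horner_atX addr_eq0 => /eqP eq_z.
  have /eqP := z_irr (- g`_d) _ c_neq0; apply.
  by rewrite rmorphN -eq_z mulrC mulKf.
pose i := (size (map_poly phi w)).-1.
exists (u * w`_i); split=> [|beta ker_phi].
  by rewrite rmorphM mulf_neq0 // -coef_map -lead_coefE lead_coef_eq0.
rewrite rmorphM mulf_eq0 negb_or => /andP[u_beta w_beta].
have [g_beta spec] := u_spec beta ker_phi u_beta.
have size_gb : size (map_poly beta g) = d.+2 by rewrite size_map_lead.
have [|x g_x] := L_roots (p := map_poly beta g); first by rewrite size_gb.
have [[y g_y neq_xy]|one_root] :=
    pselect (exists2 y, root (map_poly beta g) y & x != y).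
  have [spec_x v_x] := spec x g_x; have [spec_y v_y] := spec y g_y.
  by exists x, y.
have gb_neq0 : map_poly beta g != 0 by rewrite -size_poly_gt0 size_gb.
have eq_g : map_poly beta g = beta (lead_coef g) *: ('X - x%:P) ^+ d.+1.
  rewrite {1}(single_root_power (x := x) L_roots gb_neq0); last first.
    move=> y g_y; apply/eqP; apply: contra_notT one_root => neq_yx.
    by exists y => //; rewrite eq_sym.
  by rewrite size_gb lead_coefE size_gb coef_map lead_coefE size_g.
case/negP: w_beta; rewrite -coef_map; suff -> : map_poly beta w = 0 by rewrite coef0.
have -> : map_poly beta w = (beta c ^+ d.+1) *: map_poly beta g -
    beta (lead_coef g) *: (beta c *: 'X + (beta g`_d)%:P) ^+ d.+1.
  rewrite /w -!mul_polyC rmorphB !rmorphM /= !map_polyC /= rmorphXn.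
  by rewrite (rmorphXn (map_poly beta)) /= rmorphD rmorphM /= !map_polyC map_polyX.
have -> : beta g`_d = - (beta c * x).
  rewrite -coef_map /= eq_g coefZ coef_XsubC_exp /c rmorphMn /=.
  by rewrite mulrN mulr_natl mulrnAr mulrnAl.
rewrite eq_g scalerA mulrC -scalerA -exprZn scalerBr polyCN -mul_polyC polyCM.
by rewrite mul_polyC mul_polyC subrr.
Qed.

End SpecializeStep.

(** * Evaluation and specialisation of multivariate polynomials *)

Lemma mpoly_ring_ind n (A : nzRingType) (P : mpoly n A -> Prop) :
  (forall c, P (mpolyC n c)) -> (forall i, P (mpolyX A (mnm1 i))) ->
  (forall p q, P p -> P q -> P (p + q)) ->
  (forall p q, P p -> P q -> P (p * q)) -> forall p, P p.
Proof.
move=> PC PX PD PM; elim/mpolyind => [|c m p _ _ Pp].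
  by rewrite -(mpolyC0 n); apply: PC.
apply: PD => //; rewrite -mul_mpolyC; apply: (PM) => //.
rewrite mpolyXE_id; apply: (big_ind P); [exact: (PC 1)|exact: PM|move=> i _].
by elim: (m i) => [|k IHk]; rewrite ?expr0 ?exprS; [exact: (PC 1)|exact: PM].
Qed.

Lemma mpoly_rmorphism_eq n (A : nzRingType) (S : nzRingType)
    (f g : {rmorphism mpoly n A -> S}) :
  (forall c, f (mpolyC n c) = g (mpolyC n c)) ->
  (forall i, f (mpolyX A (mnm1 i)) = g (mpolyX A (mnm1 i))) -> f =1 g.
Proof.
move=> fgC fgX; elim/mpoly_ring_ind => // p q fp fq.
  by rewrite !rmorphD fp fq.
by rewrite !rmorphM fp fq.
Qed.

Lemma mmapXU n (A S : nzRingType) (f : {rmorphism A -> S}) (h : 'I_n -> S) i :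
  mmap f h (mpolyX A (mnm1 i)) = h i.
Proof. by rewrite mmapX mmap1U. Qed.

Lemma rmorph_mmap n (A S T : comNzRingType) (psi : {rmorphism S -> T})
    (f : {rmorphism A -> S}) (f' : {rmorphism A -> T}) (z : 'I_n -> S) h :
  (forall a, psi (f a) = f' a) -> psi (mmap f z h) = mmap f' (psi \o z) h.
Proof.
move=> psi_f; apply: (mpoly_rmorphism_eq (f := psi \o mmap f z)
  (g := mmap f' (psi \o z))) => [a|i] /=; first by rewrite !mmapC /= psi_f.
by rewrite !mmapXU.
Qed.

Lemma mderivXU n (A : nzRingType) i j :
  mderiv i (mpolyX A (mnm1 j)) = (i == j)%:R :> mpoly n A.
Proof.
rewrite mderivX mnmE eq_sym; case: eqP => [->|_]; last by rewrite scale0r.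
rewrite scale1r -mpolyX0; congr mpolyX.
by apply/mnmP => l; rewrite mnmBE subnn mnm0E.
Qed.

Lemma sum_mderivXU n (A S : nzRingType) (f : {rmorphism mpoly n A -> S})
    (v : 'I_n -> S) j :
  \sum_i f (mderiv i (mpolyX A (mnm1 j))) * v i = v j.
Proof.
rewrite (bigD1 j) //= mderivXU eqxx rmorph1 mul1r big1 ?addr0 // => i /negbTE neq_ij.
by rewrite mderivXU neq_ij raddf0 mul0r.
Qed.

Lemma mpoly0_const (A : nzRingType) (p : mpoly 0 A) : exists c, p = mpolyC 0 c.
Proof.
elim/mpoly_ring_ind: p => [c|[]|_ _ [a ->] [b ->]|_ _ [a ->] [b ->]] //.
- by exists c.
- by exists (a + b); rewrite mpolyCD.
- by exists (a * b); rewrite mpolyCM.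
Qed.

Section Curry.
Variables (A : comNzRingType) (n : nat).

Definition mcurry_var (i : 'I_n.+1) : mpoly n {poly A} :=
  if unlift ord0 i is Some j then mpolyX _ (mnm1 j) else mpolyC n 'X.

Definition mcurry : mpoly n.+1 A -> mpoly n {poly A} :=
  mmap (mpolyC n (R := {poly A}) \o polyC) mcurry_var.

Lemma mmap_mcurry (M : fieldType) (phi : {rmorphism A -> M}) (z : 'I_n.+1 -> M) h :
  mmap phi z h =
  mmap (horner_at phi (z ord0)) (fun j => z (lift ord0 j)) (mcurry h).
Proof.
pose e := mmap (horner_at phi (z ord0)) (fun j => z (lift ord0 j)).
apply: (mpoly_rmorphism_eq (f := mmap phi z) (g := e \o mcurry)) => [c|i] /=.
  by rewrite /e /mcurry !mmapC /= horner_atC.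
rewrite /e /mcurry !mmapXU /mcurry_var; case: unliftP => [j ->|->] /=.
  by rewrite mmapXU.
by rewrite mmapC /= horner_atX.
Qed.

End Curry.

(** Elimination in the manner of Chevalley. The induction hypothesis over [{poly A}] turns [v] into
    a condition on the first coordinate alone, and one more step turns that into a condition in [A].
    With [A] a field this yields the Nullstellensatz. *)
Lemma specialize_mpoly n (M L : fieldType) (A : comNzRingType)
    (phi : {rmorphism A -> M}) (z : 'I_n -> M) (v : mpoly n A) :
    has_roots L -> mmap phi z v != 0 ->
  exists u, phi u != 0 /\ forall beta : {rmorphism A -> L},
    specializes phi beta -> beta u != 0 ->
    exists xi : 'I_n -> L, specializes (mmap phi z) (mmap beta xi) /\
      mmap beta xi v != 0.
Proof.
move=> L_roots; elim: n A phi z v => [|n IHn] A phi z v v_z.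
  have [c eq_v] := mpoly0_const v; exists c; split.
    by move: v_z; rewrite eq_v mmapC.
  move=> beta ker_phi c_beta; exists (fun _ => 0); split; last by rewrite eq_v mmapC.
  move=> h; have [b ->] := mpoly0_const h.
  by rewrite /= !mmapC; apply: ker_phi.
have [|u [u_z u_spec]] :=
  IHn _ (horner_at phi (z ord0)) (fun j => z (lift ord0 j)) (mcurry v).
  by rewrite -mmap_mcurry.
have [u0 [u0_neq0 u0_spec]] := specialize_step L_roots u_z.
exists u0; split=> // beta ker_phi u0_beta.
have [x [x_spec u_x]] := u0_spec beta ker_phi u0_beta.
have [xi [xi_spec v_xi]] := u_spec (horner_at beta x) x_spec u_x.
pose y i := if unlift ord0 i is Some j then xi j else x.
have mmap_y h : mmap beta y h = mmap (horner_at beta x) xi (mcurry h).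
  rewrite mmap_mcurry /y unlift_none; congr mmap.
  by apply: funext => j; rewrite liftK.
exists y; split=> [h|]; rewrite /= mmap_y // mmap_mcurry; exact: xi_spec.
Qed.

(** * Extension of derivations *)

Definition derivation_over (A M : pzRingType) (phi D : A -> M) : Prop :=
  (forall a b, D (a + b) = D a + D b) /\
  (forall a b, D (a * b) = D a * phi b + phi a * D b).

Section DerivationStep.
Variables (A : comNzRingType) (M : fieldType) (phi : {rmorphism A -> M}) (z : M).
Variable D : A -> M.
Hypothesis D_der : derivation_over phi D.

Lemma derivation0 : D 0 = 0.
Proof. by apply: (addrI (D 0)); rewrite -D_der.1 !addr0. Qed.

Lemma derivation1 : D 1 = 0.
Proof.
have := D_der.2 1 1; rewrite mulr1 rmorph1 mulr1 mul1r => D1.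
by apply: (addrI (D 1)); rewrite addr0 -D1.
Qed.

Definition coef_derivation (p : {poly A}) : M := (map_poly D p).[z].

Lemma map_polyD_derivation p q :
  map_poly D (p + q) = map_poly D p + map_poly D q.
Proof.
by apply/polyP => i; rewrite coefD !coef_map_id0 ?derivation0 // coefD D_der.1.
Qed.

Lemma coef_derivationP : derivation_over (horner_at phi z) coef_derivation.
Proof.
have addE p q : coef_derivation (p + q) = coef_derivation p + coef_derivation q.
  by rewrite /coef_derivation map_polyD_derivation hornerD.
split=> // p q; elim/poly_ind: p => [|p c IHp].
  rewrite !mul0r /coef_derivation raddf0 mul0r addr0.
  suff -> : map_poly D 0 = 0 by rewrite horner0 mul0r.
  by apply/polyP => i; rewrite coef_map_id0 ?derivation0 // !coef0 derivation0.
have mulX r : coef_derivation (r * 'X) = coef_derivation r * z.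
  rewrite /coef_derivation.
  suff -> : map_poly D (r * 'X) = map_poly D r * 'X by rewrite hornerM hornerX.
  apply/polyP => i; rewrite coef_map_id0 ?derivation0 // !coefMX.
  by case: i => [|i] /=; rewrite ?derivation0 // coef_map_id0 ?derivation0.
have mulC r : coef_derivation (c%:P * r) =
    D c * horner_at phi z r + phi c * coef_derivation r.
  rewrite /coef_derivation /horner_at.
  suff -> : map_poly D (c%:P * r) =
      (D c)%:P * map_poly phi r + (phi c)%:P * map_poly D r.
    by rewrite hornerD !hornerM !hornerC.
  apply/polyP => i; rewrite coef_map_id0 ?derivation0 // coefCM D_der.2.
  by rewrite coefD !coefCM coef_map coef_map_id0 ?derivation0.
have const : coef_derivation c%:P = D c.
  rewrite /coef_derivation; suff -> : map_poly D c%:P = (D c)%:P by rewrite hornerC.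
  apply/polyP => i; rewrite coef_map_id0 ?derivation0 // !coefC.
  by case: i => //=; rewrite derivation0.
have -> : (p * 'X + c%:P) * q = p * q * 'X + c%:P * q by rewrite mulrDl mulrAC.
rewrite !addE mulC !mulX const IHp rmorphD rmorphM /= horner_atC horner_atX.
by rewrite !mulrDl [LHS]addrACA; congr (_ + _ + (_ + _)); rewrite mulrAC.
Qed.

Hypothesis D_ker : forall a, phi a = 0 -> D a = 0.
Hypothesis char0 : [pchar M] =i pred0.

Lemma coef_derivation_ker p : map_poly phi p = 0 -> coef_derivation p = 0.
Proof.
move=> p0; rewrite /coef_derivation.
suff -> : map_poly D p = 0 by rewrite horner0.
apply/polyP => i; rewrite coef_map_id0 ?derivation0 // coef0; apply: D_ker.
by rewrite -coef_map p0 coef0.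
Qed.

(** The derivative is shorter than [g], so it could vanish at [z] only by vanishing over [M], and
    its leading coefficient forbids this in characteristic zero. *)
Lemma minimal_relation_separable g :
  minimal_relation phi z g -> horner_at phi z g^`() != 0.
Proof.
move=> g_rel; have [g_lead g_z g_min] := g_rel.
have size_g := minimal_relation_size g_rel.
apply/negP => /eqP /(g_min _ (lt_size_deriv _)) dg0.
have /polyP/(_ (size g).-2) := dg0 (lead_neq0 g_lead).
rewrite coef0 coef_map coef_deriv prednK; last by case: (size g) size_g => [|[]].
rewrite raddfMn -mulr_natr => /eqP; rewrite mulf_eq0 (pcharf0P _).1 //.
by rewrite -lead_coefE (negbTE g_lead); case: (size g) size_g => [|[]].
Qed.

(** Extensions are sought in the form [coef_derivation p + p'(z) w], where [w] is the value on the
    variable. A transcendental [z] leaves [w] free, and [0] is taken; an algebraic one forces [w],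
    because the minimal relation must be killed, and the equation for [w] is solvable since [g'(z)]
    is nonzero. *)
Lemma extend_derivation_step : exists D' : {poly A} -> M,
  [/\ derivation_over (horner_at phi z) D', forall a, D' a%:P = D a &
      forall p, horner_at phi z p = 0 -> D' p = 0].
Proof.
pose E w p := coef_derivation p + horner_at phi z p^`() * w.
have E_der w : derivation_over (horner_at phi z) (E w).
  split=> p q; rewrite /E.
    by rewrite coef_derivationP.1 derivD rmorphD mulrDl addrACA.
  rewrite coef_derivationP.2 derivM rmorphD !rmorphM /= mulrDr !mulrDl addrACA.
  by congr (_ + _ + (_ + _)); rewrite ?mulrA // mulrAC.
have E_const w a : E w a%:P = D a.
  rewrite /E derivC rmorph0 mul0r addr0 /coef_derivation.
  suff -> : map_poly D a%:P = (D a)%:P by rewrite hornerC.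
  apply/polyP => i; rewrite coef_map_id0 ?derivation0 // !coefC.
  by case: i => //=; rewrite derivation0.
have E_map w p : map_poly phi p = 0 -> E w p = 0.
  move=> p0; rewrite /E coef_derivation_ker // /horner_at -deriv_map p0.
  by rewrite deriv0 horner0 mul0r addr0.
have [z_tr|[g g_rel]] := transcendental_or_algebraic phi z.
  exists (E 0); split=> // p p_z; exact/E_map/z_tr.
have dg_z := minimal_relation_separable g_rel.
have [g_lead g_z _] := g_rel.
pose w := - coef_derivation g / horner_at phi z g^`().
exists (E w); split=> // p p_z.
have Eg : E w g = 0 by rewrite /E /w mulrC divfK // addrN.
have [k [q [r [eq_p r0]]]] := minimal_relation_divides g_rel p_z.
have := congr1 (E w) eq_p; rewrite (E_der w).1 !(E_der w).2 p_z g_z Eg.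
rewrite (E_map w r) // !mulr0 !addr0 add0r horner_atC => /eqP.
by rewrite rmorphXn mulf_eq0 expf_eq0 (negbTE g_lead) andbF => /eqP.
Qed.

End DerivationStep.

Lemma extend_derivation n (A : comNzRingType) (M : fieldType)
    (phi : {rmorphism A -> M}) (z : 'I_n -> M) (D : A -> M) :
    [pchar M] =i pred0 -> derivation_over phi D -> (forall a, phi a = 0 -> D a = 0) ->
  exists D' : mpoly n A -> M,
    [/\ derivation_over (mmap phi z) D', forall a, D' (mpolyC n a) = D a &
        forall p, mmap phi z p = 0 -> D' p = 0].
Proof.
move=> char0; elim: n A phi z D => [|n IHn] A phi z D D_der D_ker.
  exists (fun p => D (mcoeff (@mnm0 0) p)); split=> [|a|p].
  - by split=> p q; have [a ->] := mpoly0_const p; have [b ->] := mpoly0_const q;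
      rewrite -?mpolyCD -?mpolyCM !mcoeffC eqxx !mulr1 ?mmapC ?D_der.1 ?D_der.2.
  - by rewrite mcoeffC eqxx mulr1.
  have [a ->] := mpoly0_const p.
  by rewrite mmapC mcoeffC eqxx mulr1; apply: D_ker.
have [D1 [D1_der D1_const D1_ker]] := extend_derivation_step (z ord0) D_der D_ker char0.
have [D2 [D2_der D2_const D2_ker]] :=
  IHn _ (horner_at phi (z ord0)) (fun j => z (lift ord0 j)) D1 D1_der D1_ker.
exists (D2 \o @mcurry A n); split=> [|a|p] /=.
- split=> p q /=; first by rewrite /mcurry rmorphD D2_der.1.
  by rewrite !mmap_mcurry /mcurry rmorphM D2_der.2.
- by rewrite /mcurry mmapC /= D2_const D1_const.
by rewrite mmap_mcurry; apply: D2_ker.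
Qed.

Lemma derivation_mpolyE n (A : comNzRingType) (M : comNzRingType)
    (phi : {rmorphism A -> M}) (z : 'I_n -> M) (D : mpoly n A -> M) :
    derivation_over (mmap phi z) D -> (forall a, D (mpolyC n a) = 0) ->
  forall f, D f = \sum_i mmap phi z (mderiv i f) * D (mpolyX A (mnm1 i)).
Proof.
move=> D_der D_const; elim/mpoly_ring_ind => [c|i|p q Dp Dq|p q Dp Dq].
- by rewrite D_const big1 // => i _; rewrite mderivC rmorph0 mul0r.
- by rewrite (sum_mderivXU (mmap phi z) (fun j => D (mpolyX A (mnm1 j)))).
- rewrite D_der.1 Dp Dq -big_split /=; apply: eq_bigr => i _.
  by rewrite mderivD rmorphD mulrDl.
rewrite D_der.2 Dp Dq mulr_suml mulr_sumr -big_split /=; apply: eq_bigr => i _.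
by rewrite mderivM rmorphD !rmorphM /= mulrDl mulrAC mulrA.
Qed.

Lemma mderiv_derivation n (A : comNzRingType) (M : comNzRingType)
    (phi : {rmorphism A -> M}) (z v : 'I_n -> M) :
  derivation_over (mmap phi z) (fun f => \sum_i mmap phi z (mderiv i f) * v i).
Proof.
split=> p q.
  by rewrite -big_split; apply: eq_bigr => i _; rewrite mderivD rmorphD mulrDl.
rewrite mulr_suml mulr_sumr -big_split /=; apply: eq_bigr => i _.
by rewrite mderivM rmorphD !rmorphM /= mulrDl mulrAC mulrA.
Qed.

(** * Prime ideals and residue fields *)

Lemma fraction_numden (D : idomainType) (m : {fraction D}) :
  exists a b : D, b != 0 /\ m = tofrac a / tofrac b.
Proof.
elim/quotW: m => x; exists x.1, x.2; split; first exact: denom_ratioP.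
have d_neq0 : tofrac x.2 != 0 by rewrite tofrac_eq0 denom_ratioP.
apply: (canRL (mulfK d_neq0)); unlock tofrac.
rewrite -[LHS]FracField.pi_mul; apply/eqmodP.
rewrite /= FracField.equivfE /FracField.mulf !numden_Ratio ?mulf_neq0 ?oner_neq0 ?denom_ratioP //.
by rewrite !mulr1 mulrC.
Qed.

Definition ideal_set (A : comNzRingType) (P : set A) : Prop :=
  [/\ P 0, forall a b, P a -> P b -> P (a + b) & forall a b, P b -> P (a * b)].

Definition prime_set (A : comNzRingType) (P : set A) : Prop :=
  [/\ ideal_set P, ~ P 1 & forall a b, P (a * b) -> P a \/ P b].

Section ResidueField.
Variables (A : comNzRingType) (P : set A).
Hypothesis P_prime : prime_set P.

Let Pb : {pred A} := fun a => `[< P a >].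

Let Pb_closed : idealr_closed Pb.
Proof.
have [[P0 PD PM] P1 _] := P_prime; split.
- exact/asboolP.
- exact/asboolP.
by move=> a b c /asboolP Pb' /asboolP Pc; apply/asboolP/PD => //; apply: PM.
Qed.

Let Pb_prime : prime_idealr_closed Pb.
Proof.
have [_ _ Pprime] := P_prime; move=> a b /asboolP /Pprime[] Px; apply/orP.
  by left; apply/asboolP.
by right; apply/asboolP.
Qed.

HB.instance Definition _ := isIdealr.Build A Pb Pb_closed.
HB.instance Definition _ := isPrimeIdealrClosed.Build A Pb Pb_prime.

Let Q : Type := {ideal_quot Pb}.
HB.instance Definition _ := GRing.ComNzRing.on Q.

Let Qunit : {pred Q} := fun x => `[< exists y, y * x = 1 >].
Let Qinv (x : Q) : Q := if pselect (exists y, y * x = 1) is left e then sval (cid e) else x.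

Let QmulV : {in Qunit, left_inverse 1 Qinv *%R}.
Proof.
by move=> x /asboolP x_unit; rewrite /Qinv; case: pselect => // e; exact: (svalP (cid e)).
Qed.

Let Qunit_mul (x y : Q) : y * x = 1 -> x \in Qunit.
Proof. by move=> yx; apply/asboolP; exists y. Qed.

Let Qinv_out : {in [predC Qunit], Qinv =1 id}.
Proof.
move=> x; rewrite inE /Qinv => /negP x_nunit; case: pselect => // e.
by case: x_nunit; apply/asboolP.
Qed.

HB.instance Definition _ :=
  GRing.ComNzRing_hasMulInverse.Build Q QmulV Qunit_mul Qinv_out.

Let Qdomain (x y : Q) : x * y = 0 -> (x == 0) || (y == 0).
Proof. exact: Quotient.rquot_IdomainAxiom. Qed.

HB.instance Definition _ := GRing.ComUnitRing_isIntegral.Build Q Qdomain.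

Lemma residue_field : exists (M : fieldType) (phi : {rmorphism A -> M}),
  (forall a, phi a = 0 <-> P a) /\
  forall m, exists a b, phi b != 0 /\ m = phi a / phi b.
Proof.
pose pi : {rmorphism A -> Q} := \pi_Q%qT.
have piE a : (pi a == 0) = `[< P a >].
  by rewrite -(rmorph0 pi) -Quotient.idealrBE subr0.
pose phi : {rmorphism A -> {fraction Q}} := @tofrac Q \o pi.
have phiE a : (phi a == 0) = `[< P a >] by rewrite /= tofrac_eq0 piE.
exists {fraction Q}, phi; split=> [a|m].
  by split=> [/eqP|Pa]; [rewrite phiE => /asboolP | apply/eqP; rewrite phiE; apply/asboolP].
have [x [y [y_neq0 ->]]] := fraction_numden m.
elim/quotW: x => a; elim/quotW: y y_neq0 => b b_neq0.
by exists a, b; rewrite /= tofrac_eq0.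
Qed.
End ResidueField.

(** An ideal maximal among those that contain [I] and avoid the multiplicative set [S] is prime:
    adjoining either of two outside elements meets [S], and if the product of the elements were in
    the ideal, so would be the product of the two witnesses. *)
Lemma prime_avoiding (A : comNzRingType) (I S : set A) :
    ideal_set I -> S 1 -> (forall a b, S a -> S b -> S (a * b)) ->
    (forall a, I a -> ~ S a) ->
  exists P, [/\ prime_set P, I `<=` P & forall a, P a -> ~ S a].
Proof.
move=> [I0 ID IM] S1 SM I_S.
(* The ideal is the union of [I] and [X], not [X] alone: the empty chain has empty union and must
   qualify too. *)
pose Q X := ideal_set (I `|` X) /\ forall a, X a -> ~ S a.
have [F FQ Ftot|X [[X_ideal X_S] X_max]] := Zorn_bigcup (P := Q).
  split; last by move=> a [X FX Xa]; apply: (FQ X FX).2.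
  have FI X : F X -> I `|` X `<=` I `|` \bigcup_(X in F) X.
    by move=> FX a [Ia|Xa]; [left | right; exists X].
  split; first by left.
  - move=> a b [Ia|[X FX Xa]] [Ib|[Z FZ Zb]].
    + by left; apply: ID.
    + by apply: (FI Z FZ); have [[_ ZD _] _] := FQ Z FZ; apply: ZD; [left|right].
    + by apply: (FI X FX); have [[_ XD _] _] := FQ X FX; apply: XD; [right|left].
    have [XZ|ZX] := Ftot X Z FX FZ.
      by apply: (FI Z FZ); have [[_ ZD _] _] := FQ Z FZ; apply: ZD; right => //; apply: XZ.
    by apply: (FI X FX); have [[_ XD _] _] := FQ X FX; apply: XD; right => //; apply: ZX.
  move=> a b [Ib|[X FX Xb]]; first by left; apply: IM.
  by apply: (FI X FX); have [[_ _ XM] _] := FQ X FX; apply: XM; right.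
pose P := I `|` X; have [P0 PD PM] := X_ideal.
have P_S a : P a -> ~ S a by case; [apply: I_S | apply: X_S].
exists P; split=> //; last by move=> a Ia; left.
split=> // [|a b Pab]; first by move=> P1; exact: (P_S 1).
apply: contrapT => /not_orP[nPa nPb].
have meet c : ~ P c -> exists x y, P x /\ S (x + y * c).
  move=> nPc; pose J : set A := [set x + y * c | x in P & y in setT].
  have PJ : P `<=` J by move=> x Px; exists x => //; exists 0; rewrite ?mul0r ?addr0.
  have Jc : J c by exists 0 => //; exists 1; rewrite // mul1r add0r.
  have /X_max nQJ : X `<` J.
    split=> [x Xx|]; first by apply: PJ; right.
    by move=> /(_ _ Jc) Xc; apply: nPc; right.
  apply: contrapT => nS; apply: nQJ; split; last first.
    by move=> _ [x Px [y _ <-]] Sxy; apply: nS; exists x, y.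
  have -> : I `|` J = J by apply/setUidPr => x Ix; apply: PJ; left.
  split; first exact: PJ.
    move=> _ _ [x Px [y _ <-]] [x' Px' [y' _ <-]]; exists (x + x'); first exact: PD.
    by exists (y + y'); rewrite // mulrDl addrACA.
  move=> d _ [x Px [y _ <-]]; exists (d * x); first exact: PM.
  by exists (d * y); rewrite // mulrDr mulrA.
have [x [y [Px Sa]]] := meet a nPa; have [x' [y' [Px' Sb]]] := meet b nPb.
apply: (P_S _ _ (SM _ _ Sa Sb)).
rewrite mulrDl; apply: (PD); first by rewrite mulrC; apply: PM.
rewrite mulrDr; apply: (PD); first exact: PM.
by rewrite mulrACA; apply: PM.
Qed.

Lemma rmorph_pchar0 (C M : fieldType) (iota : {rmorphism C -> M}) :
  [pchar C] =i pred0 -> [pchar M] =i pred0.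
Proof.
by move=> char0 p; rewrite -char0; apply: (fmorph_pchar iota).
Qed.

Lemma mpoly_nonroot (C : fieldType) n (f : mpoly n C) : has_roots C -> f != 0 ->
  exists b, mmap idfun b f != 0.
Proof.
move=> C_roots f_neq0.
pose iota : {rmorphism C -> {fraction (mpoly n C)}} := @tofrac _ \o @mpolyC n C.
pose z i : {fraction (mpoly n C)} := tofrac (mpolyX C (mnm1 i)).
have eq_f h : mmap iota z h = tofrac h.
  apply: (mpoly_rmorphism_eq (f := mmap iota z) (g := @tofrac _)) => [c|i] /=.
    by rewrite mmapC.
  by rewrite mmapXU.
have [|u [u_neq0 u_spec]] := specialize_mpoly (phi := iota) (z := z) (v := f) C_roots.
  by rewrite eq_f tofrac_eq0.
have [||b [_ f_b]] := u_spec idfun; last by exists b.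
- by move=> c /eqP; rewrite fmorph_eq0 => /eqP.
- by apply: contraNneq u_neq0 => /= ->; rewrite raddf0.
Qed.

(** * Independent coordinates and tangent spaces of a generic point *)

Section HornerComposition.
Variables (A B : comNzRingType) (M : fieldType) (e : {rmorphism A -> B}).
Variables (psi : {rmorphism B -> M}) (phi : {rmorphism A -> M}).
Hypothesis psi_e : forall a, psi (e a) = phi a.

Lemma horner_at_comp b g : psi (horner_at e b g) = horner_at phi (psi b) g.
Proof.
rewrite /horner_at -horner_map /=; congr (_.[_]); apply/polyP => i.
by rewrite !coef_map /= psi_e.
Qed.

Variable D : B -> M.
Hypotheses (D_der : derivation_over psi D) (De : forall a, D (e a) = 0).

Lemma derivation_horner_at b g :
  D (horner_at e b g) = horner_at phi (psi b) g^`() * D b.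
Proof.
elim/poly_ind: g => [|g a IHg].
  by rewrite deriv0 !raddf0 mul0r -(rmorph0 e) De.
rewrite rmorphD rmorphM /= horner_atX horner_atC D_der.1 D_der.2 De addr0 IHg.
rewrite derivMXaddC rmorphD rmorphM /= horner_atX -!horner_at_comp mulrDl mulrAC.
by rewrite addrC.
Qed.

(** Differentiating [g(b) = 0] gives [g'(b) D b = 0], and [g'(b)] is nonzero by separability. *)
Lemma derivation_algebraic b g : [pchar M] =i pred0 ->
  (forall b, psi b = 0 -> D b = 0) -> minimal_relation phi (psi b) g -> D b = 0.
Proof.
move=> char0 D_ker g_rel; have [_ g_z _] := g_rel.
have := derivation_horner_at b g.
rewrite D_ker ?horner_at_comp // => /esym/eqP.
by rewrite mulf_eq0 (negbTE (minimal_relation_separable char0 g_rel)) => /eqP.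
Qed.

End HornerComposition.

Section TailPolynomial.
Variables (C : comNzRingType) (d : nat).

(** In contrast to [mcurry], the first variable is outermost, over polynomials in the others: in
    this form a relation shows the first coordinate to be algebraic over the rest. *)
Definition head_poly : mpoly d.+1 C -> {poly mpoly d C} :=
  mmap (polyC \o @mpolyC d C)
    (fun i => if unlift ord0 i is Some j then (mpolyX C (mnm1 j))%:P else 'X).

Let shift_var : mpoly d C -> mpoly d.+1 C :=
  mmap (@mpolyC d.+1 C) (fun j => mpolyX C (mnm1 (lift ord0 j))).

Lemma head_poly_inj : injective head_poly.
Proof.
pose back := horner_at shift_var (mpolyX C (mnm1 (ord0 : 'I_d.+1))).
suff backK : back \o head_poly =1 idfun by apply: (can_inj (g := back)) => f; exact: backK.
apply: mpoly_rmorphism_eq => [c|i] /=.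
  by rewrite /head_poly mmapC /back /= horner_atC /= /shift_var mmapC.
rewrite /head_poly mmapXU; case: unliftP => [j ->|->]; rewrite /back.
  by rewrite horner_atC /= /shift_var mmapXU.
exact: horner_atX.
Qed.

Lemma mmap_head_poly (M : comNzRingType) (phi : {rmorphism C -> M})
    (z : 'I_d.+1 -> M) f :
  mmap phi z f = horner_at (mmap phi (fun j => z (lift ord0 j))) (z ord0) (head_poly f).
Proof.
pose e := horner_at (mmap phi (fun j => z (lift ord0 j))) (z ord0).
apply: (mpoly_rmorphism_eq (f := mmap phi z) (g := e \o head_poly)) => [c|i] /=.
  by rewrite /head_poly !mmapC /= horner_atC /= ?mmapC.
rewrite /head_poly !mmapXU; case: unliftP => [j ->|->].
  by rewrite horner_atC /= mmapXU.
by rewrite horner_atX.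
Qed.

End TailPolynomial.

Section GenericPoint.
Variables (C M : fieldType) (iota : {rmorphism C -> M}) (n : nat).
Hypothesis char0 : [pchar M] =i pred0.
Implicit Type x : 'I_n -> M.

Definition independent x d (s : 'I_d -> 'I_n) : Prop :=
  forall f, mmap iota (x \o s) f = 0 -> f = 0.

Definition maximal_independent x d (s : 'I_d -> 'I_n) : Prop :=
  independent x s /\ forall e (t : 'I_e -> 'I_n), independent x t -> (e <= d)%N.

Lemma independent_inj x d (s : 'I_d -> 'I_n) : independent x s -> injective s.
Proof.
move=> s_ind i j eq_s; apply/eqP.
have /eqP : mpolyX C (mnm1 i) - mpolyX C (mnm1 j) = 0.
  by apply: s_ind; rewrite rmorphB /= !mmapXU /= eq_s subrr.
rewrite subr_eq0 => /eqP/(congr1 (mcoeff (mnm1 i))).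
rewrite !mcoeffX eqxx; case: eqP => [/mnmP/(_ i)|_ /eqP]; last by rewrite oner_eq0.
by rewrite !mnmE eqxx; case: eqP => // ->.
Qed.

Lemma independent_leq x d (s : 'I_d -> 'I_n) : independent x s -> (d <= n)%N.
Proof. by move=> /independent_inj/leq_card; rewrite !card_ord. Qed.

Lemma maximal_independent_exists x :
  exists d (s : 'I_d -> 'I_n), maximal_independent x s.
Proof.
pose P d := `[< exists s : 'I_d -> 'I_n, independent x s >].
have exP : exists d, P d.
  exists 0%N; apply/asboolP; exists (widen_ord (leq0n n)).
  by move=> f; have [c ->] := mpoly0_const f; rewrite mmapC => /eqP;
     rewrite fmorph_eq0 => /eqP ->; rewrite mpolyC0.
have leP d : P d -> (d <= n)%N by move=> /asboolP[s /independent_leq].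
case: (ex_maxnP exP leP) => d /asboolP[s s_ind] d_max.
by exists d, s; split=> // e t t_ind; apply: d_max; apply/asboolP; exists t.
Qed.

Lemma maximal_independent_algebraic x d (s : 'I_d -> 'I_n) i :
  maximal_independent x s ->
  exists g, minimal_relation (mmap iota (x \o s)) (x i) g.
Proof.
move=> [s_ind s_max].
have [i_tr|//] := transcendental_or_algebraic (mmap iota (x \o s)) (x i).
pose t (j : 'I_d.+1) := if unlift ord0 j is Some k then s k else i.
suff : independent x t by move=> /s_max; rewrite ltnn.
move=> f; rewrite mmap_head_poly /= => f_t; apply: head_poly_inj.
rewrite [RHS]rmorph0; apply/polyP => k; rewrite coef0.
apply: s_ind; rewrite -coef_map.
have -> : x \o s = (fun j => x (t (lift ord0 j))).
  by apply: funext => j /=; rewrite /t liftK.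
have {}f_t : horner_at (mmap iota (x \o s)) (x i) (head_poly f) = 0.
  rewrite -[RHS]f_t /t unlift_none; congr (horner_at (mmap iota _) _ _).
  by apply: funext => j /=; rewrite liftK.
have -> : (fun j => x (t (lift ord0 j))) = x \o s.
  by apply: funext => j /=; rewrite /t liftK.
by rewrite (i_tr _ f_t) coef0.
Qed.

Definition tangent_at x (v : 'I_n -> M) : Prop :=
  forall f, mmap iota x f = 0 -> \sum_i mmap iota x (mderiv i f) * v i = 0.

Definition select_var d (s : 'I_d -> 'I_n) : mpoly d C -> mpoly n C :=
  mmap (@mpolyC n C) (fun j => mpolyX C (mnm1 (s j))).

Lemma mmap_select_var x d (s : 'I_d -> 'I_n) f :
  mmap iota x (select_var s f) = mmap iota (x \o s) f.
Proof.
apply: (mpoly_rmorphism_eq (f := mmap iota x \o select_var s)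
  (g := mmap iota (x \o s))) => [c|i] /=; first by rewrite /select_var !mmapC.
by rewrite /select_var !mmapXU.
Qed.

(** A tangent vector is a derivation into [M] that kills constants and respects the relations of
    [x]; on coordinates algebraic over the basis it is determined by its values on the basis. *)
Lemma tangent_at_inj x d (s : 'I_d -> 'I_n) v : maximal_independent x s ->
  tangent_at x v -> (forall j, v (s j) = 0) -> forall i, v i = 0.
Proof.
move=> s_max v_tan v_s i.
pose D f := \sum_i mmap iota x (mderiv i f) * v i.
have D_der : derivation_over (mmap iota x) D by exact: mderiv_derivation.
have DX k : D (mpolyX C (mnm1 k)) = v k by exact: (sum_mderivXU (mmap iota x)).
have De a : D (select_var s a) = 0.
  elim/mpoly_ring_ind: a => [c|j|p q Dp Dq|p q Dp Dq].
  - by rewrite /select_var mmapC /D big1 // => j _; rewrite mderivC raddf0 mul0r.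
  - by rewrite /select_var mmapXU DX.
  - by rewrite /select_var rmorphD D_der.1 Dp Dq addr0.
  by rewrite /select_var rmorphM D_der.2 Dp Dq mul0r mulr0 addr0.
have [g g_rel] := maximal_independent_algebraic i s_max.
rewrite -DX; apply: (derivation_algebraic (g := g) (mmap_select_var x s) D_der De) => //.
by rewrite /= mmapXU.
Qed.
End GenericPoint.

(** The rows are members of [W], not merely of its span, so that each comes with the polynomial
    whose gradient it is. *)
Lemma spanning_rows (K : fieldType) n (W : 'rV[K]_n -> Prop) :
  exists r (B : 'M[K]_(r, n)),
    [/\ row_free B, forall k, W (row k B) & forall w, W w -> (w <= B)%MS].
Proof.
pose P r := `[< exists B : 'M[K]_(r, n), row_free B /\ forall k, W (row k B) >].
have exP : exists r, P r.
  by exists 0%N; apply/asboolP; exists 0; split; [rewrite /row_free mxrank0|case].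
have leP r : P r -> (r <= n)%N.
  by move=> /asboolP[B [B_free _]]; rewrite -(eqP B_free) rank_leq_col.
case: (ex_maxnP exP leP) => r /asboolP[B [B_free BW]] r_max.
exists r, B; split=> // w Ww; apply/negP => /negP nwB.
have /r_max : P r.+1.
  apply/asboolP; exists (col_mx w B : 'M[K]_(1 + r, n)); split.
    have lt_r : (r < \rank (col_mx w B))%N.
      rewrite -addsmxE -{1}(eqP B_free).
      apply: rank_ltmx; rewrite /ltmx addsmxSr /=.
      by apply: contra nwB; apply: submx_trans; exact: addsmxSl.
    by rewrite /row_free eqn_leq rank_leq_row.
  move=> k; rewrite -(@splitK 1 r k); case: (@fintype.split 1 r k) => i /=.
    by rewrite (@rowKu _ 1 r n) row_id.
  by rewrite (@rowKd _ 1 r n).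
by rewrite ltnn.
Qed.

Definition lift_coef n (C A : comNzRingType) (c : C -> A) : mpoly n C -> mpoly n A :=
  mmap (@mpolyC n A \o c) (fun i => mpolyX A (mnm1 i)).

Section TangentDimension.
Variables (C M : fieldType) (iota : {rmorphism C -> M}) (n : nat).
Hypothesis char0 : [pchar M] =i pred0.
Variables (x : 'I_n -> M) (d : nat) (s : 'I_d -> 'I_n).

Lemma mmap_lift_coef (A : comNzRingType) (c : {rmorphism C -> A})
    (phi : {rmorphism A -> M}) f : (forall a, phi (c a) = iota a) ->
  mmap phi x (lift_coef c f) = mmap iota x f.
Proof.
move=> phi_c.
apply: (mpoly_rmorphism_eq (f := mmap phi x \o lift_coef c)
  (g := mmap iota x)) => [a|i] /=; first by rewrite /lift_coef !mmapC /= ?mmapC phi_c.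
by rewrite /lift_coef !mmapXU.
Qed.

Lemma lift_coef_derivation (A : comNzRingType) (c : {rmorphism C -> A})
    (phi : {rmorphism A -> M}) (D : mpoly n A -> M) f :
    (forall a, phi (c a) = iota a) -> derivation_over (mmap phi x) D ->
    (forall a, D (mpolyC n (c a)) = 0) ->
  D (lift_coef c f) = \sum_i mmap iota x (mderiv i f) * D (mpolyX A (mnm1 i)).
Proof.
move=> phi_c D_der Dc.
have der : derivation_over (mmap iota x) (D \o lift_coef c).
  split=> p q /=; first by rewrite /lift_coef rmorphD D_der.1.
  by rewrite -!(mmap_lift_coef _ phi_c) /lift_coef rmorphM D_der.2.
have /= -> := derivation_mpolyE der; last first.
  by move=> a; rewrite /= /lift_coef mmapC /= Dc.
by apply: eq_bigr => i _; rewrite /lift_coef mmapXU.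
Qed.

Let phi : {rmorphism mpoly d C -> M} := mmap iota (x \o s).

(** Independence lets the partial derivatives in the basis variables define a derivation with any
    prescribed values; extended to all coordinates, it is a tangent vector. *)
Lemma tangent_at_surj (v0 : 'I_d -> M) : independent iota x s ->
  exists v, tangent_at iota x v /\ forall j, v (s j) = v0 j.
Proof.
move=> s_ind.
pose D0 a := \sum_j mmap iota (x \o s) (mderiv j a) * v0 j.
have D0_der : derivation_over phi D0 by exact: mderiv_derivation.
have D0_const a : D0 (mpolyC d a) = 0.
  by rewrite /D0 big1 // => j _; rewrite mderivC raddf0 mul0r.
have D0_ker a : phi a = 0 -> D0 a = 0.
  by move=> /s_ind ->; rewrite -(mpolyC0 d) D0_const.
have D0_X j : D0 (mpolyX C (mnm1 j)) = v0 j by exact: (sum_mderivXU phi).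
have [D [D_der D_const D_ker]] := extend_derivation x char0 D0_der D0_ker.
exists (fun i => D (mpolyX _ (mnm1 i))); split=> [f f_x|j].
  have phi_c a : phi (mpolyC d a) = iota a by rewrite /phi /= mmapC.
  rewrite -(lift_coef_derivation f phi_c D_der); last first.
    by move=> a; rewrite D_const D0_const.
  by apply: D_ker; rewrite (mmap_lift_coef f phi_c).
(* The basis coordinate occurs twice, as a variable and as a constant from the coefficient ring; the
   difference [r] vanishes at [x], so [D] agrees on the two. *)
pose r := mpolyX (mpoly d C) (mnm1 (s j)) - mpolyC n (mpolyX C (mnm1 j)).
have -> : mpolyX (mpoly d C) (mnm1 (s j)) = r + mpolyC n (mpolyX C (mnm1 j)).
  by rewrite /r subrK.
rewrite D_der.1 D_const D0_X D_ker ?add0r // /r rmorphB /= mmapXU mmapC.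
by rewrite /phi /= mmapXU subrr.
Qed.

(** If the value [w] were transcendental, differentiation by [w] would extend to a derivation on
    polynomials in all coordinates. It kills the coordinates, which are algebraic over the basis,
    hence also [w], whose derivative is 1. *)
Lemma maximal_independent_poly_algebraic f : maximal_independent iota x s ->
  exists g, minimal_relation phi (mmap iota x f) g.
Proof.
move=> s_max; set w := mmap iota x f.
have [w_tr|//] := transcendental_or_algebraic phi w.
pose Dw p := horner_at phi w p^`().
have Dw_der : derivation_over (horner_at phi w) Dw.
  split=> p q; rewrite /Dw ?derivD ?rmorphD // derivM rmorphD !rmorphM.
  by [].
have Dw_ker p : horner_at phi w p = 0 -> Dw p = 0.
  by move=> /w_tr p0; rewrite /Dw /horner_at -deriv_map p0 deriv0 horner0.
have [D [D_der D_const D_ker]] := extend_derivation x char0 Dw_der Dw_ker.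
pose e : {rmorphism mpoly d C -> mpoly n {poly mpoly d C}} :=
  @mpolyC n {poly mpoly d C} \o polyC.
pose psi : {rmorphism mpoly n {poly mpoly d C} -> M} := mmap (horner_at phi w) x.
have psi_e a : psi (e a) = phi a by rewrite /psi /= mmapC /= horner_atC.
have De a : D (e a) = 0 by rewrite D_const /Dw derivC raddf0.
have DX i : D (mpolyX _ (mnm1 i)) = 0.
  have [g g_rel] := maximal_independent_algebraic i s_max.
  apply: (@derivation_algebraic _ _ _ e psi phi psi_e D D_der De _ g char0 D_ker).
  by rewrite /psi /= mmapXU.
pose c : {rmorphism C -> {poly mpoly d C}} := polyC \o @mpolyC d C.
have phi_c a : horner_at phi w (c a) = iota a.
  by rewrite /= horner_atC /phi /= mmapC.
pose r := lift_coef c f - mpolyC n 'X.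
have Dr : D r = 0.
  by apply: D_ker; rewrite rmorphB /= (mmap_lift_coef f phi_c) mmapC /= horner_atX subrr.
have : D (lift_coef c f) = 1.
  have -> : lift_coef c f = r + mpolyC n 'X by rewrite /r subrK.
  by rewrite D_der.1 Dr add0r D_const /Dw derivX rmorph1.
rewrite (lift_coef_derivation f phi_c D_der); last by move=> a; exact: De.
rewrite big1 => [/eqP|i _]; last by rewrite DX mulr0.
by rewrite eq_sym oner_eq0.
Qed.

(** Bezout between the relation of the value of [f] and the variable [X] inverts [f] up to a
    polynomial in the basis. This is what makes the dimension drop on proper closed subsets. *)
Lemma multiple_in_independent f : maximal_independent iota x s ->
    mmap iota x f != 0 ->
  exists a h, a != 0 /\ mmap iota x (h * f - select_var s a) = 0.
Proof.
move=> s_max f_x; have [g g_rel] := maximal_independent_poly_algebraic f s_max.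
have [|h [a [a_neq0 ha]]] := minimal_relation_coprime (v := 'X) g_rel.
  by rewrite horner_atX.
exists a, (horner_at (select_var (C := C) s) f h); split.
  by apply: contraNneq a_neq0 => ->; rewrite raddf0.
rewrite rmorphB rmorphM /= (horner_at_comp (phi := phi) (e := select_var s)); last first.
  exact: mmap_select_var.
rewrite mmap_select_var -[RHS]ha rmorphB rmorphM /= horner_atX.
by rewrite horner_atC.
Qed.

(** Projection of the tangent space, the kernel of [B^T], onto the basis coordinates is injective by
    [tangent_at_inj] and surjective by [tangent_at_surj]; counting dimensions gives [n - r = d]. *)
Lemma gradient_basis : maximal_independent iota x s ->
  exists r (fs : 'I_r -> mpoly n C),
  let G := \matrix_(k, i) mmap iota x (mderiv i (fs k)) in
  [/\ (r + d)%N = n, forall k, mmap iota x (fs k) = 0, row_free G &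
      forall f, mmap iota x f = 0 -> (\row_i mmap iota x (mderiv i f) <= G)%MS].
Proof.
move=> s_max.
have [r [B [B_free BW WB]]] := spanning_rows (fun w : 'rV[M]_n =>
  exists2 f, mmap iota x f = 0 & w = \row_i mmap iota x (mderiv i f)).
have /choice[fs fsP] : forall k : 'I_r, exists f,
    mmap iota x f = 0 /\ row k B = \row_i mmap iota x (mderiv i f).
  by move=> k; have [f f_x rowk] := BW k; exists f.
exists r, fs; set G := \matrix_(k, i) _.
have eq_GB : G = B.
  apply/row_matrixP => k; rewrite (fsP k).2.
  by apply/rowP => i; rewrite !mxE.
rewrite eq_GB; split=> //; last 2 first.
- by move=> k; exact: (fsP k).1.
- by move=> f f_x; apply: WB; exists f.
pose K := kermx B^T.
have tanP v : tangent_at iota x v <-> (\row_i v i <= K)%MS.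
  have tan_sum f : \sum_i mmap iota x (mderiv i f) * v i =
      ((\row_i v i) *m (\row_i mmap iota x (mderiv i f))^T) 0 0.
    by rewrite mxE; apply: eq_bigr => i _; rewrite !mxE mulrC.
  split=> [v_tan|/sub_kermxP vK f f_x].
    apply/sub_kermxP/matrixP => i k; rewrite !mxE !ord1.
    rewrite -[RHS](v_tan (fs k) (fsP k).1); apply: eq_bigr => l _.
    by rewrite mxE mulrC -eq_GB !mxE.
  rewrite tan_sum; have /submxP[u ->] : (\row_i mmap iota x (mderiv i f) <= B)%MS.
    by apply: WB; exists f.
  by rewrite trmx_mul mulmxA vK mul0mx mxE.
pose S : 'M[M]_(n, d) := \matrix_(i, j) (i == s j)%:R.
have selE (v : 'I_n -> M) : (\row_i v i) *m S = \row_j v (s j).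
  apply/rowP => j; rewrite !mxE (bigD1 (s j)) //= !mxE eqxx mulr1 big1 ?addr0 //.
  by move=> i /negbTE neq_i; rewrite !mxE neq_i mulr0.
have KS0 : (K :&: kermx S)%MS = 0.
  apply/eqP; rewrite -submx0; apply/row_subP => i; set v := row i _.
  have : (v <= K :&: kermx S)%MS by exact: row_sub.
  rewrite sub_capmx => /andP[vK /sub_kermxP vS].
  have eq_v : v = \row_i v 0 i by apply/rowP => l; rewrite mxE.
  rewrite submx0; apply/eqP/rowP => l; rewrite [RHS]mxE.
  apply: (tangent_at_inj char0 (v := fun l => v 0 l) s_max).
    by apply/tanP; rewrite -eq_v.
  by move=> j; move: vS; rewrite eq_v selE => /rowP/(_ j); rewrite !mxE.
have KS_full : row_full (K *m S).
  rewrite -sub1mx; apply/row_subP => j.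
  have [v [v_tan v_s]] := tangent_at_surj (fun l => (row j 1%:M : 'rV_d) 0 l) s_max.1.
  have -> : row j 1%:M = (\row_i v i) *m S.
    by rewrite selE; apply/rowP => l; rewrite [RHS]mxE v_s.
  by apply: submxMr; apply/tanP.
have rankK : \rank K = (n - r)%N by rewrite mxrank_ker mxrank_tr (eqP B_free).
have := mxrank_mul_ker K S; rewrite KS0 mxrank0 addn0 (eqP KS_full) rankK => eq_d.
by rewrite {1}eq_d subnKC // -(eqP B_free) rank_leq_col.
Qed.

End TangentDimension.

(** * Dimension of irreducible affine varieties *)

Section Varieties.
Variables (R : realType) (n : nat).
Local Notation C := (R[i]).
Implicit Types (Y Z : set 'rV[C]_n) (f g : mpoly n C) (p : 'rV[C]_n).

Lemma complex_has_roots : has_roots C.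
Proof.
move=> p size_p; have [|x p_x] := @closed_rootP C p _; last by exists x.
by rewrite neq_ltn size_p orbT.
Qed.

Lemma complex_pchar0 : [pchar C] =i pred0.
Proof. exact: Num.Theory.pchar_num. Qed.

Lemma peval_mmap f p : peval f p = mmap idfun (p ord0) f.
Proof. by []. Qed.

Lemma peval_rV f (b : 'I_n -> C) : peval f (\row_i b i) = mmap idfun b f.
Proof. by rewrite peval_mmap; congr (mmap _ _ _); apply: funext => i; rewrite mxE. Qed.

Lemma pevalD f g p : peval (f + g) p = peval f p + peval g p.
Proof. exact: mevalD. Qed.

Lemma pevalN f p : peval (- f) p = - peval f p.
Proof. exact: mevalN. Qed.

Lemma pevalB f g p : peval (f - g) p = peval f p - peval g p.
Proof. exact: mevalB. Qed.

Lemma pevalM f g p : peval (f * g) p = peval f p * peval g p.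
Proof. exact: (rmorphM (meval (p ord0))). Qed.

Lemma pevalC c p : peval (mpolyC n c) p = c.
Proof. exact: mevalC. Qed.

Lemma peval0 p : peval 0 p = 0.
Proof. exact: meval0. Qed.

Lemma peval1 p : peval 1 p = 1.
Proof. exact: meval1. Qed.

Lemma pevalX i p : peval (mpolyX C (mnm1 i)) p = p ord0 i.
Proof. exact: mevalXU. Qed.

Lemma peval_nonroot f : f != 0 -> exists p, peval f p != 0.
Proof.
move=> /(mpoly_nonroot complex_has_roots)[b f_b].
by exists (\row_i b i); rewrite peval_rV.
Qed.

Lemma peval_eq0 f : (forall p, peval f p = 0) -> f = 0.
Proof.
move=> f0; apply/eqP; apply: contraT => /peval_nonroot[p].
by rewrite f0 eqxx.
Qed.

Lemma vanishing_ideal Y : ideal_set (vanishing Y).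
Proof.
split=> [p _|f g f_Y g_Y p Yp|f g g_Y p Yp]; first exact: peval0.
  by rewrite pevalD f_Y // g_Y // addr0.
by rewrite pevalM g_Y // mulr0.
Qed.

Lemma vanishing_prime Y : irreducible_variety Y -> prime_set (vanishing Y).
Proof.
move=> [[p0 Yp0] Y_closed Y_irr]; split; first exact: vanishing_ideal.
  by move=> /(_ p0 Yp0) /eqP; rewrite peval1 oner_eq0.
move=> f g fg_Y.
have closed1 (h : mpoly n C) : zclosed [set p | peval h p = 0].
  by exists [set h]; apply/seteqP; split=> [p h_p _ -> //|p]; apply.
have [|Y_f|Y_g] := Y_irr _ _ (closed1 f) (closed1 g).
- move=> p Yp; have /eqP := fg_Y p Yp.
  by rewrite pevalM mulf_eq0 => /orP[] /eqP; [left|right].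
- by left=> p /Y_f.
- by right=> p /Y_g.
Qed.

Lemma zclosed_vanishing Y p : zclosed Y ->
  (forall f, vanishing Y f -> peval f p = 0) -> Y p.
Proof.
by move=> [S ->] p_Y f Sf; apply: p_Y => q; apply.
Qed.

Lemma prime_residue (P : set (mpoly n C)) : prime_set P ->
  exists (M : fieldType) (iota : {rmorphism C -> M}) (x : 'I_n -> M),
    forall f, mmap iota x f = 0 <-> P f.
Proof.
move=> /residue_field[M [phi [phi_P _]]].
pose iota : {rmorphism C -> M} := phi \o @mpolyC n C.
exists M, iota, (fun i => phi (mpolyX C (mnm1 i))) => f.
rewrite -phi_P; set e := mmap _ _.
have -> // : e f = phi f.
apply: (mpoly_rmorphism_eq (f := e) (g := phi)) => [c|i]; first by rewrite /e /= mmapC.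
by rewrite /e /= mmapXU.
Qed.

Lemma generic_point Y : irreducible_variety Y ->
  exists (M : fieldType) (iota : {rmorphism C -> M}) (x : 'I_n -> M),
    forall f, mmap iota x f = 0 <-> vanishing Y f.
Proof. by move=> /vanishing_prime/prime_residue. Qed.

(** Nullstellensatz for a prime ideal: a polynomial outside [P] is nonzero at the point given by the
    residue field, and this point specialises to a zero of [P] where the polynomial is still
    nonzero. *)
Lemma vanishing_zero_locus (P : set (mpoly n C)) f : prime_set P ->
  vanishing (zero_locus P) f <-> P f.
Proof.
move=> P_prime; split=> [f_P|Pf p]; last exact.
have [M [iota [x xP]]] := prime_residue P_prime.
apply/xP; apply: contrapT => /eqP f_x.
have [u [u_neq0 u_spec]] := specialize_mpoly complex_has_roots f_x.
have [||b [b_spec]] := u_spec idfun.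
- by move=> c /eqP; rewrite fmorph_eq0 => /eqP.
- by apply: contraNneq u_neq0 => /= ->; rewrite raddf0.
rewrite -peval_rV f_P ?eqxx // => h Ph.
by rewrite peval_rV; apply: b_spec; apply/xP.
Qed.

Lemma prime_irreducible (P : set (mpoly n C)) :
  prime_set P -> irreducible_variety (zero_locus P).
Proof.
move=> P_prime; have [_ P1 PM] := P_prime.
have vanishP f := vanishing_zero_locus f P_prime.
split; last 2 first.
- by exists P.
- move=> _ _ [S1 ->] [S2 ->] sub; apply: contrapT => /not_orP[].
  have not_sub S : ~ zero_locus P `<=` zero_locus S -> exists2 f, S f & ~ P f.
    move=> nsub; apply: contrapT => all_P; apply: nsub => p Pp f Sf.
    by apply: Pp; apply: contrapT => nPf; apply: all_P; exists f.
  move=> /not_sub[f Sf nPf] /not_sub[g Sg nPg].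
  have /vanishP/PM[] // : vanishing (zero_locus P) (f * g).
  by move=> p /sub[Sp|Sp]; rewrite pevalM; [rewrite (Sp f Sf) mul0r | rewrite (Sp g Sg) mulr0].
apply: contrapT => empty; apply: P1; apply/vanishP => p Pp.
by case: empty; exists p.
Qed.

(** Independence is restated on [Y] itself, so that two varieties with unrelated residue fields can
    be compared. *)
Definition free_coords Y d (s : 'I_d -> 'I_n) : Prop :=
  forall a : mpoly d C, vanishing Y (select_var s a) -> a = 0.

Definition coord_dim Y d : Prop :=
  (exists s : 'I_d -> 'I_n, free_coords Y s) /\
  forall e (t : 'I_e -> 'I_n), free_coords Y t -> (e <= d)%N.

Section GenericPoint.
Variables (Y : set 'rV[C]_n) (M : fieldType) (iota : {rmorphism C -> M}).
Variable x : 'I_n -> M.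
Hypothesis xP : forall f, mmap iota x f = 0 <-> vanishing Y f.

Lemma free_coords_independent d (s : 'I_d -> 'I_n) :
  free_coords Y s <-> independent iota x s.
Proof.
by split=> s_free f; [rewrite -mmap_select_var => /xP | move=> /xP; rewrite mmap_select_var];
  apply: s_free.
Qed.

Lemma coord_dim_maximal d : coord_dim Y d <->
  exists s : 'I_d -> 'I_n, maximal_independent iota x s.
Proof.
split=> [[[s /free_coords_independent s_ind] d_max]|[s [s_ind s_max]]].
  by exists s; split=> // e t /free_coords_independent; apply: d_max.
split; first by exists s; apply/free_coords_independent.
by move=> e t /free_coords_independent; apply: s_max.
Qed.

Lemma free_coords_maximal d (s : 'I_d -> 'I_n) :
  coord_dim Y d -> free_coords Y s -> maximal_independent iota x s.
Proof.
move=> [_ d_max] /free_coords_independent s_ind; split=> // e t.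
by move=> /free_coords_independent; apply: d_max.
Qed.

End GenericPoint.

Lemma coord_dim_exists Y : irreducible_variety Y -> exists d, coord_dim Y d.
Proof.
move=> /generic_point[M [iota [x xP]]].
have [d [s s_max]] := maximal_independent_exists iota x.
by exists d; apply/(coord_dim_maximal xP); exists s.
Qed.

(** If the dimensions agreed, a basis free on [Y] would be maximal on [Z]. An equation of [Y] that
    is not one of [Z] has a multiple that is, on [Z], a nonzero polynomial in the basis; on [Y] that
    polynomial vanishes, against freeness. *)
Lemma coord_dim_lt Y Z d e : irreducible_variety Y -> irreducible_variety Z ->
  Y `<` Z -> coord_dim Y d -> coord_dim Z e -> (d < e)%N.
Proof.
move=> Y_irr Z_irr [sub nsub] [[s s_free] _] Z_dim.
have s_freeZ : free_coords Z s by move=> f f_Z; apply: s_free => p /sub/f_Z.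
have := Z_dim.2 _ _ s_freeZ; rewrite leq_eqVlt => /orP[/eqP eq_de|//]; subst e.
have [M [iota [x xP]]] := generic_point Z_irr.
have char0 := rmorph_pchar0 iota complex_pchar0.
have s_max := free_coords_maximal xP Z_dim s_freeZ.
have [f f_Y f_x] : exists2 f, vanishing Y f & mmap iota x f != 0.
  apply: contrapT => no_f; apply: nsub => p Zp.
  have [_ Y_closed _] := Y_irr; apply: (zclosed_vanishing Y_closed) => f f_Y.
  have /xP : mmap iota x f = 0; last by apply.
  by apply/eqP; apply: contrapT => /negP f_x; apply: no_f; exists f.
have [a [h [a_neq0 /xP ha]]] := multiple_in_independent char0 s_max f_x.
case/eqP: a_neq0; apply: s_free => p Yp; have := ha p (sub p Yp).
by rewrite pevalB pevalM f_Y // mulr0 sub0r => /eqP; rewrite oppr_eq0 => /eqP.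
Qed.

Lemma free_coords_dominant Y d (s : 'I_d -> 'I_n) : irreducible_variety Y ->
    free_coords Y s ->
  exists u : mpoly d C, u != 0 /\
    forall b, mmap idfun b u != 0 -> exists2 p, Y p & forall j, p ord0 (s j) = b j.
Proof.
move=> Y_irr s_free; have [M [iota [x xP]]] := generic_point Y_irr.
have s_ind := (free_coords_independent xP s).1 s_free.
pose phi : {rmorphism mpoly d C -> M} := mmap iota (x \o s).
have [|u [u_neq0 u_spec]] :=
    specialize_mpoly (phi := phi) (z := x) (v := 1) complex_has_roots.
  by rewrite rmorph1 oner_neq0.
exists u; split=> [|b u_b]; first by apply: contraNneq u_neq0 => ->; rewrite raddf0.
pose beta : {rmorphism mpoly d C -> C} := mmap idfun b.
have [||xi [xi_spec _]] := u_spec beta.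
- by move=> a /s_ind ->; rewrite raddf0.
- exact: u_b.
exists (\row_i xi i) => [|j]; last first.
  rewrite mxE; apply/eqP; rewrite -subr_eq0; apply/eqP.
  have := xi_spec (mpolyX (mpoly d C) (mnm1 (s j)) - mpolyC n (mpolyX C (mnm1 j))).
  rewrite !rmorphB /= !mmapXU !mmapC /= /phi /beta /= !mmapXU /= subrr; exact.
have [_ Y_closed _] := Y_irr; apply: (zclosed_vanishing Y_closed) => f /xP f_x.
pose c : {rmorphism C -> mpoly d C} := @mpolyC d C.
have beta_c a : beta (c a) = idfun a by rewrite /beta /= mmapC.
have phi_c a : phi (c a) = iota a by rewrite /phi /= mmapC.
rewrite peval_rV -(mmap_lift_coef xi f beta_c); apply: xi_spec.
by rewrite /= (mmap_lift_coef x f phi_c).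
Qed.

End Varieties.

(** * Dimension by chains and by free coordinates *)

Section Dimension.
Variables (R : realType) (n : nat).
Local Notation C := (R[i]).
Implicit Types (Y Z : set 'rV[C]_n).

Lemma peval_select_var d (s : 'I_d -> 'I_n) (a : mpoly d C) (p : 'rV[C]_n) :
  peval (select_var s a) p = mmap idfun (p ord0 \o s) a.
Proof. by rewrite peval_mmap mmap_select_var. Qed.

(* A component of a generic hyperplane section [x_(s 0) = c]: a prime ideal
   over [I(Y) + (x_(s 0) - c)] avoiding the nonzero polynomials in the
   remaining free coordinates. *)
Lemma coord_dim_step Y d : irreducible_variety Y -> coord_dim Y d.+1 ->
  exists Z, [/\ irreducible_variety Z, Z `<` Y & coord_dim Z d].
Proof.
move=> Y_irr Y_dim; have [[s s_free] _] := Y_dim.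
have [u [u_neq0 u_dom]] := free_coords_dominant Y_irr s_free.
have [b0 u_b0] := mpoly_nonroot (@complex_has_roots R) u_neq0.
(* [c] comes from a point where [u] is nonzero, so that [u] restricted to the slice, the polynomial
   [w] below, is not zero. *)
pose c := b0 ord0; pose t j := s (lift ord0 j).
pose l : mpoly n C := select_var s (mpolyX C (mnm1 ord0) - mpolyC _ c).
have l_eval p : peval l p = p ord0 (s ord0) - c.
  by rewrite peval_select_var rmorphB /= mmapXU mmapC.
pose I : set (mpoly n C) := [set f + h * l | f in vanishing Y & h in setT].
pose S : set (mpoly n C) := [set select_var t a | a in [set a | a != 0]].
have [VY0 VYD VYM] := vanishing_ideal Y.
have I_ideal : ideal_set I.
  split; first by exists 0 => //; exists 0; rewrite // mul0r addr0.
    move=> _ _ [f f_Y [h _ <-]] [g g_Y [k _ <-]]; exists (f + g); first exact: VYD.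
    by exists (h + k); rewrite // mulrDl addrACA.
  move=> e _ [f f_Y [h _ <-]]; exists (e * f); first exact: VYM.
  by exists (e * h); rewrite // mulrDr mulrA.
have S1 : S 1 by exists 1; rewrite /= ?oner_neq0 // /select_var rmorph1.
have SM a b : S a -> S b -> S (a * b).
  move=> [f /= f_neq0 <-] [g /= g_neq0 <-]; exists (f * g); rewrite /= ?mulf_neq0 //.
  by rewrite /select_var rmorphM.
pose cons_point (b : 'I_d -> C) (j : 'I_d.+1) := if unlift ord0 j is Some k then b k else c.
pose w : mpoly d C := mmap (@mpolyC d C)
  (fun j => if unlift ord0 j is Some k then mpolyX C (mnm1 k) else mpolyC d c) u.
have w_eval b : mmap idfun b w = mmap idfun (cons_point b) u.
  apply: (mpoly_rmorphism_eq (f := mmap idfun b \o mmap (@mpolyC d C) _)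
    (g := mmap idfun (cons_point b))) => [a|j] /=; first by rewrite !mmapC /= ?mmapC.
  rewrite !mmapXU /cons_point; case: unliftP => [k _|_]; first by rewrite mmapXU.
  by rewrite mmapC.
have w_neq0 : w != 0.
  apply: contraNneq u_b0 => w0.
  have <- : cons_point (b0 \o lift ord0) = b0.
    by apply: funext => j; rewrite /cons_point; case: unliftP => [k ->|->].
  by rewrite -w_eval w0 raddf0.
(* The slice has a point of [Y] over every [b] with [w] nonzero at [b], in particular one off the
   zeros of [a], whereas all of [I] vanishes on the slice. *)
have I_S f : I f -> ~ S f.
  move=> [g g_Y [h _ eq_f]] [a /= a_neq0 eq_a].
  have [b] : exists b, mmap idfun b (w * a) != 0.
    by apply: mpoly_nonroot; [exact: complex_has_roots | rewrite mulf_neq0].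
  rewrite rmorphM /= mulf_eq0 negb_or w_eval => /andP[u_b a_b].
  have [p Yp p_s] := u_dom _ u_b.
  case/eqP: a_b; have <- : peval (select_var t a) p = mmap idfun b a.
    rewrite peval_select_var; congr mmap; apply: funext => j /=.
    by rewrite /t p_s /cons_point liftK.
  rewrite eq_a -eq_f pevalD pevalM g_Y // l_eval p_s /cons_point unlift_none subrr.
  by rewrite mulr0 addr0.
have [P [P_prime IP PS]] := prime_avoiding I_ideal S1 SM I_S.
pose Z := zero_locus P.
have Z_irr : irreducible_variety Z by exact: prime_irreducible.
have vanishZ f : vanishing Z f <-> P f by exact: vanishing_zero_locus.
have VYP f : vanishing Y f -> P f.
  by move=> f_Y; apply: IP; exists f => //; exists 0; rewrite // mul0r addr0.
have ltZY : Z `<` Y.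
  split=> [p Zp|sub].
    have [_ Y_closed _] := Y_irr; apply: (zclosed_vanishing Y_closed) => f f_Y.
    by apply: Zp; apply: VYP.
  have Pl : P l by apply: IP; exists 0 => //; exists 1; rewrite // mul1r add0r.
  have /s_free /(congr1 (mmap idfun (fun _ => c + 1))) :
      vanishing Y l by move=> p /sub; apply.
  rewrite rmorphB /= mmapXU mmapC raddf0 /= addrC addKr => /eqP.
  by rewrite oner_eq0.
have [e Z_dim] := coord_dim_exists Z_irr.
have le_de : (d <= e)%N.
  apply: (Z_dim.2 _ t) => a /vanishZ Pa; apply: contrapT => /eqP a_neq0.
  by apply: (PS _ Pa); exists a.
have := coord_dim_lt Z_irr Y_irr ltZY Z_dim Y_dim; rewrite ltnS => le_ed.
have eq_de : d = e by apply/eqP; rewrite eqn_leq le_de.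
by exists Z; split=> //; rewrite eq_de.
Qed.

Lemma irr_chain_leq Y k d : irreducible_variety Y -> coord_dim Y d ->
  irr_chain Y k -> (k <= d)%N.
Proof.
elim: k Y d => // k IHk Y d Y_irr Y_dim [Zs [Zs_irr Zs_lt Zs_Y]].
have Z_irr := Zs_irr k (leqnSn k).
have [e Z_dim] := coord_dim_exists Z_irr.
have lt_ed : (e < d)%N.
  by apply: (coord_dim_lt Z_irr Y_irr _ Z_dim Y_dim); rewrite -Zs_Y; apply: Zs_lt.
apply: leq_ltn_trans lt_ed; apply: (IHk (Zs k)) => //.
exists Zs; split=> // j lt_jk; first by apply: Zs_irr; apply: leqW.
by apply: Zs_lt; apply: leqW.
Qed.

Lemma irr_chain_coord_dim Y d : irreducible_variety Y -> coord_dim Y d ->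
  irr_chain Y d.
Proof.
elim: d Y => [|d IHd] Y Y_irr Y_dim; first by exists (fun _ => Y).
have [Z [Z_irr ltZY Z_dim]] := coord_dim_step Y_irr Y_dim.
have [Zs [Zs_irr Zs_lt Zs_Z]] := IHd Z Z_irr Z_dim.
exists (fun j => if (j <= d)%N then Zs j else Y); split=> [j _|j|].
- by case: ifP => // le_jd; apply: Zs_irr.
- rewrite ltnS => le_jd; rewrite le_jd; move: le_jd.
  rewrite leq_eqVlt => /orP[/eqP ->|lt_jd]; first by rewrite ltnn Zs_Z.
  by rewrite lt_jd; apply: Zs_lt.
by rewrite ltnn.
Qed.

Lemma coord_dim_variety_dim Y d : irreducible_variety Y -> coord_dim Y d ->
  variety_dim Y d.
Proof.
move=> Y_irr Y_dim; split; first exact: irr_chain_coord_dim.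
by move=> /(irr_chain_leq Y_irr Y_dim); rewrite ltnn.
Qed.

End Dimension.

(** * Smooth points and critical points *)

Section Gradients.
Variables (R : realType) (n : nat).
Local Notation C := (R[i]).
Implicit Types (Y : set 'rV[C]_n) (f g : mpoly n C) (p u v : 'rV[C]_n).

Lemma pgradE f p i : pgrad f p ord0 i = peval (mderiv i f) p.
Proof. by rewrite mxE. Qed.

Lemma pgrad_lin r (c : 'I_r -> C) (fs : 'I_r -> mpoly n C) p :
  pgrad (\sum_k mpolyC n (c k) * fs k) p = \sum_k c k *: pgrad (fs k) p.
Proof.
apply/rowP => i; rewrite mxE summxE raddf_sum /=.
elim/big_rec2: _ => [|k a b _ IH]; first exact: peval0.
by rewrite pevalD IH mderiv_mulC pevalM pevalC !mxE.
Qed.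

Lemma pgradD f g p : pgrad (f + g) p = pgrad f p + pgrad g p.
Proof. by apply/rowP => i; rewrite !mxE mderivD pevalD. Qed.

Lemma pgradN f p : pgrad (- f) p = - pgrad f p.
Proof. by apply/rowP => i; rewrite !mxE mderivN pevalN. Qed.

(** By double annihilation the covector is a combination of gradients of equations; the same
    combination of the equations is again an equation of [Y], so one polynomial suffices. *)
Lemma conormal_gradient Y p (w : 'rV[C]_n) :
    (forall v, tangent_space Y p v -> \sum_i v ord0 i * w ord0 i = 0) ->
  exists2 f, vanishing Y f & w = pgrad f p.
Proof.
move=> w_tan; have [r [B [_ BW WB]]] := spanning_rows (fun w : 'rV[C]_n =>
  exists2 f, vanishing Y f & w = pgrad f p).
have /choice[fs fsP] : forall k : 'I_r, exists f, vanishing Y f /\ row k B = pgrad f p.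
  by move=> k; have [f f_Y rowk] := BW k; exists f.
have /submxP[c eq_w] : (w <= B)%MS.
  rewrite submxE; apply/eqP/rowP => j; rewrite !mxE.
  pose v : 'rV[C]_n := \row_i cokermx B i j.
  rewrite -[RHS](w_tan v); last first.
    move=> f f_Y; have /submxP[a eq_f] : (pgrad f p <= B)%MS by apply: WB; exists f.
    have := congr1 (fun A : 'rV_n => (A *m cokermx B) 0 j) eq_f.
    rewrite -mulmxA mulmx_coker mulmx0 [RHS]mxE => eq0; rewrite -[RHS]eq0 [RHS]mxE.
    by apply: eq_bigr => i _; rewrite [v _ _]mxE.
  by apply: eq_bigr => i _; rewrite [v _ _]mxE mulrC.
exists (\sum_k mpolyC n (c 0 k) * fs k).
  have [VY0 VYD VYM] := vanishing_ideal Y.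
  by elim/big_ind: _ => // k _; apply: VYM; exact: (fsP k).1.
rewrite pgrad_lin eq_w mulmx_sum_row; apply: eq_bigr => k _.
by rewrite (fsP k).2.
Qed.

Section SmoothLocus.
Variables (Y : set 'rV[C]_n) (M : fieldType) (iota : {rmorphism C -> M}).
Variable x : 'I_n -> M.
Hypotheses (Y_irr : irreducible_variety Y).
Hypothesis xP : forall f, mmap iota x f = 0 <-> vanishing Y f.

(* [mu] is a maximal minor of the Jacobian matrix, and Cramer's rule makes
   [mu *: grad f] a combination of the [grad (fs k)] modulo [I(Y)]. *)
Lemma generic_smooth : exists r (fs : 'I_r -> mpoly n C) (mu : mpoly n C),
  [/\ forall k, vanishing Y (fs k), mmap iota x mu != 0,
      forall f, vanishing Y f ->
        exists a : 'I_r -> M, forall i,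
          mmap iota x (mderiv i f) = \sum_k a k * mmap iota x (mderiv i (fs k)) &
      forall p, Y p -> peval mu p != 0 -> smooth_point Y p /\
        forall v, (forall k, \sum_i pgrad (fs k) p ord0 i * v ord0 i = 0) ->
          tangent_space Y p v].
Proof.
have char0 := rmorph_pchar0 iota (@complex_pchar0 R).
have [d [s s_max]] := maximal_independent_exists iota x.
have Y_dim : coord_dim Y d by apply/(coord_dim_maximal xP); exists s.
have [r [fs [rd fs_x G_free G_span]]] := gradient_basis char0 s_max.
set G : 'M[M]_(r, n) := \matrix_(_, _) _ in G_free G_span.
pose Gp : 'M[mpoly n C]_(r, n) := \matrix_(k, i) mderiv i (fs k).
have GpE : map_mx (mmap iota x) Gp = G by apply/matrixP => k i; rewrite !mxE.
have GT_full : row_full G^T by rewrite /row_full mxrank_tr.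
pose c := fullrankfun GT_full.
have G_unit : \det (colsub c G) != 0.
  rewrite -det_tr -unitfE -unitmxE.
  have -> : (colsub c G)^T = rowsub c G^T by apply/matrixP => i j; rewrite !mxE.
  exact: fullrowsub_unit.
pose mu := \det (colsub c Gp).
have mu_x : mmap iota x mu = \det (colsub c G).
  by rewrite /mu -det_map_mx -GpE; congr (\det _); apply/matrixP => i j; rewrite !mxE.
pose gradp f : 'rV[mpoly n C]_n := \row_i mderiv i f.
pose rel f := mu *: gradp f - colsub c (gradp f) *m \adj (colsub c Gp) *m Gp.
have rel_vanish f i : vanishing Y f -> vanishing Y (rel f 0 i).
  move=> f_Y; apply/xP.
  have /submxP[a eq_a] := G_span f ((xP f).2 f_Y).
  suff /matrixP/(_ 0 i) : map_mx (mmap iota x) (rel f) = 0 by rewrite !mxE.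
  have grad_x : map_mx (mmap iota x) (gradp f) = a *m G.
    by rewrite -eq_a; apply/rowP => j; rewrite !mxE.
  have grad_c : map_mx (mmap iota x) (colsub c (gradp f)) = a *m colsub c G.
    by rewrite mulmx_colsub -grad_x; apply/rowP => j; rewrite !mxE.
  have Gp_c : map_mx (mmap iota x) (colsub c Gp) = colsub c G.
    by rewrite -GpE; apply/matrixP => k j; rewrite !mxE.
  rewrite /rel map_mxB map_mxZ /= mu_x grad_x !map_mxM /= map_mx_adj grad_c Gp_c GpE.
  by rewrite -[a *m _ *m _]mulmxA mul_mx_adj mul_mx_scalar -scalemxAl subrr.
exists r, fs, mu; split.
- by move=> k; apply/xP.
- by rewrite mu_x.
- move=> f f_Y; have /submxP[a eq_a] := G_span f ((xP f).2 f_Y).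
  exists (fun k => a 0 k) => i; have /rowP/(_ i) := eq_a.
  by rewrite !mxE => ->; apply: eq_bigr => k _; rewrite !mxE.
move=> p Yp mu_p.
pose ev : {rmorphism mpoly n C -> C} := mmap idfun (p ord0).
have evE f : ev f = peval f p by [].
pose P : 'M[C]_(r, n) := map_mx ev Gp.
have PE k i : P k i = pgrad (fs k) p ord0 i by rewrite !mxE.
have grad_sub f : vanishing Y f -> (pgrad f p <= P)%MS.
  move=> f_Y; rewrite -(eqmx_scale _ mu_p).
  have : map_mx ev (rel f) = 0.
    by apply/rowP => i; rewrite mxE [RHS]mxE; exact: rel_vanish.
  rewrite /rel map_mxB map_mxZ !map_mxM /= => /eqP; rewrite subr_eq0 => /eqP eq_f.
  have -> : pgrad f p = map_mx ev (gradp f) by apply/rowP => i; rewrite !mxE.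
  by rewrite -evE eq_f submxMl.
have P_free : row_free P.
  have P_unit : colsub c P \in unitmx.
    rewrite unitmxE unitfE; have -> // : \det (colsub c P) = peval mu p.
    by rewrite -evE /mu -det_map_mx; congr (\det _); apply/matrixP => i j; rewrite !mxE.
  rewrite -row_leq_rank -{1}(mxrank_unit P_unit).
  have -> : colsub c P = P *m colsub c 1%:M by rewrite mulmx_colsub mulmx1.
  exact: mxrankM_maxl.
have tanP v : tangent_space Y p v <-> (v <= kermx P^T)%MS.
  have sum_mx f : \sum_i (pgrad f p) ord0 i * v ord0 i = (v *m (pgrad f p)^T) 0 0.
    by rewrite mxE; apply: eq_bigr => i _; rewrite [in RHS]mxE mulrC.
  split=> [v_tan|/sub_kermxP vP f f_Y]; last first.
    by rewrite sum_mx; have /submxP[a ->] := grad_sub f f_Y; rewrite trmx_mul mulmxA vP mul0mx mxE.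
  apply/sub_kermxP/rowP => k; rewrite !mxE.
  rewrite -[RHS](v_tan (fs k)); last by apply/xP.
  by apply: eq_bigr => i _; rewrite -PE [P^T _ _]mxE mulrC.
split; last first.
  move=> v v_fs; apply/tanP/sub_kermxP/rowP => k; rewrite !mxE -[RHS](v_fs k).
  by apply: eq_bigr => i _; rewrite -PE [P^T _ _]mxE mulrC.
split=> //; exists d; split; first exact: coord_dim_variety_dim.
have rank_ker : \rank (kermx P^T) = d.
  by rewrite mxrank_ker mxrank_tr (eqP P_free) -rd addKn.
rewrite -rank_ker; exists (row_base (kermx P^T)); split; first exact: row_base_free.
by move=> v; rewrite tanP eq_row_base.
Qed.

End SmoothLocus.

(** Criticality in explicit form: the covector is the logarithmic gradient plus a conormal vector.
    This recovers [u] from [p] and [f], which both directions of the equivalence use. *)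
Lemma crit_points_conormal F Y u p : crit_points F Y u p ->
  [/\ Y p, peval F p != 0 & exists2 f, vanishing Y f &
      u = (peval F p)^-1 *: pgrad F p + pgrad f p].
Proof.
move=> [[Yp _] F_p crit]; split=> //.
have [|f f_Y eq_f] := @conormal_gradient Y p ((peval F p)^-1 *: pgrad F p - u).
  move=> v /crit crit_v; rewrite -[RHS]crit_v; apply: eq_bigr => i _.
  by congr (_ * _); rewrite mxE [in RHS]mulrC [X in X + _]mxE [X in _ + X]mxE.
exists (- f); first by move=> q Yq; rewrite pevalN f_Y // oppr0.
by rewrite pgradN -eq_f opprB addrC subrK.
Qed.

Lemma conormal_crit_points F Y p f : smooth_point Y p -> peval F p != 0 ->
  vanishing Y f -> crit_points F Y ((peval F p)^-1 *: pgrad F p + pgrad f p) p.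
Proof.
move=> p_smooth F_p f_Y; split=> // v /(_ _ f_Y) v_f.
rewrite -[RHS]oppr0 -[in RHS]v_f -sumrN; apply: eq_bigr => i _.
by rewrite !mxE [_^-1 * _]mulrC opprD addrA subrr sub0r mulrN mulrC.
Qed.

End Gradients.

(** * Derivatives along lines *)

Section Calculus.
Variables (K : numFieldType) (n : nat).

Lemma is_derive_ext (f g : K -> K^o) (x : K) (df : K) :
  f =1 g -> is_derive (x : K^o) (1 : K^o) f df -> is_derive (x : K^o) (1 : K^o) g df.
Proof. by move=> /funext ->. Qed.

Lemma is_derive_mmap (c : 'I_n -> K -> K^o) (dc : 'I_n -> K) (x : K) (f : mpoly n K) :
    (forall i, is_derive (x : K^o) (1 : K^o) (c i) (dc i)) ->
  is_derive (x : K^o) (1 : K^o) (fun h => mmap idfun (c^~ h) f : K^o)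
    (\sum_i mmap idfun (c^~ x) (mderiv i f) * dc i).
Proof.
move=> c_der; elim/mpoly_ring_ind: f => [a|j|p q p_der q_der|p q p_der q_der].
- apply: (is_derive_ext (f := cst a)) => [h|]; first by rewrite mmapC.
  apply: (is_derive_eq (is_derive_cst _ _ _)).
  by rewrite big1 // => i _; rewrite mderivC raddf0 mul0r.
- apply: (is_derive_ext (f := c j)) => [h|]; first by rewrite mmapXU.
  apply: (is_derive_eq (c_der j)).
  by rewrite (sum_mderivXU (mmap idfun (c^~ x))).
- apply: (is_derive_ext
    (f := (fun h => mmap idfun (c^~ h) p : K^o) + (fun h => mmap idfun (c^~ h) q))).
    by move=> h; rewrite [RHS]rmorphD.
  apply: (is_derive_eq (is_deriveD p_der q_der)).
  by rewrite -big_split; apply: eq_bigr => i _ /=; rewrite mderivD rmorphD mulrDl.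
apply: (is_derive_ext
  (f := (fun h => mmap idfun (c^~ h) p : K^o) * (fun h => mmap idfun (c^~ h) q : K^o))).
  by move=> h; rewrite [RHS]rmorphM.
apply: (is_derive_eq (is_deriveM p_der q_der)).
rewrite /GRing.scale /= mulr_sumr mulr_sumr -big_split; apply: eq_bigr => i _ /=.
by rewrite mderivM rmorphD !rmorphM /=; ring.
Qed.

Lemma is_derive_line (a b x : K) :
  is_derive (x : K^o) (1 : K^o) (fun h => a + h * b : K^o) b.
Proof.
apply: (is_derive_ext (f := cst a + (b \*: (id : K^o -> K^o)))) => [h|].
  by rewrite /= [in RHS]mulrC.
by apply: is_derive_eq; rewrite add0r /GRing.scale /= mulr1.
Qed.

Lemma is_derive_quotient (f g : K -> K^o) (df dg x : K) :
    is_derive (x : K^o) (1 : K^o) f df -> is_derive (x : K^o) (1 : K^o) g dg ->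
    g x != 0 ->
  is_derive (x : K^o) (1 : K^o) (fun h => f h / g h : K^o)
    ((df * g x - f x * dg) / g x ^+ 2).
Proof.
move=> f_der g_der g_x.
have gV_der : is_derive (x : K^o) (1 : K^o) (fun h => (g h)^-1 : K^o) (- (g x) ^- 2 * dg).
  apply: DeriveDef; first by apply: derivableV => //; apply: ex_derive.
  by rewrite deriveV // derive_val.
apply: (is_derive_eq (is_deriveM f_der gV_der)).
rewrite /GRing.scale /=; field.
exact: g_x.
Qed.

Lemma is_derive_power e (c : K) :
  is_derive (0 : K^o) (1 : K^o) (fun h => (1 + h) ^+ e * c : K^o) (e%:R * c).
Proof.
have line := is_derive_line 1 1 0.
apply: (is_derive_eq (is_derive_ext _
  (is_deriveM (is_deriveX e line) (is_derive_cst (c : K^o) (0 : K^o) (1 : K^o))))) => [h|].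
  by rewrite mulrfctE exprfctE mulr1.
by rewrite scaler0 add0r /GRing.scale /= mul0r addr0 expr1n !mulr1 mulrC.
Qed.

End Calculus.

Lemma is_derive_unique (K : numFieldType) (f : K -> K^o) (x a b : K) :
  is_derive (x : K^o) (1 : K^o) f a -> is_derive (x : K^o) (1 : K^o) f b -> a = b.
Proof. by move=> [_ <-] [_ <-]. Qed.

Section ComplexCalculus.
Variables (R : realType) (n : nat).
Local Notation C := (R[i]).
Implicit Types (Y : set 'rV[C]_n) (f g F : mpoly n C) (p u v : 'rV[C]_n).

Definition pdiff f p v : C := \sum_i peval (mderiv i f) p * v ord0 i.

Lemma is_derive_peval f u v :
  is_derive (0 : C^o) (1 : C^o) (fun h : C => peval f (u + h *: v) : C^o) (pdiff f u v).
Proof.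
have line i : is_derive (0 : C^o) (1 : C^o)
    (fun h : C => u ord0 i + h * v ord0 i : C^o) (v ord0 i) by exact: is_derive_line.
apply: (is_derive_eq (is_derive_ext _ (is_derive_mmap f line))) => [h|].
  by rewrite peval_mmap; congr mmap; apply: funext => i; rewrite !mxE.
apply: eq_bigr => i _; rewrite peval_mmap; congr (mmap _ _ _ * _).
by apply: funext => j; rewrite mul0r addr0.
Qed.

Definition rdiff (N : 'I_n -> mpoly n C) D u v : 'rV[C]_n :=
  \row_j ((pdiff (N j) u v * peval D u - peval (N j) u * pdiff D u v) / peval D u ^+ 2).

Lemma is_derive_reval N D u v j : rdom D u ->
  is_derive (0 : C^o) (1 : C^o) (fun h : C => reval N D (u + h *: v) ord0 j : C^o)
    (rdiff N D u v ord0 j).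
Proof.
move=> D_u; rewrite mxE.
have u0 : u + 0 *: v = u by rewrite scale0r addr0.
have := is_derive_quotient (is_derive_peval (N j) u v) (is_derive_peval D u v).
rewrite u0 => /(_ D_u); apply: is_derive_ext => h.
by rewrite mxE.
Qed.

Lemma is_derive_comp_reval f N D u v : rdom D u ->
  is_derive (0 : C^o) (1 : C^o) (fun h : C => peval f (reval N D (u + h *: v)) : C^o)
    (pdiff f (reval N D u) (rdiff N D u v)).
Proof.
move=> D_u; have := is_derive_mmap f (fun j => is_derive_reval N v j D_u).
by rewrite scale0r addr0.
Qed.

Lemma derive1_is_derive (g : C -> C^o) (a : C) :
  is_derive (0 : C^o) (1 : C^o) g a -> derive1 g 0 = a.
Proof. by move=> g_der; rewrite derive1E; exact: derive_val. Qed.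

Lemma partial_comp_reval f N D u k : rdom D u ->
  partial (fun w => peval f (reval N D w)) u k =
  pdiff f (reval N D u) (rdiff N D u (delta_mx ord0 k)).
Proof. by move=> D_u; apply/derive1_is_derive/is_derive_comp_reval. Qed.

Lemma homogeneous_scale F e t p :
    F \is @mpoly.ishomog1 n C e (mpoly.mpoly_mdeg__canonical__mpoly_Measure n) ->
  peval F (t *: p) = t ^+ e * peval F p.
Proof.
move=> /dhomogP F_hom; rewrite /peval !mevalE mulr_sumr big_seq [RHS]big_seq.
apply: eq_bigr => m /F_hom m_e; rewrite mulrCA; congr (_ * _).
have -> : t ^+ e = \prod_i t ^+ m i by rewrite prodrXr -m_e /= mdegE.
by rewrite -big_split; apply: eq_bigr => i _; rewrite mxE exprMn.
Qed.

Lemma euler F e p :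
    F \is @mpoly.ishomog1 n C e (mpoly.mpoly_mdeg__canonical__mpoly_Measure n) ->
  pdiff F p p = e%:R * peval F p.
Proof.
move=> F_hom; apply: is_derive_unique (is_derive_peval F p p) _.
apply: is_derive_ext (is_derive_power e (peval F p)) => h.
by rewrite -[p in peval F (p + _)]scale1r -scalerDl (homogeneous_scale _ _ F_hom).
Qed.

Lemma pdiff_pgrad f p v : pdiff f p v = \sum_i pgrad f p ord0 i * v ord0 i.
Proof. by apply: eq_bigr => i _; rewrite pgradE. Qed.

Lemma tangent_space_pdiff Y p v : tangent_space Y p v <->
  forall f, vanishing Y f -> pdiff f p v = 0.
Proof. by split=> v_tan f /v_tan; rewrite pdiff_pgrad. Qed.

Section Cone.
Variable Y : set 'rV[C]_n.
Hypothesis Y_cone : affine_cone_of_proj_variety Y.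

Lemma cone_irreducible : irreducible_variety Y.
Proof. by have [] := Y_cone. Qed.

Lemma cone_scale t p : Y p -> Y (t *: p).
Proof.
have [_ [S [S_hom ->]] _] := Y_cone => p_S f Sf.
by have [e /homogeneous_scale ->] := S_hom f Sf; rewrite p_S // mulr0.
Qed.

Lemma cone_tangent p : Y p -> tangent_space Y p p.
Proof.
move=> Yp; apply/tangent_space_pdiff => f f_Y.
apply: is_derive_unique (is_derive_peval f p p) _.
apply: (is_derive_ext (f := cst 0)) => h.
by rewrite -[p in peval f (p + _)]scale1r -scalerDl f_Y //; apply: cone_scale.
Qed.

Definition scale_poly (t : C) f : mpoly n C :=
  mmap (@mpolyC n C) (fun i => mpolyC n t * mpolyX C (mnm1 i)) f.

Lemma peval_scale_poly t f p : peval (scale_poly t f) p = peval f (t *: p).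
Proof.
apply: (mpoly_rmorphism_eq (f := mmap idfun (p ord0) \o mmap (@mpolyC n C) _)
  (g := mmap idfun ((t *: p) ord0))) => [a|i] /=; first by rewrite !mmapC /= ?mmapC.
by rewrite !mmapXU rmorphM /= mmapC mmapXU mxE.
Qed.

Lemma pdiff_scale_poly t f p v : pdiff (scale_poly t f) p v = pdiff f (t *: p) (t *: v).
Proof.
apply: is_derive_unique (is_derive_peval (scale_poly t f) p v) _.
apply: is_derive_ext (is_derive_peval f (t *: p) (t *: v)) => h.
by rewrite peval_scale_poly scalerDr !scalerA mulrC.
Qed.

Lemma pdiff_scaler f p t v : pdiff f p (t *: v) = t * pdiff f p v.
Proof. by rewrite mulr_sumr; apply: eq_bigr => i _; rewrite mxE mulrCA. Qed.

Lemma cone_tangent_sub t p v : t != 0 -> tangent_space Y p v -> tangent_space Y (t *: p) v.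
Proof.
move=> t_neq0 /tangent_space_pdiff v_tan; apply/tangent_space_pdiff => f f_Y.
have /v_tan : vanishing Y (scale_poly t f).
  by move=> q Yq; rewrite peval_scale_poly f_Y //; apply: cone_scale.
by rewrite pdiff_scale_poly pdiff_scaler => /eqP; rewrite mulf_eq0 (negbTE t_neq0) => /eqP.
Qed.

Lemma cone_tangent_scale t p v : t != 0 ->
  tangent_space Y (t *: p) v <-> tangent_space Y p v.
Proof.
move=> t_neq0; split; last exact: cone_tangent_sub.
have tV_neq0 : t^-1 != 0 by rewrite invr_eq0.
by move=> /(cone_tangent_sub tV_neq0); rewrite scalerA mulVf // scale1r.
Qed.

Lemma log_gradientE F u p v : \sum_i v ord0 i * (pgrad F p ord0 i / peval F p - u ord0 i) =
  pdiff F p v / peval F p - \sum_i u ord0 i * v ord0 i.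
Proof.
rewrite mulr_suml -sumrB; apply: eq_bigr => i _.
by rewrite pgradE mulrBr mulrA [v _ _ * u _ _]mulrC [v _ _ * _]mulrC.
Qed.

(** At [t^-1 p] the tangent space is that at [p], while the logarithmic gradient of the homogeneous
    [F] is multiplied by [t], just as [u] is. *)
Lemma crit_points_scale F u p t : homogeneous F -> t != 0 ->
  crit_points F Y u p -> crit_points F Y (t *: u) (t^-1 *: p).
Proof.
move=> [e F_hom] t_neq0 [[Yp [k [Yk Tk]]] F_p crit].
have tV_neq0 : t^-1 != 0 by rewrite invr_eq0.
have tanE v := cone_tangent_scale p v tV_neq0.
have F_tp : peval F (t^-1 *: p) = t^-1 ^+ e * peval F p by exact: homogeneous_scale.
split.
- split; first exact: cone_scale.
  exists k; split=> //; have [B [B_free TB]] := Tk.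
  by exists B; split=> // v; rewrite tanE.
- by rewrite F_tp mulf_neq0 ?expf_neq0.
move=> v /tanE v_tan; have := crit v v_tan; rewrite !log_gradientE => /eqP.
rewrite subr_eq0 => /eqP crit_v.
have dF : t^-1 * pdiff F (t^-1 *: p) v = t^-1 ^+ e * pdiff F p v.
  rewrite -pdiff_scaler -pdiff_scale_poly.
  apply: is_derive_unique (is_derive_peval _ p v) _.
  have := is_deriveZ (t^-1 ^+ e) (is_derive_peval F p v); apply: is_derive_ext => h.
  by rewrite peval_scale_poly (homogeneous_scale _ _ F_hom).
have te : t^-1 ^+ e != 0 by rewrite expf_neq0.
have -> : pdiff F (t^-1 *: p) v = t * (t^-1 ^+ e * pdiff F p v).
  by rewrite -dF mulrA divff // mul1r.
have -> : \sum_i (t *: u) ord0 i * v ord0 i = t * \sum_i u ord0 i * v ord0 i.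
  by rewrite mulr_sumr; apply: eq_bigr => i _; rewrite mxE mulrA.
rewrite F_tp -crit_v; move: (_ ^+ e) te => c c_neq0; field.
by rewrite F_p.
Qed.

(** A cone contains the line through [p], so [p] is itself a tangent vector; pairing the critical
    equation with it leaves Euler's identity. *)
Lemma crit_points_degree F e u p :
    F \is @mpoly.ishomog1 n C e (mpoly.mpoly_mdeg__canonical__mpoly_Measure n) ->
  crit_points F Y u p -> \sum_i u ord0 i * p ord0 i = e%:R.
Proof.
move=> F_hom [[Yp _] F_p crit]; have := crit p (cone_tangent Yp).
rewrite log_gradientE (euler _ F_hom) mulfK // => /eqP.
by rewrite subr_eq0 => /eqP.
Qed.

End Cone.
End ComplexCalculus.

(** * Generic critical points *)

(** The polynomial [e] and the exponent [k] do not depend on the field or the point, so an identity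
    found at a generic point can be read at complex points. *)
Lemma clear_denominators (C : fieldType) m n (h : mpoly m C)
    (a : 'I_m -> mpoly n C) (b : mpoly n C) :
  exists e k, forall (L : fieldType) (l : {rmorphism C -> L}) (y : 'I_n -> L),
    mmap l y b != 0 ->
    mmap l (fun i => mmap l y (a i) / mmap l y b) h * mmap l y b ^+ k = mmap l y e.
Proof.
elim/mpoly_ring_ind: h => [c|i|p q [e [k ek]] [f [j fj]]|p q [e [k ek]] [f [j fj]]].
- by exists (mpolyC n c), 0%N => L l y b_y; rewrite !mmapC mulr1.
- by exists (a i), 1%N => L l y b_y; rewrite mmapXU expr1 divfK.
- exists (e * b ^+ j + f * b ^+ k), (k + j)%N => L l y b_y.
  rewrite rmorphD mulrDl [RHS]rmorphD !(rmorphM (mmap l y)) !(rmorphXn (mmap l y)) /=.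
  by rewrite -ek // -fj // exprD; ring.
exists (e * f), (k + j)%N => L l y b_y.
by rewrite rmorphM [RHS]rmorphM /= -ek // -fj // exprD; ring.
Qed.

Section GenericCovector.
Variables (R : realType) (n : nat).
Local Notation C := (R[i]).
Variables (Y : set 'rV[C]_n) (F : mpoly n C).
Hypothesis Y_irr : irreducible_variety Y.
Variables (M : fieldType) (iota : {rmorphism C -> M}) (x : 'I_n -> M).
Hypothesis xP : forall f, mmap iota x f = 0 <-> vanishing Y f.
Variables (r : nat) (fs : 'I_r -> mpoly n C) (mu : mpoly n C).
Hypothesis fs_Y : forall k, vanishing Y (fs k).
Hypothesis mu_smooth : forall p, Y p -> peval mu p != 0 -> smooth_point Y p.
Hypothesis mu_x : mmap iota x mu != 0.
Hypothesis F_x : mmap iota x F != 0.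
Variable c : 'I_r -> M.

Definition generic_covector (i : 'I_n) : M :=
  mmap iota x (mderiv i F) / mmap iota x F + \sum_k c k * mmap iota x (mderiv i (fs k)).

Variables (B : comNzRingType) (q : {rmorphism mpoly n C -> B}) (phi : {rmorphism B -> M}).
Hypothesis phi_q : forall a, phi (q a) = mmap iota generic_covector a.

(** The point [x] and the coefficients [c] are specialised together as unknowns over [B]. The ring
    [B] is left open: [C[u]] with an extra variable carrying a coordinate of [x] tests whether that
    coordinate is rational, and plain [C[u]] serves once all are. The last clause transports
    relations between [B] and [x]. *)
Lemma specialize_covector (w : mpoly n C) : mmap iota x w != 0 ->
  exists t, phi t != 0 /\ forall beta : {rmorphism B -> C},
    specializes phi beta -> (forall a, beta (q (mpolyC n a)) = a) -> beta t != 0 ->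
    exists p, [/\ crit_points F Y (\row_i beta (q (mpolyX C (mnm1 i)))) p,
      peval w p != 0 &
      forall b0 b1 h, phi b0 = phi b1 * mmap iota x h -> beta b0 = beta b1 * peval h p].
Proof.
move=> w_x.
pose z (i : 'I_(n + r)) := match fintype.split i with inl j => x j | inr k => c k end.
have zl j : z (lshift r j) = x j by rewrite /z -[lshift r j]/(unsplit (inl j)) unsplitK.
have zr k : z (rshift n k) = c k by rewrite /z -[rshift n k]/(unsplit (inr k)) unsplitK.
pose cst_B : {rmorphism C -> B} := q \o @mpolyC n C.
pose em (h : mpoly n C) : mpoly (n + r) B :=
  mmap (@mpolyC (n + r) B \o cst_B) (fun j => mpolyX B (mnm1 (lshift r j))) h.
have em_z h : mmap phi z (em h) = mmap iota x h.
  apply: (mpoly_rmorphism_eq (f := mmap phi z \o em) (g := mmap iota x)) => [a|i] /=.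
    by rewrite /em !mmapC /= ?mmapC /= phi_q mmapC.
  by rewrite /em !mmapXU zl.
(* The factors [F] and [mu] keep the specialised point off [V(F)] and smooth; [w] is an additional
   condition, free to choose. *)
have v_z : mmap phi z (em (F * mu * w)) != 0.
  by rewrite em_z !rmorphM !mulf_neq0.
have [t [t_neq0 t_spec]] := specialize_mpoly (@complex_has_roots R) v_z.
exists t; split=> // beta ker_phi beta_C t_beta.
have [xi [xi_spec v_xi]] := t_spec beta ker_phi t_beta.
pose p : 'rV[C]_n := \row_j xi (lshift r j).
have em_p h : mmap beta xi (em h) = peval h p.
  rewrite peval_rV.
  apply: (mpoly_rmorphism_eq (f := mmap beta xi \o em)
    (g := mmap idfun (fun j => xi (lshift r j)))) => [a|i] /=.
    by rewrite /em !mmapC /= ?mmapC /= beta_C.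
  by rewrite /em !mmapXU.
clearbody em; move: v_xi; rewrite em_p !pevalM !mulf_eq0 !negb_or => /andP[/andP[F_p mu_p] w_p].
have Yp : Y p.
  have [_ Y_closed _] := Y_irr; apply: (zclosed_vanishing Y_closed) => f /xP f_x.
  by rewrite -em_p; apply: xi_spec; rewrite /= em_z.
exists p; split=> //; last first.
  move=> b0 b1 h eq_b; apply/eqP; rewrite -subr_eq0; apply/eqP.
  pose rel := mpolyC (n + r) b0 - mpolyC (n + r) b1 * em h.
  have rel_z : mmap phi z rel = 0.
    by rewrite rmorphB rmorphM /= !mmapC em_z; apply/eqP; rewrite subr_eq0; apply/eqP.
  by have := xi_spec rel rel_z; rewrite /= rmorphB rmorphM /= !mmapC em_p.
pose f := \sum_k mpolyC n (xi (rshift n k)) * fs k.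
have f_Y : vanishing Y f.
  have [VY0 VYD VYM] := vanishing_ideal Y.
  by rewrite /f; elim/big_ind: _ => // k _; apply: VYM.
have -> : \row_i beta (q (mpolyX C (mnm1 i))) = (peval F p)^-1 *: pgrad F p + pgrad f p.
  apply/rowP => i; rewrite pgrad_lin !mxE summxE.
  apply: (mulfI F_p); rewrite mulrDr mulVKf // mulr_sumr.
  (* The definition of the generic covector multiplied by [F]: without denominators it is a
     polynomial relation and specialises. *)
  pose rel := em F * mpolyC _ (q (mpolyX C (mnm1 i))) - em (mderiv i F) -
    \sum_k em (F * mderiv i (fs k)) * mpolyX B (mnm1 (rshift n k)).
  have rel_z : mmap phi z rel = 0.
    rewrite /rel !(rmorphB (mmap phi z)) /= rmorphM /= rmorph_sum /= !em_z mmapC /= phi_q mmapXU.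
    rewrite /generic_covector mulrDr [_ * (_ / _)]mulrC divfK // -addrA -opprD.
    apply/eqP; rewrite subr_eq0; apply/eqP; congr (_ + _).
    rewrite mulr_sumr; apply: eq_bigr => k _.
    by rewrite (rmorphM (mmap phi z)) /= mmapXU zr em_z rmorphM /=; ring.
  have := xi_spec rel rel_z; rewrite /rel /= !(rmorphB (mmap beta xi)) /= rmorphM /= rmorph_sum /=.
  rewrite !em_p mmapC => /eqP; rewrite subr_eq0 subr_eq => /eqP ->; rewrite addrC.
  congr (_ + _); apply: eq_bigr => k _.
  by rewrite (rmorphM (mmap beta xi)) /= mmapXU em_p pevalM !mxE; ring.
by apply: conormal_crit_points => //; apply: mu_smooth.
Qed.

End GenericCovector.

(** * Algebraic independence of the generic covector *)

Section MLDOne.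
Variables (R : realType) (n : nat).
Local Notation C := (R[i]).
Variables (Y : set 'rV[C]_n) (F : mpoly n C).
Hypothesis Y_irr : irreducible_variety Y.

Lemma MLD1_unique_crit : MLD_eq F Y 1 ->
  general (fun u => exists p, forall q, crit_points F Y u q <-> q = p).
Proof.
move=> [g [g_neq0 g_crit]]; exists g; split=> // u /g_crit[[|p [|q s]] [_ // _ crit]].
by exists p => q; split=> [/crit|->]; [rewrite inE => /eqP | apply/crit; rewrite inE].
Qed.

Lemma gradient_image_dense (h g : mpoly n C) : h != 0 -> g != 0 ->
    (forall u, peval g u != 0 -> exists p, crit_points F Y u p) ->
  exists f p, [/\ Y p, peval F p != 0, vanishing Y f &
    peval h ((peval F p)^-1 *: pgrad F p + pgrad f p) != 0].
Proof.
move=> h_neq0 g_neq0 g_crit.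
have [u] : exists u, peval (h * g) u != 0 by apply: peval_nonroot; rewrite mulf_neq0.
rewrite pevalM mulf_eq0 negb_or => /andP[h_u /g_crit[p p_crit]].
have [Yp F_p [f f_Y eq_u]] := crit_points_conormal p_crit.
by exists f, p; rewrite -eq_u.
Qed.

Variables (K : fieldType) (iota0 : {rmorphism C -> K}) (x0 : 'I_n -> K).
Hypothesis x0P : forall f, mmap iota0 x0 f = 0 <-> vanishing Y f.
Variables (r : nat) (fs : 'I_r -> mpoly n C).
Hypothesis fs_span : forall f, vanishing Y f -> exists a : 'I_r -> K, forall i,
  mmap iota0 x0 (mderiv i f) = \sum_k a k * mmap iota0 x0 (mderiv i (fs k)).

Let M : fieldType := {fraction (mpoly r K)}.
Let j : {rmorphism K -> M} := @tofrac _ \o @mpolyC r K.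
Let iota : {rmorphism C -> M} := j \o iota0.
Let x i : M := j (x0 i).
Let c k : M := tofrac (mpolyX K (mnm1 k)).
Let U := generic_covector F iota x fs c.

Lemma generic_fraction_eval f : mmap iota x f = j (mmap iota0 x0 f).
Proof. by rewrite (rmorph_mmap (f' := iota)). Qed.

Lemma generic_fractionP f : mmap iota x f = 0 <-> vanishing Y f.
Proof.
rewrite generic_fraction_eval -x0P; split=> [/eqP|->]; last by rewrite raddf0.
by rewrite fmorph_eq0 => /eqP.
Qed.

(** A relation [h] of the covector holds for free variables [c], so these may be replaced by the
    coefficients expressing [grad f] at [x0], for any equation [f]. The resulting identity holds at
    the generic point, hence at all points of [Y] off [V(F)], while existence of critical points for
    general [u] makes such covectors dense. *)
Lemma generic_covector_free h : MLD_eq F Y 1 -> mmap iota U h = 0 -> h = 0.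
Proof.
move=> /MLD1_unique_crit[g [g_neq0 g_crit]] h_U; apply/eqP; apply: contraT => h_neq0.
have [|f [p [Yp F_p f_Y /eqP[]]]] := gradient_image_dense h_neq0 g_neq0.
  by move=> u /g_crit[p crit]; exists p; apply/crit.
pose grad f i : mpoly n C := mderiv i F + F * mderiv i f.
have [e [k eP]] := clear_denominators h (grad f) F.
have F_x : mmap iota0 x0 F != 0 by apply: contra_neqN F_p => /eqP/x0P; apply.
pose P i : mpoly r K := mpolyC r (mmap iota0 x0 (mderiv i F) / mmap iota0 x0 F) +
  \sum_k mpolyX K (mnm1 k) * mpolyC r (mmap iota0 x0 (mderiv i (fs k))).
pose l : {rmorphism C -> mpoly r K} := @mpolyC r K \o iota0.
have P_U i : tofrac (P i) = U i.
  rewrite /P rmorphD (rmorph_sum (@tofrac (mpoly r K))) /= /U /generic_covector.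
  rewrite !generic_fraction_eval -fmorph_div; congr (_ + _); apply: eq_bigr => m _.
  by rewrite rmorphM /= generic_fraction_eval.
have h_P : mmap l P h = 0.
  apply/eqP; rewrite -tofrac_eq0 (rmorph_mmap (f' := iota)) //.
  by have -> : @tofrac _ \o P = U; [apply: funext => i; exact: P_U | apply/eqP].
have [a a_f] := fs_span f_Y.
have h_a : mmap iota0 (fun i => mmap iota0 x0 (grad f i) / mmap iota0 x0 F) h = 0.
  have := congr1 (mmap idfun a) h_P; rewrite raddf0.
  rewrite (rmorph_mmap (psi := mmap idfun a) (f' := iota0)); last first.
    by move=> b; rewrite /l /= mmapC.
  move=> eq0; rewrite -[RHS]eq0; congr (mmap _ _ h); apply: funext => i.
  rewrite /grad rmorphD rmorphM /= mulrDl mulrAC divff // mul1r a_f.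
  rewrite /P rmorphD (rmorph_sum (mmap idfun a)) /= mmapC; congr (_ + _); apply: eq_bigr => m _.
  by rewrite rmorphM /= mmapXU mmapC.
have /x0P e_Y : mmap iota0 x0 e = 0 by rewrite -eP // h_a mul0r.
have := eP _ idfun (p ord0) F_p; rewrite -!peval_mmap e_Y // => /eqP.
rewrite mulf_eq0 expf_eq0 (negbTE F_p) andbF orbF => /eqP eq0.
rewrite -[RHS]eq0 peval_mmap; congr (mmap _ _ h); apply: funext => i.
by rewrite !mxE /grad -!peval_mmap pevalD pevalM mulrDl mulrAC divff // mul1r mulrC.
Qed.

End MLDOne.

(** * Rationality of the critical point *)

Section RationalCritPoint.
Variables (R : realType) (n : nat).
Local Notation C := (R[i]).
Variables (Y : set 'rV[C]_n) (F : mpoly n C).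
Hypothesis Y_irr : irreducible_variety Y.
Variables (M : fieldType) (iota : {rmorphism C -> M}) (x : 'I_n -> M).
Hypothesis xP : forall f, mmap iota x f = 0 <-> vanishing Y f.
Variables (r : nat) (fs : 'I_r -> mpoly n C) (mu : mpoly n C) (c : 'I_r -> M).
Hypothesis fs_Y : forall k, vanishing Y (fs k).
Hypothesis mu_smooth : forall p, Y p -> peval mu p != 0 -> smooth_point Y p.
Hypothesis mu_x : mmap iota x mu != 0.
Hypothesis mld : MLD_eq F Y 1.
Let U := generic_covector F iota x fs c.
Hypothesis U_free : forall h, mmap iota U h = 0 -> h = 0.

Let F_x : mmap iota x F != 0.
Proof.
have [g [g_neq0 g_crit]] := MLD1_unique_crit mld.
have [u /g_crit[p crit]] := peval_nonroot g_neq0.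
have [Yp F_p _] : crit_points F Y u p by apply/crit.
by apply: contra_neqN F_p => /eqP/xP; apply; case: Yp.
Qed.

Let U_eval : {rmorphism mpoly n C -> M} := mmap iota U.

Lemma generic_coordinate_fraction i :
  exists a b, U_eval b != 0 /\ x i = U_eval a / U_eval b.
Proof.
have [g [g_neq0 g_crit]] := MLD1_unique_crit mld.
apply: contrapT => no_frac.
(* The extra variable carries [x i]: its admissible specialisations [y] are values of that
   coordinate at critical points over the same [u]. *)
pose phi : {rmorphism {poly mpoly n C} -> M} := horner_at U_eval (x i).
pose q : {rmorphism mpoly n C -> {poly mpoly n C}} := polyC.
have phi_q a : phi (q a) = mmap iota U a by rewrite /phi /q /= horner_atC.
have [|t [t_neq0 t_spec]] := specialize_covector Y_irr xP fs_Y mu_smooth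
    mu_x F_x phi_q (w := 1).
  by rewrite rmorph1 oner_neq0.
have charM := rmorph_pchar0 iota (@complex_pchar0 R).
have [|t1 [t1_neq0 t1_spec]] :=
    specialize_step_twice (@complex_has_roots R) charM _ t_neq0.
  move=> a b b_neq0; apply/eqP => eq_x; apply: no_frac; by exists a, b.
have [u] : exists u, peval (t1 * g) u != 0.
  apply: peval_nonroot; rewrite mulf_neq0 //.
  by apply: contraNneq t1_neq0 => ->; rewrite raddf0.
rewrite pevalM mulf_eq0 negb_or => /andP[t1_u g_u].
pose beta : {rmorphism mpoly n C -> C} := mmap idfun (u ord0).
have [|y1 [y2 [neq_y y1_spec y2_spec y1_t y2_t]]] := t1_spec beta _ t1_u.
  by move=> a /U_free ->; rewrite raddf0.
have crit_y y : specializes phi (horner_at beta y) -> horner_at beta y t != 0 ->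
    exists2 p, crit_points F Y u p & p ord0 i = y.
  move=> y_spec y_neq0; have [|p [p_crit _ p_rel]] := t_spec (horner_at beta y) y_spec _ y_neq0.
    by move=> a; rewrite /q /= horner_atC /beta /= mmapC.
  exists p.
    suff -> : u = \row_l horner_at beta y (q (mpolyX C (mnm1 l))) by [].
    by apply/rowP => l; rewrite mxE /q /= horner_atC /beta /= mmapXU.
  have := p_rel 'X 1 (mpolyX C (mnm1 i)).
  rewrite /phi /= !rmorph1 !mul1r mmapXU !horner_atX pevalX => /(_ erefl) ->.
  by [].
have [p1 p1_crit p1_y] := crit_y y1 y1_spec y1_t.
have [p2 p2_crit p2_y] := crit_y y2 y2_spec y2_t.
have [p crit] := g_crit u g_u; case/eqP: neq_y.
by rewrite -p1_y -p2_y ((crit p1).1 p1_crit) ((crit p2).1 p2_crit).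
Qed.

Lemma crit_point_rational : exists (N : 'I_n -> mpoly n C) (D : mpoly n C), [/\ D != 0,
  forall u, rdom D u -> forall p, crit_points F Y u p <-> p = reval N D u &
  dominant N D Y].
Proof.
have [g [g_neq0 g_crit]] := MLD1_unique_crit mld.
have /choice[a] := generic_coordinate_fraction => /choice[b ab].
have phi_q e : U_eval (idfun e) = mmap iota U e by [].
pose D0 := \prod_i b i.
pose N0 i := a i * \prod_(l | l != i) b l.
have D0_U : U_eval D0 != 0.
  by rewrite /D0 rmorph_prod; apply/prodf_neq0 => i _; exact: (ab i).1.
have N0_U i : U_eval (N0 i) = U_eval D0 * mmap iota x (mpolyX C (mnm1 i)).
  have eq_D0 : D0 = b i * \prod_(l | l != i) b l by rewrite /D0 (bigD1 i).
  rewrite mmapXU (ab i).2 eq_D0 (rmorphM U_eval (a i)) (rmorphM U_eval (b i)).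
  by rewrite [RHS]mulrAC [U_eval (b i) * _]mulrC divfK // (ab i).1.
(* The condition [w] is [1] for the map itself and, at the end, a polynomial not vanishing on [Y],
   which gives dominance. *)
have spec w : mmap iota x w != 0 -> exists t, t != 0 /\ forall u, peval (t * D0) u != 0 ->
    exists p, [/\ crit_points F Y u p, peval w p != 0 &
      p = \row_i (peval (N0 i) u / peval D0 u)].
  move=> w_x; have [t [t_neq0 t_spec]] := specialize_covector Y_irr xP
    fs_Y mu_smooth mu_x F_x phi_q w_x.
  exists t; split=> [|u].
    by apply: contraNneq t_neq0 => ->; rewrite raddf0.
  rewrite pevalM mulf_eq0 negb_or => /andP[t_u D0_u].
  pose beta : {rmorphism mpoly n C -> C} := mmap idfun (u ord0).
  have [||p [p_crit w_p p_rel]] := t_spec beta _ _ t_u.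
  - by move=> e /U_free ->; rewrite raddf0.
  - by move=> e; rewrite /beta /= mmapC.
  exists p; split=> //.
    suff -> : u = \row_l beta (idfun (mpolyX C (mnm1 l))) by [].
    by apply/rowP => l; rewrite mxE /beta /= mmapXU.
  apply/rowP => i; rewrite mxE; apply: (mulfI D0_u); rewrite mulrC mulrCA divff // mulr1.
  by have /esym := p_rel (N0 i) D0 _ (N0_U i); rewrite pevalX mulrC.
have [|t [t_neq0 t_spec]] := spec 1; first by rewrite rmorph1 oner_neq0.
have D0_neq0 : D0 != 0 by apply: contraNneq D0_U => ->; rewrite raddf0.
(* Numerators and denominator get the common factor [t * g]: the values are unchanged, but on the
   smaller domain each value is the unique critical point. *)
pose D := D0 * (t * g); pose N i := N0 i * (t * g).
have critE u : rdom D u -> forall p, crit_points F Y u p <-> p = reval N D u.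
  rewrite /rdom !pevalM !mulf_eq0 !negb_or => /and3P[D0_u t_u g_u].
  have [|p [p_crit _ eq_p]] := t_spec u; first by rewrite pevalM mulf_neq0.
  have -> : reval N D u = p.
    rewrite eq_p; apply/rowP => i; rewrite !mxE !pevalM.
    by field; rewrite D0_u t_u g_u.
  have [p' crit] := g_crit u g_u; move=> y; rewrite crit.
  by rewrite ((crit p).1 p_crit).
exists N, D; split=> //; first by rewrite !mulf_neq0.
move=> f f_Psi; apply/xP/eqP; apply: contraT => /spec[s [s_neq0 s_spec]].
have [u] : exists u, peval (s * D) u != 0 by apply: peval_nonroot; rewrite !mulf_neq0.
rewrite pevalM mulf_eq0 negb_or => /andP[s_u D_u].
have [|p [p_crit /eqP[]]] := s_spec u.
  by move: D_u; rewrite !pevalM !mulf_eq0 !negb_or => /andP[-> _]; rewrite s_u.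
by rewrite ((critE u D_u p).1 p_crit) f_Psi.
Qed.

End RationalCritPoint.

(** * Derivatives of rational maps along lines *)

Lemma is_derive_near_neq0 (K : numFieldType) (g : K -> K^o) (x dg : K) :
    is_derive (x : K^o) (1 : K^o) g dg -> g x != 0 ->
  \forall h \near (x : K^o), g h != 0.
Proof.
move=> [g_der _] g_x.
have /differentiable_continuous g_cont : differentiable (g : K^o -> K^o) (x : K^o).
  exact/derivable1_diffP.
exact: (@cvgr_neq0 K K^o K^o (nbhs (x : K^o)) _ g (g x) g_cont g_x).
Qed.

(** Identities of rational maps hold off the zeros of a denominator [g]; being differentiable, hence
    continuous, [g] is nonzero near [x], which is enough to compare derivatives at [x]. *)
Lemma is_derive_unique_off_zeros (K : numFieldType) (f1 f2 g : K -> K^o) (x d1 d2 dg : K) :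
    is_derive (x : K^o) (1 : K^o) g dg -> g x != 0 ->
    (forall h, g h != 0 -> f1 h = f2 h) ->
    is_derive (x : K^o) (1 : K^o) f1 d1 -> is_derive (x : K^o) (1 : K^o) f2 d2 ->
  d1 = d2.
Proof.
move=> g_der g_x eq_f f1_der f2_der; apply: is_derive_unique f2_der.
apply: (@near_eq_is_derive K K^o K^o f1) f1_der.
exact: (filterS _ (is_derive_near_neq0 g_der g_x)).
Qed.

Section RationalMaps.
Variables (R : realType) (n : nat).
Local Notation C := (R[i]).
Implicit Types (Y : set 'rV[C]_n) (f F : mpoly n C) (p u v : 'rV[C]_n).

Lemma is_derive_dot N D u v : rdom D u ->
  is_derive (0 : C^o) (1 : C^o)
    (fun h : C => \sum_k (u + h *: v) ord0 k * reval N D (u + h *: v) ord0 k : C^o)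
    (\sum_k (u ord0 k * rdiff N D u v ord0 k + reval N D u ord0 k * v ord0 k)).
Proof.
move=> D_u.
have term k : is_derive (0 : C^o) (1 : C^o)
    (fun h : C => (u + h *: v) ord0 k * reval N D (u + h *: v) ord0 k : C^o)
    (u ord0 k * rdiff N D u v ord0 k + reval N D u ord0 k * v ord0 k).
  have line : is_derive (0 : C^o) (1 : C^o) (fun h : C => (u + h *: v) ord0 k : C^o) (v ord0 k).
    by apply: is_derive_ext (is_derive_line (u ord0 k) (v ord0 k) 0) => h; rewrite !mxE.
  apply: (is_derive_eq (is_deriveM line (is_derive_reval N v k D_u))).
  by rewrite scale0r addr0.
apply: is_derive_ext (is_derive_sum term) => h.
by rewrite fct_sumE.
Qed.

Lemma rdiff_tangent N D Y u v : rational_map_to N D Y -> rdom D u ->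
  tangent_space Y (reval N D u) (rdiff N D u v).
Proof.
move=> [_ Psi_Y] D_u; apply/tangent_space_pdiff => f f_Y.
have D_der := is_derive_peval D u v.
apply: (is_derive_unique_off_zeros D_der _ _ (is_derive_comp_reval f N v D_u)
  (is_derive_cst (0 : C^o) (0 : C^o) (1 : C^o))).
  by rewrite scale0r addr0.
by move=> h D_h; rewrite f_Y //; apply: Psi_Y.
Qed.

Lemma dot_const_diff N D (E : mpoly n C) e u v :
    (forall w, rdom E w -> rdom D w /\ \sum_k w ord0 k * reval N D w ord0 k = e) ->
    rdom E u ->
  \sum_k u ord0 k * rdiff N D u v ord0 k = - \sum_k reval N D u ord0 k * v ord0 k.
Proof.
move=> dotE E_u; have [D_u _] := dotE u E_u.
apply/eqP; rewrite -addr_eq0 -big_split /=; apply/eqP.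
apply: (is_derive_unique_off_zeros (is_derive_peval E u v) _ _ (is_derive_dot N v D_u)
  (is_derive_cst (e : C^o) (0 : C^o) (1 : C^o))).
  by rewrite scale0r addr0.
by move=> h E_h; have [_ ->] := dotE _ E_h.
Qed.

Lemma sum_delta (a : 'I_n -> C) i : \sum_k a k * (delta_mx ord0 i : 'rV[C]_n) ord0 k = a i.
Proof.
rewrite (bigD1 i) //= mxE !eqxx mulr1 big1 ?addr0 // => k /negbTE neq_ik.
by rewrite mxE neq_ik andbF mulr0.
Qed.

Lemma MLD1_MLE_like Y F : affine_cone_of_proj_variety Y -> homogeneous F ->
  MLD_eq F Y 1 -> exists N D, MLE_like F Y N D.
Proof.
move=> Y_cone F_hom mld; have Y_irr := cone_irreducible Y_cone.
have [K [iota [x xP]]] := generic_point Y_irr.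
have [r [fs [mu [fs_Y mu_x fs_span mu_smooth]]]] := generic_smooth Y_irr xP.
have smooth p : Y p -> peval mu p != 0 -> smooth_point Y p.
  by move=> Yp mu_p; have [] := mu_smooth p Yp mu_p.
have [|N [D [D_neq0 critE Psi_dom]]] := crit_point_rational Y_irr
  (generic_fractionP xP r) fs_Y smooth _ mld
  (fun h => generic_covector_free xP fs_span mld).
  by rewrite generic_fraction_eval fmorph_eq0.
have crit u : rdom D u -> crit_points F Y u (reval N D u).
  by move=> D_u; apply/(critE u D_u).
have Psi_Y u : rdom D u -> Y (reval N D u).
  by move=> /crit[[]].
have Psi_map : rational_map_to N D Y by [].
exists N, D; split=> //.
  move=> t u t_neq0 D_u D_tu; apply/esym/(critE (t *: u) D_tu).
  by apply: crit_points_scale => //; apply: crit.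
have [e F_e] := F_hom.
exists D; split=> // u D_u; have [_ F_u crit_u] := crit u D_u; split=> // i.
rewrite partial_comp_reval //.
have := crit_u _ (rdiff_tangent (delta_mx ord0 i) Psi_map D_u).
rewrite log_gradientE => /eqP; rewrite subr_eq0 => /eqP ->.
rewrite (@dot_const_diff N D D e%:R) // ?sum_delta // => w D_w; split=> //.
exact: crit_points_degree F_e (crit w D_w).
Qed.

End RationalMaps.

(** * Rational function fields and their derivations *)

Section FractionDerivation.
Variables (A : comNzRingType) (M : fieldType) (tof : {rmorphism A -> M}).
Hypothesis tof_inj : injective tof.
Hypothesis tof_frac : forall m, exists a b, tof b != 0 /\ m = tof a / tof b.

Lemma fraction_derivation (D : A -> M) : derivation_over tof D ->
  exists D' : M -> M, derivation_over idfun D' /\ forall a, D' (tof a) = D a.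
Proof.
move=> D_der.
have /choice[num] := tof_frac => /choice[den nd].
have den0 m : tof (den m) != 0 := (nd m).1.
have numE m : m = tof (num m) / tof (den m) := (nd m).2.
pose D' m := (D (num m) * tof (den m) - tof (num m) * D (den m)) / tof (den m) ^+ 2.
(* The value defined by the chosen numerator and denominator obeys the quotient rule for every other
   fraction too, by differentiating [a b' = a' b]. Sums and products can then be computed with
   convenient representatives. *)
have D'E a b : tof b != 0 -> D' (tof a / tof b) * tof b ^+ 2 = D a * tof b - tof a * D b.
  move=> b0; set m := tof a / tof b; rewrite /D'.
  have := numE m; move: (num m) (den m) (den0 m) => a' b' b'0 eq_m.
  have eq_ab : tof a * tof b' = tof a' * tof b.
    by apply/eqP; rewrite -eqr_div //; apply/eqP.
  have := congr1 D (tof_inj (etrans (rmorphM tof a b') (etrans eq_ab (esym (rmorphM tof a' b))))).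
  rewrite !D_der.2 => eq_D.
  have Da : D a * tof b' = D a' * tof b + tof a' * D b - tof a * D b' by rewrite -eq_D addrK.
  apply: (mulIf (expf_neq0 2 b'0)); rewrite mulrAC divfK ?expf_neq0 //.
  have -> : (D a * tof b - tof a * D b) * tof b' ^+ 2 =
      (D a * tof b') * tof b * tof b' - (tof a * tof b') * D b * tof b' by ring.
  rewrite Da eq_ab.
  have -> : (D a' * tof b + tof a' * D b - tof a * D b') * tof b * tof b' =
     (D a' * tof b + tof a' * D b) * tof b * tof b' - (tof a * tof b') * D b' * tof b by ring.
  by rewrite eq_ab; ring.
exists D'; split; last first.
  move=> a; have := D'E a 1; rewrite !rmorph1 divr1 expr1n !mulr1 => -> //; last exact: oner_neq0.
  by rewrite (derivation1 D_der) mulr0 subr0.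
have D'_frac a b : tof b != 0 ->
    D' (tof a / tof b) = (D a * tof b - tof a * D b) / tof b ^+ 2.
  by move=> b0; rewrite -D'E // mulfK // expf_neq0.
split=> m1 m2.
  rewrite (numE m1) (numE m2); move: (num m1) (den m1) (den0 m1) (num m2) (den m2) (den0 m2).
  move=> a b b0 c d d0.
  have -> : tof a / tof b + tof c / tof d = tof (a * d + c * b) / tof (b * d).
    by rewrite rmorphD !rmorphM /=; field; rewrite b0 d0.
  have bd0 : tof (b * d) != 0 by rewrite rmorphM mulf_neq0.
  rewrite !D'_frac // D_der.1 !D_der.2 rmorphD !rmorphM /=.
  by field; rewrite b0 d0.
rewrite /=  (numE m1) (numE m2); move: (num m1) (den m1) (den0 m1) (num m2) (den m2) (den0 m2).
move=> a b b0 c d d0.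
have -> : tof a / tof b * (tof c / tof d) = tof (a * c) / tof (b * d).
  by rewrite !rmorphM /=; field; rewrite b0 d0.
have bd0 : tof (b * d) != 0 by rewrite rmorphM mulf_neq0.
rewrite !D'_frac // !D_der.2 !rmorphM /=.
by field; rewrite b0 d0.
Qed.

Lemma derivation_eq_fractions (D D' : M -> M) : derivation_over idfun D ->
  derivation_over idfun D' -> (forall a, D (tof a) = D' (tof a)) -> D =1 D'.
Proof.
move=> D_der D'_der eq_D m; have [a [b [b0 ->]]] := tof_frac m.
have frac (E : M -> M) : derivation_over idfun E ->
    E (tof a / tof b) * tof b = E (tof a) - tof a / tof b * E (tof b).
  move=> E_der; apply/eqP; rewrite eq_sym subr_eq; apply/eqP.
  by rewrite -(E_der.2 (tof a / tof b)) divfK.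
by apply: (mulIf b0); rewrite !frac // !eq_D.
Qed.

End FractionDerivation.

Section FunctionField.
Variables (C M : fieldType) (n : nat) (tof : {rmorphism mpoly n C -> M}).
Hypothesis tof_inj : injective tof.
Hypothesis tof_frac : forall m, exists a b, tof b != 0 /\ m = tof a / tof b.
Let iota : {rmorphism C -> M} := tof \o @mpolyC n C.
Let U i := tof (mpolyX C (mnm1 i)).

Lemma mmap_coordinates h : mmap iota U h = tof h.
Proof.
apply: (mpoly_rmorphism_eq (f := mmap iota U) (g := tof)) => [c|i] /=.
  by rewrite mmapC.
by rewrite mmapXU.
Qed.

(** The commutator of two derivations is a derivation; it vanishes on polynomials, which determine
    it on fractions. *)
Lemma partial_derivations : exists d : 'I_n -> M -> M,
  [/\ forall k, derivation_over idfun (d k),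
      forall k a, d k (tof a) = tof (mderiv k a) &
      forall k l m, d k (d l m) = d l (d k m)].
Proof.
have /choice[d dP] : forall k : 'I_n, exists D : M -> M,
    derivation_over idfun D /\ forall a, D (tof a) = tof (mderiv k a).
  move=> k; apply: (fraction_derivation tof_inj tof_frac).
  split=> a b; first by rewrite mderivD rmorphD.
  by rewrite mderivM rmorphD !rmorphM.
exists d; split=> [k|k a|k l m]; [exact: (dP k).1|exact: (dP k).2|].
have [dD dM] := (dP k).1; have [eD eM] := (dP l).1.
pose E y := d k (d l y) - d l (d k y).
have E_der : derivation_over idfun E.
  split=> a b; first by rewrite /E eD dD dD eD; ring.
  by rewrite /E eM dM dD eD !dM !eM /=; ring.
have zero_der : derivation_over idfun (fun _ : M => 0 : M).
  by split=> a b; rewrite ?addr0 // mul0r mulr0 addr0.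
apply/eqP; rewrite -subr_eq0; apply/eqP.
apply: (derivation_eq_fractions tof_frac E_der zero_der) => a.
by rewrite /E (dP l).2 (dP k).2 (dP k).2 (dP l).2 mderiv_comm subrr.
Qed.

Variable d : 'I_n -> M -> M.
Hypothesis d_der : forall k, derivation_over idfun (d k).
Hypothesis d_tof : forall k a, d k (tof a) = tof (mderiv k a).
Hypothesis char0 : [pchar M] =i pred0.

Variables (N : 'I_n -> mpoly n C) (D : mpoly n C).
Hypothesis D_neq0 : tof D != 0.
Variable Psi : 'I_n -> M.
Hypothesis Psi_eq : forall j, tof D * Psi j = tof (N j).

Lemma derivation_chain_rule (e : M -> M) f : derivation_over idfun e ->
    (forall c, e (iota c) = 0) -> forall y : 'I_n -> M,
  e (mmap iota y f) = \sum_i mmap iota y (mderiv i f) * e (y i).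
Proof.
move=> [eD eM] e_const y.
have der : derivation_over (mmap iota y) (e \o mmap iota y).
  by split=> p q /=; rewrite ?rmorphD ?eD // rmorphM eM.
have /= -> := derivation_mpolyE der; first by apply: eq_bigr => i _; rewrite mmapXU.
by move=> c; rewrite mmapC e_const.
Qed.

Lemma d_const k c : d k (iota c) = 0.
Proof. by rewrite /iota /= d_tof mderivC raddf0. Qed.

Lemma d_Psi k j : tof D * d k (Psi j) = tof (mderiv k (N j)) - tof (mderiv k D) * Psi j.
Proof.
have := congr1 (d k) (Psi_eq j); rewrite (d_der k).2 /= !d_tof => eq_d.
by rewrite -eq_d addrC addKr.
Qed.

Lemma tangent_image v : tangent_at iota Psi v ->
  exists w : 'I_n -> M, forall j, v j = \sum_k w k * d k (Psi j).
Proof.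
move=> v_tan.
pose phi : {rmorphism mpoly n C -> M} := mmap iota Psi.
pose D0 f := \sum_i mmap iota Psi (mderiv i f) * v i.
have D0_der : derivation_over phi D0 by exact: mderiv_derivation.
have [E [E_der E_const E_ker]] := extend_derivation U char0 D0_der v_tan.
exists (fun k => E (mpolyX _ (mnm1 k))) => j.
have v_j : E (mpolyC n (mpolyX C (mnm1 j))) = v j.
  by rewrite E_const; exact: (sum_mderivXU phi).
pose c : {rmorphism C -> mpoly n C} := @mpolyC n C.
have phi_c a : phi (c a) = iota a by rewrite /phi /= mmapC.
have Ec a : E (mpolyC n (c a)) = 0.
  by rewrite E_const /D0 big1 // => i _; rewrite mderivC raddf0 mul0r.
have E_lift h := lift_coef_derivation h phi_c E_der Ec.
have lift_U h : mmap phi U (lift_coef c h) = tof h.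
  by rewrite (mmap_lift_coef U h phi_c) mmap_coordinates.
move: (lift_coef c) lift_U E_lift => lc lift_U E_lift.
(* This polynomial says [D(U) Psi_j = N_j(U)], with [Psi_j] represented by a constant of the
   coefficient ring, on which [E] takes the value [v j]. As [E] kills the relation, the chain rule
   expresses [v j] by the values of [E] on the variables. *)
pose rel := lc D * mpolyC n (mpolyX C (mnm1 j)) - lc (N j).
have rel0 : mmap phi U rel = 0.
  rewrite /rel (rmorphB (mmap phi U)) (rmorphM (mmap phi U)) /= !lift_U mmapC /= mmapXU.
  by rewrite Psi_eq subrr.
have : E (lc D * mpolyC n (mpolyX C (mnm1 j))) = E (lc (N j)).
  rewrite -[X in E X](subrK (lc (N j))) E_der.1 -/rel E_ker ?add0r //.
rewrite E_der.2 lift_U v_j mmapC /= mmapXU !E_lift => eq_E.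
apply: (mulfI D_neq0); rewrite mulr_sumr.
have -> : tof D * v j = \sum_k mmap iota U (mderiv k (N j)) * E (mpolyX _ (mnm1 k)) -
    (\sum_k mmap iota U (mderiv k D) * E (mpolyX _ (mnm1 k))) * Psi j.
  by rewrite -eq_E addrC addKr.
rewrite mulr_suml -sumrB; apply: eq_bigr => k _.
by rewrite !mmap_coordinates mulrCA d_Psi; ring.
Qed.

(* Along the direction [q = grad f (Psi)] the map [Psi] is constant. With
   [delta = sum_i q_i d_i], which kills [Psi], the polynomial
   [D (U + t q) Psi_j - N_j (U + t q)] in [t] is killed by [delta - d/dt] and
   vanishes at [t = 0]. *)
Lemma constant_along_conormal f : (forall k l, d k (Psi l) = d l (Psi k)) ->
    mmap iota Psi f = 0 ->
  let q i := mmap iota Psi (mderiv i f) in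
  forall j, mmap iota (fun i => U i + q i) D * Psi j = mmap iota (fun i => U i + q i) (N j).
Proof.
move=> d_sym f_Psi q j.
pose delta m := \sum_i q i * d i m.
have delta_der : derivation_over idfun delta.
  split=> a b; rewrite /delta.
    by rewrite -big_split; apply: eq_bigr => i _ /=; rewrite (d_der i).1 mulrDr.
  rewrite mulr_suml mulr_sumr -big_split; apply: eq_bigr => i _ /=.
  by rewrite (d_der i).2 /=; ring.
have delta_const a : delta (iota a) = 0.
  by rewrite /delta big1 // => i _; rewrite d_const mulr0.
have delta_Psi k : delta (Psi k) = 0.
  (* By symmetry the derivative of [Psi k] along [q] is the [k]-th derivative of [f(Psi)], which is
     zero. *)
  have <- : d k (mmap iota Psi f) = 0.
    by rewrite f_Psi (derivation0 (d_der k)).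
  rewrite (derivation_chain_rule f (d_der k) (d_const k)).
  by apply: eq_bigr => i _; rewrite d_sym.
have delta_q i : delta (q i) = 0.
  rewrite (derivation_chain_rule _ delta_der delta_const) big1 // => l _.
  by rewrite delta_Psi mulr0.
have delta_U i : delta (U i) = q i.
  rewrite -[RHS](sum_mderivXU tof q i); apply: eq_bigr => k _.
  by rewrite d_tof mulrC.
pose E P := map_poly delta P - P^`().
have coefE P k : (E P)`_k = delta P`_k - P`_k.+1 *+ k.+1.
  by rewrite coefB coef_map_id0 ?(derivation0 delta_der) // coef_deriv.
clearbody E.
have E_D P Q : E (P + Q) = E P + E Q.
  by apply/polyP => k; rewrite coefD !coefE !coefD delta_der.1 mulrnDl; ring.
have E_C m : E m%:P = (delta m)%:P.
  apply/polyP => k; rewrite coefE !coefC /= mul0rn subr0.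
  by case: k => //=; rewrite (derivation0 delta_der).
have E_CM m P : E (m%:P * P) = E m%:P * P + m%:P * E P.
  apply/polyP => k; rewrite E_C coefD !coefCM !coefE !coefCM delta_der.2 /=.
  by rewrite mulrBr -mulrnAr; ring.
have E_X P : E (P * 'X) = E P * 'X - P.
  apply/polyP => k; rewrite coefB !coefMX !coefE !coefMX.
  case: k => [|k] /=; first by rewrite (derivation0 delta_der) mulr1n sub0r.
  by rewrite [_ *+ k.+2]mulrS; ring.
have E_M P Q : E (P * Q) = E P * Q + P * E Q.
  elim/poly_ind: P Q => [|P m IHP] Q.
    have E0 : E 0 = 0 by rewrite -[0]/(0%:P) E_C (derivation0 delta_der).
    by rewrite !mul0r E0 mul0r addr0.
  have -> : (P * 'X + m%:P) * Q = P * (Q * 'X) + m%:P * Q by ring.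
  rewrite !E_D IHP E_CM !E_X; ring.
pose W i : {poly M} := (U i)%:P + (q i)%:P * 'X.
pose io : {rmorphism C -> {poly M}} := polyC \o iota.
have E_W i : E (W i) = 0.
  rewrite /W E_D E_X !E_C delta_U delta_q polyC0 mul0r sub0r subrr //.
have E_H h : E (mmap io W h) = 0.
  elim/mpoly_ring_ind: h => [a|i|p1 p2 IH1 IH2|p1 p2 IH1 IH2].
  - by rewrite mmapC /= E_C delta_const.
  - by rewrite mmapXU E_W.
  - by rewrite rmorphD /= E_D IH1 IH2 addr0.
  by rewrite rmorphM /= E_M IH1 IH2 mul0r mulr0 addr0.
pose P := mmap io W D * (Psi j)%:P - mmap io W (N j).
have eval_H t h : (mmap io W h).[t] = mmap iota (fun i => U i + q i * t) h.
  have io_t a : horner_eval t (io a) = iota a by rewrite /horner_eval /= hornerC.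
  have eq_h : (mmap io W h).[t] = mmap iota (horner_eval t \o W) h.
    exact: (rmorph_mmap W h io_t).
  rewrite eq_h.
  have -> // : horner_eval t \o W = (fun i => U i + q i * t).
  apply: funext => i.
  by rewrite /= /horner_eval /W hornerD hornerM !hornerC hornerX.
have P0 : P = 0.
  have E_P : E P = 0.
    have E_N Q : E (- Q) = - E Q.
      by apply/eqP; rewrite -addr_eq0 -E_D addNr -[0]/(0%:P) E_C (derivation0 delta_der).
    by rewrite /P E_D E_N E_M !E_H E_C delta_Psi mul0r mulr0 addr0 subr0.
  (* From [E P = 0] the coefficients satisfy [(k+1) P_(k+1) = delta P_k], and [P_0 = 0] because
     [D Psi_j = N_j] at [U]. *)
  apply/polyP => k; rewrite coef0; elim: k => [|k IHk].
    rewrite -horner_coef0 /P hornerD hornerN hornerM hornerC !eval_H.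
    have -> : (fun i => U i + q i * 0) = U by apply: funext => i; rewrite mulr0 addr0.
    by rewrite !mmap_coordinates Psi_eq subrr.
  have := coefE P k; rewrite E_P coef0 IHk (derivation0 delta_der) sub0r => /esym/eqP.
  by rewrite oppr_eq0 -mulr_natr mulf_eq0 (pcharf0P _).1 // orbF => /eqP.
have := congr1 (fun Q => Q.[1]) P0.
rewrite /P hornerD hornerN hornerM hornerC !eval_H horner0.
have -> : (fun i => U i + q i * 1) = (fun i => U i + q i).
  by apply: funext => i; rewrite mulr1.
by move=> /eqP; rewrite subr_eq0 => /eqP.
Qed.

End FunctionField.

(** * Critical points from a rational map *)

Section RegularFunctions.
Variables (R : realType) (n : nat).
Local Notation C := (R[i]).
Local Notation pt := 'rV[C]_n.
Variables (M : fieldType) (tof : {rmorphism mpoly n C -> M}).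
Hypothesis tof_inj : injective tof.
Hypothesis tof_frac : forall m, exists a b, tof b != 0 /\ m = tof a / tof b.
Let iota : {rmorphism C -> M} := tof \o @mpolyC n C.
Implicit Types (B : set pt) (m : M) (f : pt -> C).

(** The dictionary between the field of rational functions and functions on points: [m] and [f] are
    given by one fraction whose denominator has no zero on [B]. Complex derivatives enter on the
    side of [f], derivations of the field on the side of [m]. *)
Definition regular_on B m f : Prop := exists a e : mpoly n C,
  [/\ tof e != 0, m = tof a / tof e &
      forall u, B u -> peval e u != 0 /\ f u = peval a u / peval e u].

Lemma regular_ratio B (a e : mpoly n C) : tof e != 0 ->
    (forall u, B u -> peval e u != 0) ->
  regular_on B (tof a / tof e) (fun u => peval a u / peval e u).
Proof. by move=> e0 eB; exists a, e; split=> // u Bu; split=> //; apply: eB. Qed.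

Lemma regular_tof B (a : mpoly n C) : regular_on B (tof a) (peval a).
Proof.
exists a, 1; split=> [||u _]; rewrite ?rmorph1 ?oner_neq0 ?divr1 //.
by rewrite peval1 oner_neq0 divr1.
Qed.

Lemma regular_const B c : regular_on B (iota c) (fun _ => c).
Proof.
have [a [e [e0 eq_m eB]]] := regular_tof B (mpolyC n c).
by exists a, e; split=> // u Bu; have [? <-] := eB u Bu; rewrite pevalC.
Qed.

Lemma regularD B m1 m2 f1 f2 : regular_on B m1 f1 -> regular_on B m2 f2 ->
  regular_on B (m1 + m2) (fun u => f1 u + f2 u).
Proof.
move=> [a [e [e0 -> eB]]] [b [d [d0 -> dB]]]; exists (a * d + b * e), (e * d); split.
- by rewrite rmorphM mulf_neq0.
- by rewrite rmorphD !rmorphM /= addf_div.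
move=> u Bu; have [e_u ->] := eB u Bu; have [d_u ->] := dB u Bu.
by rewrite pevalD !pevalM mulf_neq0 // addf_div.
Qed.

Lemma regularM B m1 m2 f1 f2 : regular_on B m1 f1 -> regular_on B m2 f2 ->
  regular_on B (m1 * m2) (fun u => f1 u * f2 u).
Proof.
move=> [a [e [e0 -> eB]]] [b [d [d0 -> dB]]]; exists (a * b), (e * d); split.
- by rewrite rmorphM mulf_neq0.
- by rewrite !rmorphM /= mulf_div.
move=> u Bu; have [e_u ->] := eB u Bu; have [d_u ->] := dB u Bu.
by rewrite !pevalM mulf_neq0 // mulf_div.
Qed.

Lemma regular_ext B m f1 f2 : (forall u, B u -> f1 u = f2 u) ->
  regular_on B m f1 -> regular_on B m f2.
Proof.
move=> eq_f [a [e [e0 eq_m eB]]]; exists a, e; split=> // u Bu.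
by rewrite -eq_f //; apply: eB.
Qed.

Lemma regularN B m f : regular_on B m f -> regular_on B (- m) (fun u => - f u).
Proof.
move=> m_f; have := regularM (regular_const B (-1)) m_f.
by rewrite rmorphN1 mulN1r; apply: regular_ext => u _; rewrite mulN1r.
Qed.

Lemma regular_sum B k (m : 'I_k -> M) (f : 'I_k -> pt -> C) :
  (forall i, regular_on B (m i) (f i)) ->
  regular_on B (\sum_i m i) (fun u => \sum_i f i u).
Proof.
elim: k m f => [|k IHk] m f m_f.
  rewrite big_ord0; have := regular_const B 0; rewrite raddf0.
  by apply: regular_ext => u _; rewrite big_ord0.
rewrite big_ord_recl; have := regularD (m_f ord0) (IHk _ _ (fun i => m_f (lift ord0 i))).
by apply: regular_ext => u _; rewrite big_ord_recl.
Qed.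

Lemma regular_mmap B k (m : 'I_k -> M) (f : 'I_k -> pt -> C) (h : mpoly k C) :
  (forall i, regular_on B (m i) (f i)) ->
  regular_on B (mmap iota m h) (fun u => mmap idfun (f^~ u) h).
Proof.
move=> m_f; elim/mpoly_ring_ind: h => [c|i|p q IHp IHq|p q IHp IHq].
- rewrite mmapC; have := regular_const B c; apply: regular_ext => u _.
  by rewrite mmapC.
- by rewrite mmapXU; apply: regular_ext (m_f i) => u _; rewrite mmapXU.
- rewrite rmorphD; apply: regular_ext (regularD IHp IHq) => u _.
  by rewrite [RHS]rmorphD.
rewrite rmorphM; apply: regular_ext (regularM IHp IHq) => u _.
by rewrite [RHS]rmorphM.
Qed.

Lemma regular_sub B B' m f : B' `<=` B -> regular_on B m f -> regular_on B' m f.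
Proof.
move=> sub [a [e [e0 eq_m eB]]]; exists a, e; split=> // u /sub; exact: eB.
Qed.

Lemma regular_eq0 B m f u : regular_on B m f -> m = 0 -> B u -> f u = 0.
Proof.
move=> [a [e [e0 -> eB]]] /eqP; rewrite mulf_eq0 invr_eq0 (negbTE e0) orbF => /eqP a0 Bu.
have [_ ->] := eB u Bu; have -> : a = 0 by apply: tof_inj; rewrite a0 raddf0.
by rewrite peval0 mul0r.
Qed.

Lemma regular_general0 B m f (g : mpoly n C) : regular_on B m f -> g != 0 ->
  (forall u, peval g u != 0 -> B u /\ f u = 0) -> m = 0.
Proof.
move=> [a [e [e0 -> eB]]] g_neq0 f0; suff -> : a = 0 by rewrite raddf0 mul0r.
have /eqP : g * a = 0.
  apply: peval_eq0 => u; rewrite pevalM; have [->|g_u] := eqVneq (peval g u) 0.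
    by rewrite mul0r.
  have [Bu f_u] := f0 u g_u; have [e_u eq_f] := eB u Bu.
  move/eqP: eq_f; rewrite f_u eq_sym mulf_eq0 invr_eq0 (negbTE e_u) orbF.
  by move=> /eqP ->; rewrite mulr0.
by rewrite mulf_eq0 (negbTE g_neq0) => /eqP.
Qed.

Lemma regular_exists m : exists (b : mpoly n C) f, b != 0 /\ regular_on (rdom b) m f.
Proof.
have [a [b [b0 ->]]] := tof_frac m.
exists b, (fun u => peval a u / peval b u); split; last exact: regular_ratio.
by apply: contraNneq b0 => ->; rewrite raddf0.
Qed.

Lemma regular_family k (m : 'I_k -> M) : exists (b : mpoly n C) (f : 'I_k -> pt -> C),
  b != 0 /\ forall i, regular_on (rdom b) (m i) (f i).
Proof.
have /choice[b /choice[f bf]] : forall i, exists (b : mpoly n C) f,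
    b != 0 /\ regular_on (rdom b) (m i) f by move=> i; exact: regular_exists.
exists (\prod_i b i), f; split; first by apply/prodf_neq0 => i _; exact: (bf i).1.
move=> i; apply: regular_sub (bf i).2 => u.
by rewrite /rdom (bigD1 i) //= pevalM mulf_eq0 negb_or => /andP[].
Qed.

End RegularFunctions.

(** * Critical points of a rational map with properties (a) and (b) *)

Section Backward.
Variables (R : realType) (n : nat).
Local Notation C := (R[i]).
Local Notation pt := 'rV[C]_n.
Variables (M : fieldType) (tof : {rmorphism mpoly n C -> M}).
Hypothesis tof_inj : injective tof.
Hypothesis tof_frac : forall m, exists a b, tof b != 0 /\ m = tof a / tof b.
Let iota : {rmorphism C -> M} := tof \o @mpolyC n C.
Let U i := tof (mpolyX C (mnm1 i)).
Variables (Y : set pt) (F : mpoly n C) (N : 'I_n -> mpoly n C) (D : mpoly n C).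
Hypothesis Y_cone : affine_cone_of_proj_variety Y.
Hypothesis Psi_map : rational_map_to N D Y.
Hypothesis Psi_dom : dominant N D Y.
Variable d : 'I_n -> M -> M.
Hypothesis d_der : forall k, derivation_over idfun (d k).
Hypothesis d_tof : forall k a, d k (tof a) = tof (mderiv k a).
Hypothesis d_comm : forall k l m, d k (d l m) = d l (d k m).
Variable Psi : 'I_n -> M.
Hypothesis Psi_eq : forall j, tof D * Psi j = tof (N j).

Let D_neq0 : tof D != 0.
Proof. by have [D0 _] := Psi_map; rewrite -(rmorph0 tof) (inj_eq tof_inj). Qed.

Lemma regular_Psi j : regular_on tof (rdom D) (Psi j) (fun u => reval N D u ord0 j).
Proof.
have -> : Psi j = tof (N j) / tof D by rewrite -Psi_eq mulrC mulKf.
by apply: regular_ext (regular_ratio _ D_neq0 _) => // u _; rewrite mxE.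
Qed.

Lemma regular_U B i : regular_on tof B (U i) (fun u => u ord0 i).
Proof. by apply: regular_ext (regular_tof _ _ _) => u _; rewrite pevalX. Qed.

Lemma regular_comp_Psi f :
  regular_on tof (rdom D) (mmap iota Psi f) (fun u => peval f (reval N D u)).
Proof. exact: (regular_mmap f regular_Psi). Qed.

Lemma regular_dPsi k j :
  regular_on tof (rdom D) (d k (Psi j)) (fun u => rdiff N D u (delta_mx ord0 k) ord0 j).
Proof.
pose a := mderiv k (N j) * D - N j * mderiv k D.
have -> : d k (Psi j) = tof a / tof (D * D).
  have := d_Psi d_der d_tof Psi_eq k j => eq_d.
  apply: (mulfI D_neq0); rewrite eq_d rmorphB !rmorphM /= -Psi_eq.
  by field; exact: D_neq0.
apply: regular_ext (regular_ratio _ _ _).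
- by move=> u D_u; rewrite mxE /pdiff !sum_delta /a pevalB !pevalM expr2.
- by rewrite rmorphM mulf_neq0.
by move=> u D_u; rewrite pevalM mulf_neq0.
Qed.

(** Values in [Y] give one direction and dominance the other: [Psi] is a generic point of [Y] in
    [C(u)], so the results on smoothness and tangent vectors apply to it. *)
Lemma PsiP f : mmap iota Psi f = 0 <-> vanishing Y f.
Proof.
have [D0 Psi_Y] := Psi_map; split=> [f_Psi|f_Y]; last first.
  apply: (regular_general0 (regular_comp_Psi f) D0) => u D_u; split=> //.
  by apply: f_Y; apply: Psi_Y.
apply: Psi_dom => u D_u.
exact: (regular_eq0 tof_inj (regular_comp_Psi f) f_Psi D_u).
Qed.

Lemma general_vanishing f (g : mpoly n C) : g != 0 ->
    (forall u, peval g u != 0 -> rdom D u /\ peval f (reval N D u) = 0) ->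
  vanishing Y f.
Proof.
move=> g0 f0; apply/PsiP.
exact: (regular_general0 (regular_comp_Psi f) g0 f0).
Qed.

Lemma general_nonvanishing f : ~ vanishing Y f ->
  exists2 g : mpoly n C, g != 0 &
    forall u, peval g u != 0 -> rdom D u /\ peval f (reval N D u) != 0.
Proof.
move=> f_Y; have [a [e [e0 eq_f eB]]] := regular_comp_Psi f.
have a0 : a != 0.
  apply/eqP => a0; apply: f_Y; apply/PsiP; rewrite eq_f a0 raddf0 mul0r //.
exists (a * D); first by rewrite mulf_neq0 //; have [] := Psi_map.
move=> u; rewrite pevalM mulf_eq0 negb_or => /andP[a_u D_u]; split=> //.
by have [e_u ->] := eB u D_u; rewrite mulf_neq0 ?invr_eq0.
Qed.

Hypothesis Psi_hom : forall (t : C) u, t != 0 -> rdom D u -> rdom D (t *: u) ->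
  reval N D (t *: u) = t^-1 *: reval N D u.
Hypothesis Psi_grad : general (fun u => [/\ rdom D u, peval F (reval N D u) != 0 &
  forall i, partial (fun w => peval F (reval N D w)) u i / peval F (reval N D u) =
    - reval N D u ord0 i]).
Let char0 : [pchar M] =i pred0 := rmorph_pchar0 iota (@complex_pchar0 R).

(** By (a) the function [(1 + h) Psi ((1 + h) u)] is constant where it is defined and [1 + h] is
    nonzero; its derivative at [0] is therefore zero. *)
Lemma rdiff_radial u j : rdom D u -> rdiff N D u u ord0 j = - reval N D u ord0 j.
Proof.
move=> D_u; apply/eqP; rewrite -addr_eq0; apply/eqP.
have line := is_derive_line 1 1 (0 : C).
have g_der := is_deriveM line (is_derive_peval D u u).
have f_der := is_deriveM line (is_derive_reval N u j D_u).
have <- : (1 + 0 * 1 : C) *: (rdiff N D u u ord0 j : C^o) +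
    reval N D (u + 0 *: u) ord0 j *: (1 : C^o) = rdiff N D u u ord0 j + reval N D u ord0 j.
  by rewrite scale0r addr0 /GRing.scale /= mul0r addr0 mul1r mulr1.
apply: (is_derive_unique_off_zeros g_der _ _ f_der
  (is_derive_cst (reval N D u ord0 j : C^o) (0 : C^o) (1 : C^o))).
  by rewrite mulrfctE mul0r addr0 mul1r scale0r addr0.
move=> h; rewrite !mulrfctE mulr1 -[X in X + h *: _](scale1r u) -scalerDl.
rewrite mulf_eq0 negb_or => /andP[h1 D_h].
by rewrite (Psi_hom h1 D_u D_h) mxE mulVKf.
Qed.

Lemma rdiff_sum u v j : rdom D u ->
  rdiff N D u v ord0 j = \sum_k v ord0 k * rdiff N D u (delta_mx ord0 k) ord0 j.
Proof.
have pdiff_sum f : pdiff f u v = \sum_k v ord0 k * pdiff f u (delta_mx ord0 k).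
  by apply: eq_bigr => k _; rewrite /pdiff sum_delta mulrC.
move=> D_u; rewrite mxE !pdiff_sum mulr_suml mulr_sumr -sumrB mulr_suml.
by apply: eq_bigr => k _; rewrite mxE; field.
Qed.

Lemma euler_Psi j : \sum_k U k * d k (Psi j) = - Psi j.
Proof.
apply/eqP; rewrite -addr_eq0; apply/eqP; have [D0 _] := Psi_map.
apply: (regular_general0 (regularD (regular_sum (fun k =>
  regularM (regular_U (rdom D) k) (regular_dPsi k j))) (regular_Psi j)) D0) => u D_u.
by split=> //; rewrite -rdiff_sum // rdiff_radial // addNr.
Qed.

Let G := mmap iota Psi F.

Lemma F_not_vanishing : ~ vanishing Y F.
Proof.
have [g [g0 g_grad]] := Psi_grad; have [u /g_grad[D_u F_u _]] := peval_nonroot g0.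
by move=> F_Y; case/eqP: F_u; apply: F_Y; have [_] := Psi_map; apply.
Qed.

Lemma gradient_Psi k : \sum_i mmap iota Psi (mderiv i F) * d k (Psi i) = - (Psi k * G).
Proof.
apply/eqP; rewrite -addr_eq0; apply/eqP; have [g [g0 g_grad]] := Psi_grad.
apply: (regular_general0 (regularD (regular_sum (fun i =>
  regularM (regular_comp_Psi (mderiv i F)) (regular_dPsi k i)))
  (regularM (regular_Psi k) (regular_comp_Psi F))) g0) => u /g_grad[D_u F_u grad_u].
split=> //; rewrite -/(pdiff F _ _) -partial_comp_reval //.
have := congr1 (fun y => y * peval F (reval N D u)) (grad_u k).
by rewrite divfK // mulNr => ->; rewrite addNr.
Qed.

(** By (b) the derivatives of [G = F(Psi)] are [- Psi_k G]; the two mixed second derivatives differ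
    only in the terms [(d_k Psi_l) G], and [G] is nonzero. *)
Lemma dPsi_symmetric k l : d k (Psi l) = d l (Psi k).
Proof.
have G0 : G != 0 by apply/eqP => /PsiP; exact: F_not_vanishing.
have dG i : d i G = - (Psi i * G).
  by rewrite /G (derivation_chain_rule F (d_der i) (d_const d_tof i)) gradient_Psi.
have dN i m : d i (- m) = - d i m.
  by apply/eqP; rewrite -addr_eq0 -(d_der i).1 addNr (derivation0 (d_der i)).
have := d_comm k l G; rewrite !dG !dN !(d_der _).2 /= !dG.
move=> /oppr_inj; rewrite !mulrN [Psi l * (_ * _)]mulrCA => /addIr.
exact: mulIf.
Qed.

Lemma Psi_constant u f j : rdom D u -> vanishing Y f ->
  peval D (u + pgrad f (reval N D u)) * reval N D u ord0 j =
  peval (N j) (u + pgrad f (reval N D u)).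
Proof.
move=> D_u /PsiP f_Psi.
have const := constant_along_conormal d_der d_tof char0 Psi_eq dPsi_symmetric f_Psi j.
have reg_U i : regular_on tof (rdom D) (U i + mmap iota Psi (mderiv i f))
    (fun u => (u + pgrad f (reval N D u)) ord0 i).
  apply: regular_ext (regularD (regular_U _ i) (regular_comp_Psi (mderiv i f))) => w _.
  by rewrite !mxE.
have reg := regularD (regularM (regular_mmap D reg_U) (regular_Psi j))
  (regularN (regular_mmap (N j) reg_U)).
apply/eqP; rewrite -subr_eq0; apply/eqP.
by apply: (regular_eq0 tof_inj reg _ D_u); rewrite const subrr.
Qed.

Lemma Psi_critical : general (fun u => crit_points F Y u (reval N D u)).
Proof.
have Y_irr := cone_irreducible Y_cone; have [_ Psi_Y] := Psi_map.
have [r [fs [mu [fs_Y mu_Psi fs_span mu_smooth]]]] := generic_smooth Y_irr PsiP.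
pose J : 'M[M]_(r, n) := \matrix_(k, i) mmap iota Psi (mderiv i (fs k)).
(* [w] is [F(Psi)] times the gradient of the log-likelihood, to be shown conormal. *)
pose w : 'rV[M]_n := \row_i (mmap iota Psi (mderiv i F) - U i * G).
have /submxP[c eq_w] : (w <= J)%MS.
  rewrite submxE; apply/eqP/rowP => l; rewrite mxE [RHS]mxE.
  pose v i := cokermx J i l.
  have v_tan : tangent_at iota Psi v.
    move=> f /PsiP/fs_span[a f_a].
    have -> : \sum_i mmap iota Psi (mderiv i f) * v i =
        \sum_k a k * (J *m cokermx J) k l.
      under eq_bigr => i _ do rewrite f_a mulr_suml.
      rewrite exchange_big; apply: eq_bigr => k _; rewrite mxE mulr_sumr.
      by apply: eq_bigr => i _; rewrite mxE mulrA.
    by rewrite mulmx_coker big1 // => k _; rewrite mxE mulr0.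
  have [y v_y] := tangent_image d_der d_tof char0 D_neq0 Psi_eq v_tan.
  have -> : \sum_i w 0 i * cokermx J i l = \sum_k y k * \sum_i w 0 i * d k (Psi i).
    under [RHS]eq_bigr => k _ do rewrite mulr_sumr.
    rewrite exchange_big; apply: eq_bigr => i _; rewrite -/(v i) v_y mulr_sumr.
    by apply: eq_bigr => k _; rewrite mulrCA.
  (* Symmetry turns [u . d_k Psi] into the radial derivative of [Psi k], which is [- Psi k] by (a);
     the gradient of [F] contributes [- Psi k G] by (b), and the two terms cancel. *)
  rewrite big1 // => k _; suff -> : \sum_i w 0 i * d k (Psi i) = 0 by rewrite mulr0.
  have -> : \sum_i w 0 i * d k (Psi i) =
      \sum_i mmap iota Psi (mderiv i F) * d k (Psi i) - G * \sum_i U i * d i (Psi k).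
    rewrite mulr_sumr -sumrB; apply: eq_bigr => i _.
    by rewrite mxE dPsi_symmetric mulrBl; congr (_ - _); rewrite mulrAC mulrC.
  by rewrite gradient_Psi euler_Psi mulrN mulrC opprK addNr.
(* The coefficients [c] are rational functions; off the zeros of a common denominator they become
   numbers [phi k u], and the identity can be read at points. *)
have [b [phi [b0 b_phi]]] := regular_family tof_frac (fun k => c 0 k).
have [|g1 g1_neq0 g1_mu] := general_nonvanishing (f := mu).
  by move=> /PsiP mu0; rewrite mu0 eqxx in mu_Psi.
have [g2 g2_neq0 g2_F] := general_nonvanishing F_not_vanishing.
exists (b * g1 * g2); split=> [|u]; first by rewrite !mulf_neq0.
rewrite !pevalM !mulf_eq0 !negb_or => /andP[/andP[b_u /g1_mu[D_u mu_u]] /g2_F[_ F_u]].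
pose B := rdom D `&` rdom b.
have Bu : B u by [].
have eq_i i : peval (mderiv i F) (reval N D u) - u ord0 i * peval F (reval N D u) =
    \sum_k phi k u * peval (mderiv i (fs k)) (reval N D u).
  have sub_D := regular_sub (B' := B) (@subIsetl _ (rdom D) (rdom b)).
  have sub_b := regular_sub (B' := B) (@subIsetr _ (rdom D) (rdom b)).
  have reg := regularD (regularD (sub_D _ _ _ _ (regular_comp_Psi (mderiv i F)))
    (regularN (regularM (regular_U B i) (sub_D _ _ _ _ (regular_comp_Psi F)))))
    (regularN (regular_sum (fun k => regularM (sub_b _ _ _ _ (b_phi k))
      (sub_D _ _ _ _ (regular_comp_Psi (mderiv i (fs k))))))).
  apply/eqP; rewrite -subr_eq0; apply/eqP; apply: (regular_eq0 tof_inj reg _ Bu).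
  have := congr1 (fun z : 'rV_n => z 0 i) eq_w; rewrite mxE => ->.
  apply/eqP; rewrite subr_eq0 mxE; apply/eqP; apply: eq_bigr => k _.
  by rewrite [J _ _]mxE.
have Yp := Psi_Y u D_u; have [p_smooth _] := mu_smooth _ Yp mu_u.
pose f := \sum_k mpolyC n (- (phi k u / peval F (reval N D u))) * fs k.
have f_Y : vanishing Y f.
  have [VY0 VYD VYM] := vanishing_ideal Y.
  by rewrite /f; elim/big_ind: _ => // k _; apply: VYM.
suff {1}-> : u = (peval F (reval N D u))^-1 *: pgrad F (reval N D u) + pgrad f (reval N D u).
  exact: conormal_crit_points.
apply/rowP => i; rewrite pgrad_lin !mxE summxE; apply: (mulfI F_u).
rewrite mulrDr mulVKf // mulr_sumr.
have -> : peval (mderiv i F) (reval N D u) =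
    u ord0 i * peval F (reval N D u) + \sum_k phi k u * peval (mderiv i (fs k)) (reval N D u).
  by rewrite -eq_i; ring.
rewrite -addrA -big_split big1 /= ?addr0 1?mulrC // => k _.
by rewrite !mxE; field.
Qed.

(** The equation [f] of a critical point [p] is kept fixed while a point [q] moves over [Y]:
    [D(w) q_j = N_j(w)] with [w = grad F / F (q) + grad f (q)] becomes, after clearing denominators,
    a polynomial condition [T] on [q]. It holds at general values of [Psi], hence on [Y], and at
    [q = p] the covector [w] is [u]. *)
Lemma critical_Psi : general (fun u => forall p, crit_points F Y u p -> p = reval N D u).
Proof.
have [D0 Psi_Y] := Psi_map; have [g [g0 g_crit]] := Psi_critical.
exists D; split=> // u D_u p /crit_points_conormal[Yp F_p [f f_Y eq_u]].
pose a i : mpoly n C := mderiv i F + F * mderiv i f.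
have aE q : peval F q != 0 -> forall h,
    mmap idfun (fun i => mmap idfun (q ord0) (a i) / mmap idfun (q ord0) F) h =
    peval h ((peval F q)^-1 *: pgrad F q + pgrad f q).
  move=> F_q h; rewrite [RHS]peval_mmap; congr (mmap _ _ h); apply: funext => i.
  by rewrite !mxE -!peval_mmap /a pevalD pevalM mulrDl mulrAC divff // mul1r mulrC.
have [eD [kD eDP]] := clear_denominators D a F.
suff eq_j j : peval D u * p ord0 j = peval (N j) u.
  by apply/rowP => j; rewrite mxE -eq_j mulrAC divff // mul1r.
have [eN [kN eNP]] := clear_denominators (N j) a F.
pose T := eD * mpolyX C (mnm1 j) * F ^+ kN - eN * F ^+ kD.
have pevalX' (h : mpoly n C) k q : peval (h ^+ k) q = peval h q ^+ k.
  exact: (rmorphXn (meval (q ord0))).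
have TE q : peval F q != 0 -> let w := (peval F q)^-1 *: pgrad F q + pgrad f q in
    peval T q = peval F q ^+ kD * peval F q ^+ kN * (peval D w * q ord0 j - peval (N j) w).
  move=> F_q w; rewrite /T pevalB !pevalM !pevalX' pevalX.
  have := eDP _ idfun (q ord0) F_q; rewrite aE // -!peval_mmap => <-.
  have := eNP _ idfun (q ord0) F_q; rewrite aE // -!peval_mmap => <-.
  by rewrite -/w; ring.
have T_Y : vanishing Y T.
  apply: (general_vanishing (g := g * D)); first by rewrite mulf_neq0.
  move=> v; rewrite pevalM mulf_eq0 negb_or => /andP[/g_crit v_crit D_v]; split=> //.
  have [Yq F_q [h h_Y eq_v]] := crit_points_conormal v_crit.
  have [VY0 VYD VYM] := vanishing_ideal Y.
  (* Since [v] is the logarithmic gradient plus [grad h], adding [grad (f - h)] exchanges [h] for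
     [f], and [Psi_constant] applies to [f - h]. *)
  have fh_Y : vanishing Y (f - h).
    by move=> q Yq'; rewrite pevalB f_Y // h_Y // subrr.
  have := Psi_constant j D_v fh_Y; rewrite pgradD pgradN.
  have -> : v + (pgrad f (reval N D v) - pgrad h (reval N D v)) =
      (peval F (reval N D v))^-1 *: pgrad F (reval N D v) + pgrad f (reval N D v).
    by rewrite {1}eq_v -addrA; congr (_ + _); rewrite addrC subrK.
  by move=> eq_N; rewrite TE // eq_N subrr mulr0.
have := TE p F_p; rewrite T_Y // -eq_u => /esym/eqP.
rewrite !mulf_eq0 !expf_eq0 (negbTE F_p) !andbF /= subr_eq0 => /eqP.
exact.
Qed.

End Backward.

Lemma MLE_like_crit_points (R : realType) (n : nat) (Y : set 'rV[R[i]]_n)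
    (F : mpoly n R[i]) (N : 'I_n -> mpoly n R[i]) (D : mpoly n R[i]) :
  affine_cone_of_proj_variety Y -> MLE_like F Y N D ->
  general (fun u => rdom D u /\ forall p, crit_points F Y u p <-> p = reval N D u).
Proof.
move=> Y_cone [Psi_map Psi_dom Psi_hom Psi_grad]; have [D0 _] := Psi_map.
pose M : fieldType := {fraction (mpoly n R[i])}.
pose tof : {rmorphism mpoly n R[i] -> M} := @tofrac (mpoly n R[i]).
have tof_inj : injective tof by move=> a b /eqP; rewrite tofrac_eq => /eqP.
have tof_frac m : exists a b, tof b != 0 /\ m = tof a / tof b.
  have [a [b [b0 eq_m]]] := fraction_numden m.
  by exists a, b; rewrite tofrac_eq0.
have [d [d_der d_tof d_comm]] := partial_derivations tof_inj tof_frac.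
have Psi_eq j : tof D * (tof (N j) / tof D) = tof (N j).
  by rewrite mulrC divfK // tofrac_eq0.
have [g [g0 g_crit]] := Psi_critical tof_inj tof_frac Y_cone Psi_map Psi_dom
  d_der d_tof d_comm Psi_eq Psi_hom Psi_grad.
have [h [h0 h_crit]] := critical_Psi tof_inj tof_frac Y_cone Psi_map Psi_dom
  d_der d_tof d_comm Psi_eq Psi_hom Psi_grad.
exists (D * (g * h)); split=> [|u]; first by rewrite !mulf_neq0.
rewrite !pevalM !mulf_eq0 !negb_or => /and3P[D_u g_u h_u]; split=> // p.
by split=> [|->]; [exact: h_crit | exact: g_crit].
Qed.

Theorem theorem3p1 (R : realType) (n : nat) (Y : set 'rV[R[i]]_n)
    (F : mpoly.mpoly n R[i]) :
  affine_cone_of_proj_variety Y -> homogeneous F ->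
  (MLD_eq F Y 1 <-> exists N D, MLE_like F Y N D) /\
  (forall N D, MLE_like F Y N D ->
     general (fun u => rdom D u /\
       forall p, crit_points F Y u p <-> p = reval N D u)).
Proof.
move=> Y_cone F_hom; split; last by move=> N D; exact: MLE_like_crit_points.
split; first exact: MLD1_MLE_like.
move=> [N [D /(MLE_like_crit_points Y_cone)[g [g_neq0 g_crit]]]].
exists g; split=> // u /g_crit[D_u crit]; exists [:: reval N D u]; split=> // p.
by rewrite inE; split=> [/crit -> //|/eqP ->]; apply/crit.
Qed.
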